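(* Let $p\mapsto Q_p(z)$ be Frobenian with respect to the finite Galois extension $E/\mathbb{Q}$, where each $Q_p(z)$ is holomorphic on (a branch cut of) the open unit disk, save for a set of isolated singularities, and is holomorphic at $z=0$ with $Q_p(0)=1$. Let $r$ be the smallest magnitude of a singularity of $Q_p(z)$ for any $p$, and let $\mathcal{Q}(s)=\prod_p Q_p(p^{-s})$ be the corresponding Euler product. Then: (i) There exists a sequence of complex numbers $b_{n,\rho}=b_{n,\rho}(Q)$, indexed by positive integers $n$ and irreducible complex representations $\rho$ of $\mathrm{Gal}(E/\mathbb{Q})$ (up to isomorphism), such that for all but finitely many primes $p$ $$\log Q_p(z) = -\sum_{n,\rho} b_{n,\rho}\log\det(I-\rho(\mathrm{Fr}_p)z^n)$$ as formal power series centered at $z=0$. (ii) For each $\epsilon>0$, $$\mathcal{Q}(s)\prod_{p\le r^{-1/\epsilon}}Q_p(p^{-s})^{-1}\prod_{n\le 1/\epsilon}\prod_\rho L(ns,\rho)^{-b_{n,\rho}}$$ is an absolutely convergent Dirichlet series (and so holomorphic) on the right half-plane $\mathrm{Re}(s)>\epsilon$.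
   Context: A function $f$ from the set of rational primes to a set $A$ is Frobenian with respect to a finite Galois extension $E/\mathbb{Q}$ if there are a finite set $S$ of primes (including those ramified in $E$) and a class function $c:\mathrm{Gal}(E/\mathbb{Q})\to A$ (constant on conjugacy classes) with $f(p)=c(\mathrm{Fr}_p)$ for all $p\notin S$, where $\mathrm{Fr}_p$ is a Frobenius element at $p$. Here $A$ is a set of complex functions of $z$. For $\rho:\mathrm{Gal}(E/\mathbb{Q})\to \mathrm{GL}(V)$, the Artin $L$-function is $L(s,\rho)=\prod_p\det(I-\rho(\mathrm{Fr}_p|V^{I_p})p^{-s})^{-1}$, where $V^{I_p}$ is the subspace fixed by an inertia group $I_p$ at $p$. Logarithms in (i) are formal logarithms of power series with constant term $1$. Complex powers are $w^\alpha=e^{\alpha\log w}$ for a branch of the logarithm; for Euler factors $\det(I-\rho(\mathrm{Fr}_p|V^{I_p})p^{-ns})^{b}$ with $\mathrm{Re}(s)>0$ they are given by the power series in $p^{-ns}$ with constant term $1$. ''A branch cut of'' a domain means the domain with curves (cuts) removed that start at singularities and prevent loops around singularities of non-integral order. The cuts are taken to start at singularities and run outward, so that they do not meet the disk $|z|<r$; thus each $Q_p$ is holomorphic on $|z|<\min(r,1)$ and equal to its Taylor series there. If no $Q_p$ has a singularity in the open unit disk, then $r$ is understood to be $\ge1$, so that the product over $p\le r^{-1/\epsilon}$ is empty. The expression in (ii) is understood as an Euler product, multiplied prime by prime: $L(ns,\rho)^{-b}=\prod_p\det(I-\rho(\mathrm{Fr}_p|V^{I_p})p^{-ns})^{b}$,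 and multiplying by $Q_p(p^{-s})^{-1}$ cancels the factor of $\mathcal{Q}(s)$ at $p$. *)

(* Defs.v *)
From HB Require Import structures.
From mathcomp Require Import all_boot all_order all_algebra all_fingroup.
From mathcomp Require Import all_solvable all_field all_character.
From mathcomp Require Import complex.
From mathcomp Require Import all_classical all_reals all_analysis.

Set Implicit Arguments.
Unset Strict Implicit.
Unset Printing Implicit Defensive.

Import Order.TTheory GRing.Theory Num.Theory numFieldNormedType.Exports.
Local Open Scope ring_scope.
Local Open Scope classical_set_scope.
Local Open Scope complex_scope.

(* MathComp-Analysis puts its topology on structures of type [numFieldType];
   the bare type [R[i]] has none. *)
Definition Cplx (R : realType) : numFieldType := R[i].

(** * Formal power series, given by their coefficients *)

Section FormalSeries.
Variable F : fieldType.
Implicit Types a c : nat -> F.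

Definition trunc_poly a (m : nat) : {poly F} := \poly_(i < m.+1) a i.

(* log (1 + u) = \sum_(k >= 1) (-1)^(k+1) u^k / k for a = 1 + u with u 0 = 0;
   the terms with k > m do not contribute to the coefficient of degree m, and
   that coefficient only depends on a modulo degree m + 1. *)
Definition fps_log a : nat -> F := fun m =>
  \sum_(1 <= k < m.+1) (-1) ^+ k.+1 / k%:R * ((trunc_poly a m - 1) ^+ k)`_m.

(* Meant for a 0 = 0. *)
Definition fps_exp a : nat -> F := fun m =>
  \sum_(0 <= k < m.+1) (k`!%:R)^-1 * (trunc_poly a m ^+ k)`_m.

Definition fps_pow a (b : F) : nat -> F := fps_exp (fun m => b * fps_log a m).

End FormalSeries.

(* det (I - A z^n), as a polynomial in z *)
Definition det_poly (F : fieldType) (d : nat) (A : 'M[F]_d) (n : nat) :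
    {poly F} := \det (1%:M - 'X^n *: map_mx polyC A).

(** * Complex analysis *)

Section Complex.
Variable R : realType.
Local Notation C := (Cplx R).

Definition cexp (z : C) : C :=
  (expR (complex.Re z))%:C * (cos (complex.Im z) +i* sin (complex.Im z)).

(* n ^ w *)
Definition npow (n : nat) (w : C) : C := cexp (w * (ln (n%:R : R))%:C).

Definition holomorphic_on (D : set C) (f : C -> C) : Prop :=
  open D /\ forall z, D z -> derivable f z 1.

Definition taylor (f : C -> C) : nat -> C := fun n => derive1n n f 0 / n`!%:R.

Definition fps_eval (c : nat -> C) (z : C) : C :=
  limn (series (fun k => c k * z ^+ k)).

Definition unit_disk : set C := [set z | `|z| < 1].

Definition cut_disk (Sing branch : set C) (cut : C -> R -> C) : set C :=
  unit_disk `\` (Sing `|` \bigcup_(a in branch) (cut a @` `[0, 1[)).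

(* The cut [cut a] starts at the singularity [a] and its modulus does not
   decrease along it; it is parametrized by [0, 1[ so as to allow cuts that
   accumulate at the boundary. That loops around singularities of non-integral
   order are cut is expressed by [f] being a function, single-valued and
   holomorphic on the whole of [cut_disk]. *)
Definition holomorphic_cut_disk (f : C -> C) (Sing : set C) : Prop :=
  exists (branch : set C) (cut : C -> R -> C),
    let D := cut_disk Sing branch cut in
    [/\ Sing `<=` unit_disk /\
          (forall z, unit_disk z -> \forall w \near z, Sing w -> w = z),
        branch `<=` Sing,
        (forall a, branch a ->
          [/\ cut a 0 = a,
              {within `[0, 1[, continuous (cut a)} &
              {in `[0, 1[ &, forall t u, t <= u ->
                `|cut a t| <= `|cut a u|}]),
        holomorphic_on D f &
        (forall a, Sing a -> ~ (exists (U : set C) (g : C -> C),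
          [/\ U a, holomorphic_on U g &
              forall z, (U `&` D) z -> f z = g z]))].

(* The second case fixes the meaning of r when there is no singularity. *)
Definition smallest_singularity (Sing : nat -> set C) (r : R) : Prop :=
  (exists p a, [/\ prime p, Sing p a, `|a| = r%:C &
     forall q c, prime q -> Sing q c -> r%:C <= `|c|])
  \/ ((forall p, prime p -> Sing p = set0) /\ 1 <= r).

End Complex.

(** * Frobenius elements *)

Section Frobenius.
Variable L : splittingFieldType rat.

Definition galQ : {group gal_of {:L}} := 'Gal({:L} / 1)%G.

Definition alg_int : set L := [set x | integralOver (intr : int -> L) x].

Definition ideal_of_int (P : set L) : Prop :=
  [/\ P `<=` alg_int, P 0, (forall x y, P x -> P y -> P (x + y)) &
      (forall a x, alg_int a -> P x -> P (a * x))].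

Definition prime_above (p : nat) (P : set L) : Prop :=
  [/\ ideal_of_int P, ~ P 1,
      (forall x y, alg_int x -> alg_int y -> P (x * y) -> P x \/ P y) &
      P p%:R].

(* p belongs to P^2 for some prime ideal P above p *)
Definition ramified (p : nat) : Prop :=
  exists P : set L, prime_above p P /\
    exists s : seq (L * L), (forall xy, xy \in s -> P xy.1 /\ P xy.2) /\
      p%:R = \sum_(xy <- s) xy.1 * xy.2.

Definition inertia (P : set L) : {set gal_of {:L}} :=
  [set g in galQ | `[< forall x, alg_int x -> P (g x - x) >]].

(* Such a g stabilizes P, as x \in P implies g x \in P. When p is ramified,
   it is only determined up to the inertia group. *)
Definition frobenius_at (p : nat) (P : set L) (g : gal_of {:L}) : Prop :=
  [/\ prime_above p P, g \in galQ & forall x, alg_int x -> P (g x - x ^+ p)].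

(* In [c (g ^ h)] the operation is conjugation. *)
Definition frobenian (A : Type) (f : nat -> A) : Prop :=
  exists (S : seq nat) (c : gal_of {:L} -> A),
    [/\ (forall p, prime p -> ramified p -> p \in S),
        (forall g h, g \in galQ -> h \in galQ -> c (g ^ h)%g = c g) &
        (forall p, prime p -> p \notin S ->
          forall P g, frobenius_at p P g -> f p = c g)].

End Frobenius.

(** * Artin Euler factors *)

Section Artin.
Variables (R : realType) (L : splittingFieldType rat).
Local Notation C := (Cplx R).
Local Notation G := (galQ L).

(* The isomorphism classes of irreducible representations of G over R[i]; the
   class W is represented by [irr_repr W]. Matrices act on row vectors and
   products in 'Gal compose from left to right, so that these are the
   transposes of the usual representations; this changes no determinant. *)
Definition irr_classes : irrType R[i] G := DecSocleType (regular_repr R[i] G).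

(* det (I - rho(g | V^I) z), with I the inertia group at P *)
Definition artin_poly (d : nat) (rho : mx_representation R[i] G d)
    (P : set L) (g : gal_of {:L}) : {poly R[i]} :=
  det_poly (restrictmx (rfix_mx rho (inertia P)) (rho g)) 1.

(* det (I - rho(g | V^I) z) ^ b *)
Definition artin_pow (d : nat) (rho : mx_representation R[i] G d)
    (P : set L) (g : gal_of {:L}) (b z : C) : C :=
  fps_eval (fps_pow (fun k => (artin_poly rho P g)`_k : C) b) z.

(* The Euler factor at p of the product of Q(s), of the Q_p(p^-s)^-1 with
   p <= r^(-1/eps), and of the L(ns, rho)^(-b n rho) with n <= 1/eps; P is the
   chosen prime ideal above p and g the chosen Frobenius element at P. *)
Definition residual_factor (Q : nat -> C -> C) (r eps : R)
    (b : nat -> irr_classes -> C) (P : set L) (g : gal_of {:L})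
    (p : nat) (s : C) : C :=
  (if p%:R <= r `^ (- eps^-1) then 1 else Q p (npow p (- s))) *
  \prod_(1 <= n < (Num.truncn eps^-1).+1) \prod_W
    artin_pow (irr_repr W) P g (b n W) (npow p (- (n%:R * s))).

End Artin.

(* Main.v *)
Require Import Defs.
From HB Require Import structures.
From mathcomp Require Import all_boot all_order all_algebra all_fingroup.
From mathcomp Require Import all_solvable all_field all_character.
From mathcomp Require Import complex.
From mathcomp Require Import all_classical all_reals all_analysis.
From mathcomp Require Import ring lra zify.

(** Let [G] be the Galois group. Outside a finite set of primes, [Q p] only
    depends on the class of a Frobenius element at [p], so that finitely many
    functions [c g] occur, and for each [m] the coefficient of degree [m] of
    [log (c g)] is a class function of [g]. On the other side, the coefficient
    of degree [m] of [log det (I - rho g z^n)] is 0 unless [n] divides [m], and is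
    [- (n / m) tr (rho (g ^ (m / n)))] otherwise. Hence the equation of degree
    [m] in (i) only involves the [b n rho] with [n <= m], and those with
    [n = m] through [\sum_rho b m rho tr (rho g)]. The irreducible characters
    span the class functions ([characters_span]), and this determines the
    [b m rho] one degree after the other, for all [g] at once
    ([exponents_exist]).

    For (ii), let [N] be the integral part of [1 / eps]. The factor at [p] of
    [L (n s, rho) ^ - b] is [det (I - rho g p^(- n s)) ^ b], so that the factors
    with [n <= N] cancel the terms of degree at most [N] of [log (Q p)]: for all
    large [p], the local factor is a power series in [z = p^-s] of the form
    [1 + O(z^(N+1))] ([factor_coef_vanish]). Here [p] has to be large enough for
    the inertia groups to be trivial, which is the case because a non-trivial
    element [h] of [G] moves some algebraic integer [x], and [h x - x] divides a
    non-zero integer ([inertia_trivial]). As finitely many series occur, the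
    implied constant does not depend on [p] ([class_bound]), and as
    [(N + 1) Re s > 1] the deviations from 1 are summable over [p]
    ([local_bounds]). Under such a bound the product expands into an absolutely
    convergent Dirichlet series ([euler_product]), which is holomorphic because
    it can be differentiated term by term ([dirichlet_holomorphic]).

    For each of the remaining primes, finite in number, it is enough that the
    local factor is an absolutely convergent power series. For the Artin factors
    this holds on the unit disc: a Frobenius element has finite order, so that
    its eigenvalues have modulus 1 and the coefficients of [det ^ b] grow
    polynomially ([log_deriv_growth]). For [Q p] with [p > r^(-1/eps)] one has
    [|p^-s| < min (r, 1)] when [Re s > eps], and there [Q p] is the sum of its
    Taylor series ([holomorphic_expands]).

    The expansion of a holomorphic function [f] on a disc is obtained without
    contour integrals along circles. Goursat's argument on triangles gives a
    primitive [F] of [f] ([primitive_on_disc]). The mean of a Cauchy kernel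
    [F w * w / (w - z)] over the vertices [w] of a regular polygon is the sum of a
    power series in [z], for any number of vertices. With [zeta = z + t (w - z)],
    the derivative in [t] of the mean of [F zeta * w / (w - z)] is the mean of
    [f zeta * w], which is close to 0 because the points [zeta] form a closed
    polygon along which the increments of [F] cancel. So [F z] is the limit of these means, and the limit
    of a power series along an ultrafilter is a power series
    ([c1_power_series]). Then [f], the derivative of [F], is the sum of the
    derived series.

    The formal logarithm and exponential are only used through the relation
    [a' = l' a] between a series [a] and its logarithm [l] ([log_deriv]). It
    determines [l] up to a constant, and it is compatible with products and with
    the substitution of [z^n] for [z]. *)

Set Implicit Arguments.
Unset Strict Implicit.
Unset Printing Implicit Defensive.

Import Order.TTheory GRing.Theory Num.Theory numFieldNormedType.Exports.
Local Open Scope ring_scope.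
Local Open Scope classical_set_scope.
Local Open Scope complex_scope.

(** * The modulus as a real number *)
Section Modulus.
Variable R : realType.
Local Notation C := (Cplx R).
Implicit Types (z w : C) (x : R).

Definition cmod (z : C) : R := complex.Re `|z|.

Lemma cmodE z : `|z| = (cmod z)%:C.
Proof. by rewrite /cmod normc_def. Qed.

Lemma cmod_sqrt z :
  cmod z = Num.sqrt (complex.Re z ^+ 2 + complex.Im z ^+ 2).
Proof. by rewrite /cmod normc_def. Qed.

Lemma cmod_ge0 z : 0 <= cmod z.
Proof. by rewrite cmod_sqrt sqrtr_ge0. Qed.

Lemma ltr_cmod z x : (`|z| < x%:C) = (cmod z < x).
Proof. by rewrite cmodE ltcR. Qed.

Lemma ler_cmod z x : (`|z| <= x%:C) = (cmod z <= x).
Proof. by rewrite cmodE lecR. Qed.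

Lemma cmodM z w : cmod (z * w) = cmod z * cmod w.
Proof. by apply: complexI; rewrite rmorphM -!cmodE normrM. Qed.

Lemma cmodD z w : cmod (z + w) <= cmod z + cmod w.
Proof. by rewrite -lecR rmorphD -!cmodE ler_normD. Qed.

Lemma cmodN z : cmod (- z) = cmod z.
Proof. by apply: complexI; rewrite -!cmodE normrN. Qed.

Lemma cmodBC z w : cmod (z - w) = cmod (w - z).
Proof. by rewrite -cmodN opprB. Qed.

Lemma cmodB z w : cmod (z - w) <= cmod z + cmod w.
Proof. by rewrite -(cmodN w) cmodD. Qed.

Lemma cmod_dist_trans w z v : cmod (z - v) <= cmod (z - w) + cmod (w - v).
Proof. by have -> : z - v = (z - w) + (w - v); [ring | exact: cmodD]. Qed.

Lemma cmod0 : cmod 0 = 0.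
Proof. by rewrite /cmod normr0. Qed.

Lemma cmod1 : cmod 1 = 1.
Proof. by rewrite /cmod normr1. Qed.

Lemma cmod_eq0 z : (cmod z == 0) = (z == 0).
Proof.
by rewrite -[RHS]normr_eq0 cmodE; apply/eqP/eqP => [->//|]; exact: complexI.
Qed.

Lemma cmod_gt0 z : (0 < cmod z) = (z != 0).
Proof. by rewrite lt_neqAle cmod_ge0 andbT eq_sym cmod_eq0. Qed.

Lemma cmod_le0 z : (cmod z <= 0) = (z == 0).
Proof. by rewrite leNgt cmod_gt0 negbK. Qed.

Lemma cmodV z : cmod z^-1 = (cmod z)^-1.
Proof.
have [->|z0] := eqVneq z 0; first by rewrite !(cmod0, invr0).
apply: (@mulIf _ (cmod z)); first by rewrite cmod_eq0.
by rewrite -cmodM mulVf// cmod1 mulVf// cmod_eq0.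
Qed.

Lemma cmodX z n : cmod (z ^+ n) = cmod z ^+ n.
Proof. by elim: n => [|n IH]; rewrite ?cmod1// !exprS cmodM IH. Qed.

Lemma cmod_real x : cmod x%:C = `|x|.
Proof. by rewrite cmod_sqrt /= expr0n addr0 sqrtr_sqr. Qed.

Lemma cmod_nat n : cmod n%:R = n%:R.
Proof. by rewrite -(rmorph_nat (real_complex R)) cmod_real normr_nat. Qed.

Lemma Re_le_cmod z : `|complex.Re z| <= cmod z.
Proof. by rewrite -sqrtr_sqr cmod_sqrt ler_wsqrtr// lerDl sqr_ge0. Qed.

Lemma Im_le_cmod z : `|complex.Im z| <= cmod z.
Proof. by rewrite -sqrtr_sqr cmod_sqrt ler_wsqrtr// lerDr sqr_ge0. Qed.

Lemma ReIm_decomposition z : z = (complex.Re z)%:C + (complex.Im z)%:C * 'i.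
Proof. by rewrite mulrC; exact: complexE. Qed.

Lemma cmod_le_ReIm z : cmod z <= `|complex.Re z| + `|complex.Im z|.
Proof.
rewrite {1}(ReIm_decomposition z) (le_trans (cmodD _ _))// cmodM !cmod_real.
by rewrite cmod_sqrt/= expr0n expr1n add0r sqrtr1 mulr1.
Qed.

Lemma ReD z w : complex.Re (z + w) = complex.Re z + complex.Re w.
Proof. by case: z w => [? ?] []. Qed.
Lemma ImD z w : complex.Im (z + w) = complex.Im z + complex.Im w.
Proof. by case: z w => [? ?] []. Qed.
Lemma ReN z : complex.Re (- z) = - complex.Re z.
Proof. by case: z. Qed.
Lemma ImN z : complex.Im (- z) = - complex.Im z.
Proof. by case: z. Qed.
Lemma ReM z w : complex.Re (z * w) =
  complex.Re z * complex.Re w - complex.Im z * complex.Im w.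
Proof. by case: z w => [? ?] []. Qed.
Lemma ImM z w : complex.Im (z * w) =
  complex.Re z * complex.Im w + complex.Im z * complex.Re w.
Proof. by case: z w => [? ?] []. Qed.

Lemma eq_ReIm z w :
  complex.Re z = complex.Re w -> complex.Im z = complex.Im w -> z = w.
Proof. by case: z w => [? ?] [? ?] /= -> ->. Qed.

Lemma Re_sum I (s : seq I) (P : pred I) (F : I -> C) :
  complex.Re (\sum_(i <- s | P i) F i) = \sum_(i <- s | P i) complex.Re (F i).
Proof. by apply: (big_morph (@complex.Re R)) => // z w; exact: ReD. Qed.

Lemma Im_sum I (s : seq I) (P : pred I) (F : I -> C) :
  complex.Im (\sum_(i <- s | P i) F i) = \sum_(i <- s | P i) complex.Im (F i).
Proof. by apply: (big_morph (@complex.Im R)) => // z w; exact: ImD. Qed.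

Lemma cmod_sum I (s : seq I) (P : pred I) (F : I -> C) :
  cmod (\sum_(i <- s | P i) F i) <= \sum_(i <- s | P i) cmod (F i).
Proof.
elim/big_rec2: _ => [|i x z _ le_zx]; first by rewrite cmod0.
by rewrite (le_trans (cmodD _ _))// lerD.
Qed.

Lemma cmod_small_eq z w : (forall e : R, 0 < e -> cmod (z - w) <= e) -> z = w.
Proof.
move=> small; apply/eqP; rewrite -subr_eq0 -cmod_le0; apply/ler_addgt0Pl => e e0.
by rewrite addr0 small.
Qed.

End Modulus.

(** * Limits and absolutely convergent series *)
Section Limits.
Variable R : realType.
Local Notation C := (Cplx R).
Implicit Types (u v w : nat -> C) (l S : C) (M e : R).

(** With real error bounds and complex values, as a norm with values in the field
    itself does not fit the real estimates used throughout. *)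
Definition tends u l := forall e, 0 < e ->
  exists N, forall n, (N <= n)%N -> cmod (u n - l) <= e.

Definition sums_to u S := tends (fun n => \sum_(i < n) u i) S.

Definition abs_bounded u M := forall n, \sum_(i < n) cmod (u i) <= M.

Definition abs_summable u := exists M, abs_bounded u M.

Lemma tends_cvg u l : tends u l -> u @ \oo --> l.
Proof.
move=> ul; apply/cvgrPdist_le => e e0.
have eE : e = (complex.Re e)%:C by rewrite RRe_real// gtr0_real.
have [|N HN] := ul (complex.Re e); first by rewrite -ltcR -eE.
by exists N => // n /= Nn; rewrite distrC eE ler_cmod HN.
Qed.

Lemma cvg_tends u l : u @ \oo --> l -> tends u l.
Proof.
move=> /cvgrPdist_le ul e e0.
have [|N _ HN] := ul e%:C; first by rewrite ltcR.
by exists N => n Nn; rewrite cmodBC -ler_cmod HN.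
Qed.

Lemma sums_to_cvg u S : sums_to u S -> series u @ \oo --> S.
Proof.
by move=> /tends_cvg; rewrite seriesEord.
Qed.

Lemma sums_to_limn u S : sums_to u S -> limn (series u) = S.
Proof. by move=> /sums_to_cvg; apply: cvg_lim; exact: norm_hausdorff. Qed.

Lemma tends_unique u l l' : tends u l -> tends u l' -> l = l'.
Proof.
move=> ul ul'; apply: cmod_small_eq => e e0.
have [|N HN] := ul (e / 2); first by rewrite divr_gt0.
have [|N' HN'] := ul' (e / 2); first by rewrite divr_gt0.
rewrite (le_trans (cmod_dist_trans (u (maxn N N')) _ _))// cmodBC.
by rewrite [leRHS]splitr lerD// ?HN ?HN'// ?leq_maxl ?leq_maxr.
Qed.

Lemma eq_tends N u v l : (forall n, (N <= n)%N -> u n = v n) ->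
  tends u l -> tends v l.
Proof.
move=> uv ul e e0; have [N' HN'] := ul e e0; exists (maxn N N') => n.
by rewrite geq_max => /andP[Nn N'n]; rewrite -uv// HN'.
Qed.

Lemma eq_sums_to u v S : u =1 v -> sums_to u S -> sums_to v S.
Proof. by move=> uv; apply: (@eq_tends 0) => n _; exact: eq_bigr. Qed.

Lemma tends_cst l : tends (fun=> l) l.
Proof. by move=> e /ltW e0; exists 0%N => n _; rewrite subrr cmod0. Qed.

Lemma tendsD u v l l' : tends u l -> tends v l' ->
  tends (fun n => u n + v n) (l + l').
Proof.
move=> ul ul' e e0.
have [|N HN] := ul (e / 2); first by rewrite divr_gt0.
have [|N' HN'] := ul' (e / 2); first by rewrite divr_gt0.
exists (maxn N N') => n; rewrite geq_max => /andP[Nn N'n].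
have -> : u n + v n - (l + l') = (u n - l) + (v n - l') by ring.
by rewrite (le_trans (cmodD _ _))// [leRHS]splitr lerD ?HN ?HN'.
Qed.

Lemma tendsZ a u l : tends u l -> tends (fun n => a * u n) (a * l).
Proof.
move=> ul e e0; have a0 : 0 < cmod a + 1 by rewrite ltr_wpDl ?cmod_ge0.
have [|N HN] := ul (e / (cmod a + 1)); first by rewrite divr_gt0.
exists N => n Nn; rewrite -mulrBr cmodM.
have := HN n Nn; rewrite ler_pdivlMr// => h; apply: le_trans h.
by rewrite mulrC ler_wpM2l ?cmod_ge0// lerDl.
Qed.

Lemma tendsB u v l l' : tends u l -> tends v l' ->
  tends (fun n => u n - v n) (l - l').
Proof.
move=> ul /(tendsZ (-1)) vl; rewrite -mulN1r.
by apply: (@eq_tends 0) (tendsD ul vl) => n _; rewrite mulN1r.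
Qed.

Lemma tends_bound u l M : tends u l -> (forall n, cmod (u n) <= M) ->
  cmod l <= M.
Proof.
move=> ul uM; apply/ler_addgt0Pr => e e0; have [N HN] := ul e e0.
rewrite -(subrK (u N) l) (le_trans (cmodD _ _))// addrC lerD//.
by rewrite cmodBC HN.
Qed.

Lemma tendsM u v l l' : tends u l -> tends v l' ->
  tends (fun n => u n * v n) (l * l').
Proof.
by move=> /tends_cvg ul /tends_cvg vl; apply: cvg_tends; exact: cvgM ul vl.
Qed.

Lemma sums_toD u v S S' : sums_to u S -> sums_to v S' ->
  sums_to (fun n => u n + v n) (S + S').
Proof.
move=> uS vS; apply: (@eq_tends 0) (tendsD uS vS) => n _.
by rewrite big_split.
Qed.

Lemma sums_toZ a u S : sums_to u S -> sums_to (fun n => a * u n) (a * S).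
Proof.
by move=> uS; apply: (@eq_tends 0) (tendsZ a uS) => n _; rewrite big_distrr.
Qed.

Lemma sums_toB u v S S' : sums_to u S -> sums_to v S' ->
  sums_to (fun n => u n - v n) (S - S').
Proof.
move=> uS vS; apply: (@eq_tends 0) (tendsB uS vS) => n _.
by rewrite sumrB.
Qed.

Lemma sums_to_bound u S M : sums_to u S -> abs_bounded u M -> cmod S <= M.
Proof.
by move=> uS uM; apply: tends_bound uS _ => n; exact: le_trans (cmod_sum _ _ _) _.
Qed.

Lemma abs_summable_le u v a : (forall n, cmod (u n) <= a * cmod (v n)) ->
  abs_summable v -> abs_summable u.
Proof.
move=> uv [M vM]; exists (`|a| * M) => n.
apply: (@le_trans _ _ (\sum_(i < n) a * cmod (v i))).
  by apply: ler_sum => i _; exact: uv.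
rewrite -big_distrr/=.
rewrite (le_trans (ler_norm _))// normrM ler_wpM2l// ger0_norm ?vM//.
by apply: sumr_ge0 => i _; exact: cmod_ge0.
Qed.

(** The form in which a convergent majorant is used: all later increments are
    small, with no mention of the limit. *)
Lemma mono_bounded_cauchy (a : nat -> R) M :
  {homo a : m n / (m <= n)%N >-> m <= n} -> (forall n, a n <= M) ->
  forall e, 0 < e -> exists m, forall n, (m <= n)%N -> a n - a m <= e.
Proof.
move=> amono aM e e0.
have hs : has_sup (range a).
  by split; [exists (a 0%N); exists 0%N | exists M => _ [n _ <-]].
have [_ [m _ <-] ltm] := sup_adherent e0 hs.
exists m => n mn; rewrite lerBlDr -lerBlDl; apply: le_trans (ltW ltm).
rewrite lerD2r; apply: ub_le_sup; last by exists n.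
by exists M => _ [k _ <-].
Qed.

Lemma cmod_sum_mono u :
  {homo (fun n => \sum_(i < n) cmod (u i)) : m n / (m <= n)%N >-> m <= n}.
Proof.
move=> m n /subnK <-; rewrite addnC big_split_ord/= lerDl.
by apply: sumr_ge0 => i _; exact: cmod_ge0.
Qed.

(** The real and imaginary parts are absolutely convergent real series. *)
Lemma abs_summable_sums u : abs_summable u -> exists S, sums_to u S.
Proof.
move=> [M uM].
have real_cvg (x : nat -> R) : (forall n, `|x n| <= cmod (u n)) -> cvgn (series x).
  move=> xu; apply: normed_cvg; apply: nondecreasing_is_cvgn.
    by apply: nondecreasing_series => *; exact: normr_ge0.
  exists M => _ [n _ <-]; rewrite /normed_series_of /series/= big_mkord.
  by apply: le_trans (uM n); exact: ler_sum.
have /cvg_ex[a ca] := real_cvg _ (fun n => Re_le_cmod (u n)).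
have /cvg_ex[b cb] := real_cvg _ (fun n => Im_le_cmod (u n)).
exists (a +i* b) => e e0; have e2 : 0 < e / 2 by rewrite divr_gt0.
have [N _ HN] := (cvgrPdist_le _ _).1 ca _ e2.
have [N' _ HN'] := (cvgrPdist_le _ _).1 cb _ e2.
exists (maxn N N') => n; rewrite geq_max => /andP[Nn N'n].
rewrite (le_trans (cmod_le_ReIm _))// [leRHS]splitr.
have := HN n Nn; have := HN' n N'n; rewrite !seriesEord/= => h' h.
by rewrite ReD ImD ReN ImN Re_sum Im_sum/= lerD// distrC.
Qed.

Lemma abs_summable_cvg u : abs_summable u ->
  cvgn (series (fun n => `|u n|)).
Proof.
move=> [M uM]; have [|S cS] := @abs_summable_sums (fun n => (cmod (u n))%:C).
  by exists M => n; under eq_bigr do rewrite cmod_real ger0_norm ?cmod_ge0//.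
apply/cvg_ex; exists S; apply: sums_to_cvg; apply: eq_sums_to cS => n.
by rewrite cmodE.
Qed.

End Limits.

(** * Products of series under a change of index *)
Section ReindexedProduct.
(** The sum of all [u i * v j] with [k i j = m], for an index map whose fibers
    are finite. [k := addn] gives the Cauchy product of power series,
    [k i j := (i.+1 * j.+1).-1] the product of Dirichlet series indexed from 0,
    and a [v] with a single non-zero term reindexes a series. *)
Definition conv (A : pzSemiRingType) (k : nat -> nat -> nat) (u v : nat -> A) :
    nat -> A := fun m =>
  \sum_(i < m.+1) \sum_(j < m.+1 | k i j == m) u i * v j.

(** This makes the fibers finite, and a sum over [m < n] only involves the terms
    with [i < n] and [j < n]. *)
Definition increasing_index (k : nat -> nat -> nat) :=
  forall i j, (i <= k i j)%N /\ (j <= k i j)%N.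

Variable k : nat -> nat -> nat.
Hypothesis kP : increasing_index k.

Lemma conv_widen (A : pzSemiRingType) (u v : nat -> A) m n : (m < n)%N ->
  conv k u v m = \sum_(i < n) \sum_(j < n | k i j == m) u i * v j.
Proof.
move=> mn; rewrite /conv.
rewrite (big_ord_widen _ (fun i => \sum_(j < m.+1 | k i j == m) u i * v j) mn).
rewrite big_mkcond/=; apply: eq_bigr => i _.
rewrite (big_ord_widen_cond _ (fun j => k i j == m) (fun j => u i * v j) mn).
case: ifPn => [_|im].
  apply: eq_bigl => j; case: eqP => //= <-; rewrite ltnS.
  by have [_ ->] := kP i j.
by rewrite big1// => j /eqP kij; case/negP: im; rewrite ltnS -kij; case: (kP i j).
Qed.

Lemma sum_conv (A : pzSemiRingType) (u v : nat -> A) n :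
  \sum_(m < n) conv k u v m =
  \sum_(i < n) \sum_(j < n | (k i j < n)%N) u i * v j.
Proof.
under eq_bigr => m _ do rewrite (conv_widen u v (ltn_ord m)).
rewrite exchange_big/=; apply: eq_bigr => i _.
under eq_bigr => m _ do rewrite big_mkcond.
rewrite exchange_big/= [RHS]big_mkcond; apply: eq_bigr => j _.
case: ifPn => [kn|kn]; last first.
  by rewrite big1// => m _; case: eqP => // km; case/negP: kn; rewrite km.
rewrite (bigD1 (Ordinal kn))//= eqxx big1 ?addr0// => m /negPf.
by rewrite eq_sym -val_eqE/= => ->.
Qed.

Variable R : realType.
Local Notation C := (Cplx R).
Implicit Types (u v : nat -> C).

Lemma cmod_conv u v m :
  cmod (conv k u v m) <= conv k (fun i => cmod (u i)) (fun i => cmod (v i)) m.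
Proof.
rewrite (le_trans (cmod_sum _ _ _))//; apply: ler_sum => i _.
rewrite (le_trans (cmod_sum _ _ _))//; apply: ler_sum => j _.
by rewrite cmodM.
Qed.

Lemma sum_conv_le (u v : nat -> R) (M N : R) :
  (forall n, 0 <= u n) -> (forall n, 0 <= v n) ->
  (forall n, \sum_(i < n) u i <= M) -> (forall n, \sum_(i < n) v i <= N) ->
  forall n, \sum_(m < n) conv k u v m <= M * N.
Proof.
move=> u0 v0 uM vN n; rewrite sum_conv.
have s0 (w : nat -> R) : (forall n, 0 <= w n) -> 0 <= \sum_(i < n) w i.
  by move=> w0; apply: sumr_ge0 => i _.
apply: le_trans (ler_pM (s0 _ u0) (s0 _ v0) (uM n) (vN n)).
rewrite big_distrl/=; apply: ler_sum => i _; rewrite big_distrr/=.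
rewrite big_mkcond; apply: ler_sum => j _; case: ifP => // _.
by rewrite mulr_ge0.
Qed.

Lemma abs_bounded_conv u v M N : abs_bounded u M -> abs_bounded v N ->
  abs_bounded (conv k u v) (M * N).
Proof.
move=> uM vN n; apply: le_trans (sum_conv_le (fun i => cmod_ge0 (u i))
  (fun i => cmod_ge0 (v i)) uM vN n).
by apply: ler_sum => m _; exact: cmod_conv.
Qed.

Lemma abs_summable_conv u v : abs_summable u -> abs_summable v ->
  abs_summable (conv k u v).
Proof. by move=> [M uM] [N vN]; exists (M * N); exact: abs_bounded_conv. Qed.

(** Mertens' argument: the partial sums of the product and the product of the
    partial sums differ by terms with [i] or [j] large, and these are bounded by
    the increase of the product of the partial sums of the moduli. *)
Lemma sums_to_conv u v U V : abs_summable u -> abs_summable v ->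
  sums_to u U -> sums_to v V -> sums_to (conv k u v) (U * V).
Proof.
move=> [M uM] [N vN] uU vV.
set A := fun w : nat -> C => fun n => \sum_(i < n) cmod (w i).
have A0 w n : 0 <= A w n by apply: sumr_ge0 => i _; exact: cmod_ge0.
have mono : {homo (fun n => A u n * A v n) : m n / (m <= n)%N >-> m <= n}.
  by move=> m n mn; rewrite ler_pM//; exact: cmod_sum_mono.
have bnd n : A u n * A v n <= M * N by rewrite ler_pM ?A0 ?uM ?vN.
have -> : U * V = U * V - 0 by rewrite subr0.
suff : tends (fun n => (\sum_(i < n) u i) * (\sum_(i < n) v i) -
    \sum_(i < n) conv k u v i) 0.
  move=> h; apply: (@eq_tends _ 0) (tendsB (tendsM uU vV) h) => n _.
  by rewrite subKr.
move=> e e0; have [m Hm] := mono_bounded_cauchy mono bnd e0.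
(* large enough for the square [i, j < m] to have its products below [n] *)
exists (m + \sum_(i < m) \sum_(j < m) (k i j).+1)%N => n len.
have mn : (m <= n)%N by apply: leq_trans len; rewrite leq_addr.
have kn i j : (i < m)%N -> (j < m)%N -> (k i j < n)%N.
  move=> im jm; apply: leq_trans len; rewrite (bigD1 (Ordinal im))//=.
  by rewrite (bigD1 (Ordinal jm))//= -addnA addnCA leq_addr.
apply: le_trans (Hm n mn); rewrite subr0 sum_conv.
have -> : (\sum_(i < n) u i) * (\sum_(i < n) v i) -
    \sum_(i < n) \sum_(j < n | (k i j < n)%N) u i * v j =
    \sum_(i < n) \sum_(j < n | ~~ (k i j < n)%N) u i * v j.
  rewrite big_distrl/= -sumrB; apply: eq_bigr => i _.
  by rewrite big_distrr/= (bigID (fun j : 'I_n => k i j < n)%N)/= addrAC subrr add0r.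
rewrite lerBrDr (le_trans (lerD (cmod_sum _ _ _) (lexx _)))//.
rewrite /A (big_ord_widen n (fun i => cmod (u i)) mn).
rewrite (big_ord_widen n (fun i => cmod (v i)) mn).
rewrite [X in _ + X * _ <= _]big_mkcond [X in _ + X <= _]big_distrl.
rewrite [leRHS]big_distrl -big_split/=; apply: ler_sum => i _.
rewrite (le_trans (lerD (cmod_sum _ _ _) (lexx _)))//.
rewrite [X in _ + _ * X <= _]big_mkcond [X in _ + X <= _]big_distrr.
rewrite [leRHS]big_distrr [X in X + _ <= _]big_mkcond -big_split/=.
apply: ler_sum => j _; have [kij|kij] := boolP (k i j < n)%N => /=.
  rewrite add0r; case: ifP => _; case: ifP => _;
    by rewrite ?(mul0r, mulr0)// mulr_ge0 ?cmod_ge0.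
have [im|] := ltnP i m; last by rewrite mul0r addr0 cmodM.
have [jm|] := ltnP j m; last by rewrite mulr0 addr0 cmodM.
by case/negP: kij; exact: kn.
Qed.

End ReindexedProduct.

Section UnitSeries.

Definition unit_seq (T : pzSemiRingType) (m : nat) : T := (m == 0%N)%:R.

Variable R : realType.
Local Notation C := (Cplx R).

Lemma cmod_unit_seq m : cmod (unit_seq C m) = unit_seq R m.
Proof. by rewrite /unit_seq; case: eqP => _; rewrite ?cmod1 ?cmod0. Qed.

Lemma unit_seq_bounded n : \sum_(i < n) unit_seq R i <= 1.
Proof.
case: n => [|n]; first by rewrite big_ord0 ler01.
by rewrite big_ord_recl big1 ?addr0.
Qed.

Lemma abs_summable_unit : abs_summable (unit_seq C).
Proof.
by exists 1 => n; under eq_bigr do rewrite cmod_unit_seq; exact: unit_seq_bounded.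
Qed.

Lemma sums_to_unit : sums_to (unit_seq C) 1.
Proof.
move=> e /ltW e0; exists 1%N => -[//|n] _.
by rewrite big_ord_recl big1// addr0 subrr cmod0.
Qed.

End UnitSeries.

(** * Complex derivatives and paths *)
Section LinearApproximation.
Variable K : numFieldType.
Implicit Types (f : K -> K) (x d : K).

Lemma is_derive_approx f x d :
  (forall e, 0 < e -> exists2 del, 0 < del &
     forall h, `|h| < del -> `|f (x + h) - f x - d * h| <= e * `|h|) ->
  is_derive x (1 : K) f d.
Proof.
move=> approx; suff lim_d : (fun h : K => h^-1 *: (f (h *: 1 + x) - f x)) @ 0^' --> d.
  by split; [apply/cvg_ex; exists d | exact: (cvg_lim (@norm_hausdorff _ _) lim_d)].
apply/cvgrPdist_le => e e0; have [del del0 Hdel] := approx e e0.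
exists del => //= h /=; rewrite sub0r normrN => hdel h0.
rewrite scaler1 [h + x]addrC -(@ler_pM2r _ `|h|) ?normr_gt0// -normrM.
have -> : (d - h^-1 *: (f (x + h) - f x)) * h = - (f (x + h) - f x - d * h).
  by rewrite /GRing.scale/=; field.
by rewrite normrN Hdel.
Qed.

Lemma derivable_approx f x : derivable f x (1 : K) ->
  forall e, 0 < e -> exists2 del, 0 < del &
     forall h, `|h| < del -> `|f (x + h) - f x - 'D_1 f x * h| <= e * `|h|.
Proof.
move=> df e e0; have /cvgrPdist_le/(_ e e0) := df.
move=> [del /= del0 Hdel]; exists del => // h hdel.
have [->|h0] := eqVneq h 0; first by rewrite addr0 subrr mulr0 subrr normr0 mulr0.
have := Hdel h; rewrite /= sub0r normrN => /(_ hdel h0).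
rewrite scaler1 [h + x]addrC -(@ler_pM2r _ `|h|) ?normr_gt0// -normrM.
congr (_ <= _); rewrite -normrN; congr (`| _ |).
rewrite -[lim _]/('D_1 f x) /GRing.scale/=; set D := 'D_1 f x.
by field.
Qed.

End LinearApproximation.

Section Derivatives.
Variable R : realType.
Local Notation C := (Cplx R).
Implicit Types (F f : C -> C) (z w d : C) (P : R -> C) (t : R).

(** The derivative as a linear approximation with a real error bound: errors in
    this form can be added up along a series. *)
Definition cdiff F z d := forall e : R, 0 < e -> exists2 del : R, 0 < del &
  forall h, cmod h < del -> cmod (F (z + h) - F z - d * h) <= e * cmod h.

Lemma cdiff_is_derive F z d : cdiff F z d -> is_derive z (1 : C) F d.
Proof.
move=> Fd; apply: is_derive_approx => e e0.
have eE : e = (complex.Re e)%:C by rewrite RRe_real// gtr0_real.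
have [|del del0 H] := Fd (complex.Re e); first by rewrite -ltcR -eE.
exists del%:C; first by rewrite ltcR.
by move=> h; rewrite ltr_cmod => /H; rewrite eE !cmodE -rmorphM lecR.
Qed.

Lemma derivable_cdiff F z : derivable F z (1 : C) -> cdiff F z (derive1 F z).
Proof.
move=> dF e e0; have [|del del0 H] := derivable_approx dF (e := e%:C).
  by rewrite ltcR.
have dE : del = (complex.Re del)%:C by rewrite RRe_real// gtr0_real.
exists (complex.Re del); first by rewrite -ltcR -dE.
move=> h; rewrite -ltr_cmod -dE => /H; rewrite -derive1E.
by rewrite !cmodE -rmorphM lecR.
Qed.

Lemma cdiff_derivable F z d : cdiff F z d -> derivable F z (1 : C).
Proof. by move=> /cdiff_is_derive []. Qed.

Lemma cdiff_derive1 F z d : cdiff F z d -> derive1 F z = d.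
Proof. by move=> /cdiff_is_derive []; rewrite derive1E. Qed.

(** Coordinatewise, so that the mean value theorem and the integral of real
    functions apply to paths. *)
Definition pderiv P d t :=
  is_derive t (1 : R) (fun x => complex.Re (P x)) (complex.Re d) /\
  is_derive t (1 : R) (fun x => complex.Im (P x)) (complex.Im d).

Lemma approx_pderiv P d t : (forall e, 0 < e -> exists2 del : R, 0 < del &
    forall h : R, `|h| < del -> cmod (P (t + h) - P t - d * h%:C) <= e * `|h|) ->
  pderiv P d t.
Proof.
move=> H; split; apply: is_derive_approx => e e0; have [del del0 Hdel] := H e e0;
  exists del => // h /Hdel; apply: le_trans.
  by apply: le_trans (Re_le_cmod _); rewrite !(ReD, ReN, ReM) /= mulr0 subr0.
by apply: le_trans (Im_le_cmod _); rewrite !(ImD, ImN, ImM) /= mulr0 add0r.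
Qed.

Lemma pderiv_segment F d a b t : cdiff F (a + t%:C * (b - a)) d ->
  pderiv (fun x => F (a + x%:C * (b - a))) (d * (b - a)) t.
Proof.
move=> Fd; apply: approx_pderiv => e e0; set c := cmod (b - a) + 1.
have c0 : 0 < c by rewrite ltr_wpDl// cmod_ge0.
have [|del del0 H] := Fd (e / c); first by rewrite divr_gt0.
exists (del / c); first by rewrite divr_gt0.
move=> h hdel.
have hc : cmod (h%:C * (b - a)) <= `|h| * c.
  by rewrite cmodM cmod_real ler_wpM2l// lerDl.
have -> : a + (t + h)%:C * (b - a) = a + t%:C * (b - a) + h%:C * (b - a).
  by rewrite rmorphD/=; ring.
rewrite -mulrA [(b - a) * _]mulrC (le_trans (H _ _))//.
  by rewrite (le_lt_trans hc)// -ltr_pdivlMr.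
by rewrite mulrAC ler_pdivrMr// -mulrA ler_wpM2l// ltW.
Qed.

Lemma pderivZ P d t a : pderiv P d t -> pderiv (fun x => a * P x) (a * d) t.
Proof.
move=> [dr di]; split.
  have -> : (fun x => complex.Re (a * P x)) =
     (fun x => complex.Re a * complex.Re (P x) - complex.Im a * complex.Im (P x)).
    by apply/funext => x; rewrite ReM.
  by rewrite ReM; apply: is_deriveB; exact: is_deriveZ.
have -> : (fun x => complex.Im (a * P x)) =
   (fun x => complex.Re a * complex.Im (P x) + complex.Im a * complex.Re (P x)).
  by apply/funext => x; rewrite ImM.
by rewrite ImM; apply: is_deriveD; exact: is_deriveZ.
Qed.

Lemma pderivD P P' d d' t : pderiv P d t -> pderiv P' d' t ->
  pderiv (fun x => P x + P' x) (d + d') t.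
Proof.
move=> [dr di] [dr' di']; split.
  rewrite ReD [X in is_derive _ _ X _](_ : _ =
      (fun x => complex.Re (P x)) \+ (fun x => complex.Re (P' x)));
    first exact: is_deriveD.
  by apply/funext => x; rewrite /= ReD.
rewrite ImD [X in is_derive _ _ X _](_ : _ =
    (fun x => complex.Im (P x)) \+ (fun x => complex.Im (P' x)));
  first exact: is_deriveD.
by apply/funext => x; rewrite /= ImD.
Qed.

Lemma pderiv_cst a t : pderiv (fun=> a) 0 t.
Proof. by split; exact: is_derive_cst. Qed.

Lemma pderiv_id a t : pderiv (fun x => x%:C * a) a t.
Proof.
apply: approx_pderiv => e e0; exists 1 => // h _.
rewrite rmorphD/= (_ : _ - _ - _ = 0); last by ring.
by rewrite cmod0 mulr_ge0// ltW.
Qed.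

(** Multiplying by the conjugate of the increment turns the path into a real
    function, so that the bound has no loss of a factor from the coordinates. *)
Lemma mean_value_bound P (dP : R -> C) (M : R) :
  (forall t, 0 <= t <= 1 -> pderiv P (dP t) t) ->
  (forall t, 0 <= t <= 1 -> cmod (dP t) <= M) -> cmod (P 1 - P 0) <= M.
Proof.
move=> PdP PM; set w := P 1 - P 0; pose wb : C := (complex.Re w) -i* (complex.Im w).
have wbm : cmod wb = cmod w by rewrite !cmod_sqrt/= sqrrN.
pose h t := complex.Re (wb * P t).
have hd t : 0 <= t <= 1 -> is_derive t (1 : R) h (complex.Re (wb * dP t)).
  by move=> /PdP /(pderivZ wb) [].
have [||c] := @MVT_segment _ h (fun t => complex.Re (wb * dP t)) 0 1 ler01.
- by move=> x; rewrite in_itv/= => /andP[/ltW ? /ltW ?]; apply: hd; apply/andP.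
- apply: derivable_within_continuous => x; rewrite in_itv/= => /hd xd.
  exact: (@ex_derive _ _ _ _ _ _ _ xd).
rewrite in_itv/= subr0 mulr1 => c01 hE.
have : cmod w ^+ 2 <= cmod w * M.
  have -> : cmod w ^+ 2 = complex.Re (wb * dP c).
    rewrite -hE /h -ReN -ReD -mulrN -mulrDr -/w ReM cmod_sqrt sqr_sqrtr /=.
      by ring.
    by rewrite addr_ge0 ?sqr_ge0.
  rewrite (le_trans (ler_norm _))// (le_trans (Re_le_cmod _))// cmodM wbm.
  by rewrite ler_wpM2l ?cmod_ge0// PM.
have [->|w0] := eqVneq w 0.
  by rewrite cmod0 => _; rewrite (le_trans (cmod_ge0 _) (PM 0 _))// lexx ler01.
by rewrite expr2 ler_pM2l// cmod_gt0.
Qed.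

End Derivatives.

(** * Termwise differentiation and the exponential function *)
Section TermwiseDerivative.
Variable R : realType.
Local Notation C := (Cplx R).

(** A quadratic error on each term, with summable constants, adds up to a
    quadratic error on the sum. *)
Lemma cdiff_series (F : nat -> C -> C) (G : C -> C) (d : nat -> C) (D z : C)
    (del M : R) (B : nat -> R) :
  0 < del -> (forall n, \sum_(i < n) B i <= M) ->
  (forall i h, cmod h < del ->
     cmod (F i (z + h) - F i z - d i * h) <= cmod h ^+ 2 * B i) ->
  (forall h, cmod h < del -> sums_to (fun i => F i (z + h)) (G (z + h))) ->
  sums_to d D -> cdiff G z D.
Proof.
move=> del0 BM FB FG dD e e0.
have M0 : 0 <= M by have := BM 0%N; rewrite big_ord0.
have M1 : 0 < M + 1 by rewrite ltr_wpDl.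
exists (Num.min del (e / (M + 1))); first by rewrite lt_min del0 divr_gt0.
move=> h; rewrite lt_min => /andP[hdel he].
have Gz : sums_to (fun i => F i z) (G z).
  by have := FG 0; rewrite cmod0 addr0; apply.
have hs : sums_to (fun i => F i (z + h) - F i z - d i * h) (G (z + h) - G z - D * h).
  apply: sums_toB; first by apply: sums_toB => //; exact: FG.
  by rewrite mulrC; apply: eq_sums_to (sums_toZ h dD) => i; rewrite mulrC.
apply: (@le_trans _ _ (cmod h ^+ 2 * M)).
  apply: sums_to_bound hs _ => n.
  apply: (@le_trans _ _ (\sum_(i < n) cmod h ^+ 2 * B i)).
    by apply: ler_sum => i _; exact: FB.
  by rewrite -big_distrr/= ler_wpM2l ?BM// sqr_ge0.
rewrite expr2 -mulrA mulrC ler_wpM2r ?cmod_ge0//.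
rewrite (le_trans (ler_wpM2r M0 (ltW he)))// mulrAC ler_pdivrMr//.
by rewrite ler_pM2l// lerDl.
Qed.

End TermwiseDerivative.

Section Exponential.
Variable R : realType.
Local Notation C := (Cplx R).
Implicit Types (z w s : C) (t : R).

Lemma cexpD z w : cexp (z + w) = cexp z * cexp w.
Proof.
rewrite /cexp ReD ImD expRD cosD sinD; apply: eq_ReIm;
  rewrite !(ReM, ImM)/= ; ring.
Qed.

Lemma cexp0 : cexp 0 = 1 :> C.
Proof. by rewrite /cexp/= expR0 cos0 sin0 mul1r. Qed.

Lemma cmod_cexp z : cmod (cexp z) = expR (complex.Re z).
Proof.
rewrite cmodM cmod_real ger0_norm ?expR_ge0// [cmod (_ +i* _)]cmod_sqrt/=.
by rewrite cos2Dsin2 sqrtr1 mulr1.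
Qed.

Lemma cexpMn n z : cexp (n%:R * z) = cexp z ^+ n.
Proof.
elim: n => [|n IH]; first by rewrite mul0r cexp0.
by rewrite -natr1 mulrDl mul1r cexpD IH exprSr.
Qed.

(** Derivatives along real rays suffice for the estimates of [cexp] near 0, as
    the mean value bound only looks at a segment. *)
Lemma cexp_path w t :
  pderiv (fun x => cexp (x%:C * w)) (w * cexp (t%:C * w)) t.
Proof.
set a := complex.Re w; set b := complex.Im w.
have d_lin c : is_derive t (1 : R) (fun x => x * c) c.
  apply: is_derive_approx => e e0; exists 1 => // h _.
  by rewrite (_ : _ - _ - _ = 0) ?normr0 ?mulr_ge0 ?(ltW e0)//; ring.
have da : is_derive t (1 : R) (fun x => x * a) a.
  exact: d_lin.
have db : is_derive t (1 : R) (fun x => x * b) b.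
  exact: d_lin.
have dexp := @is_derive1_comp _ expR (fun x => x * a) t _ _ (is_derive_expR (t * a)) da.
have dcos := @is_derive1_comp _ cos (fun x => x * b) t _ _ (is_derive_cos (t * b)) db.
have dsin := @is_derive1_comp _ sin (fun x => x * b) t _ _ (is_derive_sin (t * b)) db.
have ReE x : complex.Re (x%:C * w) = x * a by rewrite ReM/=; ring.
have ImE x : complex.Im (x%:C * w) = x * b by rewrite ImM/=; ring.
split.
  have -> : (fun x => complex.Re (cexp (x%:C * w))) =
      (expR \o (fun x => x * a)) * (cos \o (fun x => x * b)).
    by apply/funext => x; rewrite /cexp ReE ImE ReM/=; rewrite mul0r subr0.
  apply: is_derive_eq; rewrite /cexp ReE ImE !(ReM, ImM)/= /GRing.scale/= -/a -/b.
  ring.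
have -> : (fun x => complex.Im (cexp (x%:C * w))) =
    (expR \o (fun x => x * a)) * (sin \o (fun x => x * b)).
  by apply/funext => x; rewrite /cexp ReE ImE ImM/=; rewrite mul0r addr0.
apply: is_derive_eq; rewrite /cexp ReE ImE !(ReM, ImM)/= /GRing.scale/= -/a -/b.
ring.
Qed.

Lemma cmod_cexp_sub1 w : cmod (cexp w - 1) <= cmod w * expR (cmod w).
Proof.
have -> : cexp w - 1 = cexp (1%:C * w) - cexp (0%:C * w).
  by rewrite mul1r mul0r cexp0.
apply: (@mean_value_bound _ (fun x => cexp (x%:C * w))).
  by move=> t _; exact: cexp_path.
move=> t /andP[t0 t1]; rewrite cmodM cmod_cexp ler_wpM2l ?cmod_ge0// ler_expR.
rewrite (le_trans (ler_norm _))// (le_trans (Re_le_cmod _))// cmodM cmod_real.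
by rewrite ger0_norm// ler_piMl ?cmod_ge0.
Qed.

Lemma cmod_cexp_sub1_sub w :
  cmod (cexp w - 1 - w) <= cmod w ^+ 2 * expR (cmod w).
Proof.
have -> : cexp w - 1 - w = (cexp (1%:C * w) + 1%:C * (- w)) -
    (cexp (0%:C * w) + 0%:C * (- w)).
  by rewrite !mul1r !mul0r cexp0; ring.
apply: (@mean_value_bound _ (fun x => cexp (x%:C * w) + x%:C * (- w))
  (fun t => w * cexp (t%:C * w) + - w)).
  by move=> t _; apply: pderivD; [exact: cexp_path|exact: pderiv_id].
move=> t /andP[t0 t1].
have -> : w * cexp (t%:C * w) - w = w * (cexp (t%:C * w) - 1) by ring.
rewrite cmodM expr2 -mulrA ler_wpM2l ?cmod_ge0//.
have tw : cmod (t%:C * w) <= cmod w.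
  by rewrite cmodM cmod_real ger0_norm// ler_piMl ?cmod_ge0.
by rewrite (le_trans (cmod_cexp_sub1 _))// ler_pM ?cmod_ge0 ?expR_ge0// ler_expR.
Qed.

Lemma npowD n z w : npow n (z + w) = npow n z * npow n w.
Proof. by rewrite /npow mulrDl cexpD. Qed.

Lemma npowMn n k w : npow n (k%:R * w) = npow n w ^+ k.
Proof. by rewrite /npow -mulrA cexpMn. Qed.

Lemma npow1 w : npow 1 w = 1.
Proof. by rewrite /npow ln1 mulr0 cexp0. Qed.

Lemma npowM m n w : (0 < m)%N -> (0 < n)%N ->
  npow (m * n) w = npow m w * npow n w.
Proof.
by move=> m0 n0; rewrite /npow natrM lnM ?posrE ?ltr0n// rmorphD mulrDr cexpD.
Qed.

Lemma cmod_npow n w : cmod (npow n w) = expR (complex.Re w * ln n%:R).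
Proof. by rewrite cmod_cexp ReM/= mulr0 subr0. Qed.

End Exponential.

(** * Integrals along segments *)
Section SegmentIntegral.
Variable R : realType.
Local Notation C := (Cplx R).
Implicit Types (F f g : C -> C) (a b c z w v : C) (P : R -> C) (t x : R).

Definition ccont f z := forall e : R, 0 < e -> exists2 del : R, 0 < del &
  forall h, cmod h < del -> cmod (f (z + h) - f z) <= e.

Lemma cdiff_ccont F z d : cdiff F z d -> ccont F z.
Proof.
move=> Fd e e0; have [del del0 H] := Fd 1 ltr01.
have c0 : 0 < 1 + cmod d by rewrite ltr_pwDl ?cmod_ge0.
exists (Num.min del (e / (1 + cmod d))); first by rewrite lt_min del0 divr_gt0.
move=> h; rewrite lt_min => /andP[/H Hh]; rewrite ltr_pdivlMr// => he.
rewrite -(subrK (d * h) (_ - _)) (le_trans (cmodD _ _))//.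
rewrite (le_trans (lerD Hh (lexx _)))// cmodM -mulrDl mulrC; exact: ltW.
Qed.

Lemma eps_del_continuous (g : R -> R) x :
  (forall e, 0 < e -> exists2 del : R, 0 < del &
     forall h, `|h| < del -> `|g (x + h) - g x| <= e) -> {for x, continuous g}.
Proof.
move=> H; apply/cvgrPdist_le => e e0; have [del del0 Hdel] := H e e0.
exists del => //= y /=; rewrite distrC => /Hdel.
by rewrite [x + _]addrC subrK distrC.
Qed.

Lemma primitive_exists (g : R -> R) : continuous g ->
  exists G : R -> R, forall x, 0 <= x <= 1 -> is_derive x (1 : R) G (g x).
Proof.
move=> cg; exists (fun x => \int[lebesgue_measure]_(t in `[(-1)%R, x]) g t)%R => x /andP[x0 x1].
have x2 : x < 2 by rewrite (le_lt_trans x1)// ltr1n.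
have x1' : -1 < x by rewrite (lt_le_trans _ x0)// ltrN10.
have gi : lebesgue_measure.-integrable `[(-1)%R, 2%R] (EFin \o g).
  apply: continuous_compact_integrable; first exact: segment_compact.
  exact: continuous_subspaceT.
have [dG GE] := continuous_FTC1_closed x2 gi x1' (cg x).
exact: (DeriveDef dG (etrans (esym (derive1E _ _)) GE)).
Qed.

Definition clamp01 x : R := Num.max 0 (Num.min x 1).

Lemma clamp01_in x : 0 <= clamp01 x <= 1.
Proof. by rewrite /clamp01 le_max lexx ge_max ler01/= ge_min lexx orbT. Qed.

Lemma clamp01_id x : 0 <= x <= 1 -> clamp01 x = x.
Proof. by move=> /andP[x0 x1]; rewrite /clamp01 min_l// max_r. Qed.

Lemma clamp01_cases x :
  [\/ x <= 0 /\ clamp01 x = 0, 1 <= x /\ clamp01 x = 1 | clamp01 x = x].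
Proof.
have [x0|/ltW x0] := leP x 0.
  by constructor 1; rewrite /clamp01 min_l ?max_l// (le_trans x0).
have [x1|/ltW x1] := leP 1 x.
  by constructor 2; rewrite /clamp01 min_r// max_r// ler01.
by constructor 3; rewrite clamp01_id// x0.
Qed.

Lemma clamp01_dist x y : `|clamp01 x - clamp01 y| <= `|x - y|.
Proof.
wlog xy : x y / x <= y => [H|].
  by have [/H//|/ltW/H] := leP x y; rewrite distrC [leRHS]distrC.
have /andP[cx0 cx1] := clamp01_in x; have /andP[cy0 cy1] := clamp01_in y.
suff h : 0 <= clamp01 y - clamp01 x <= y - x.
  rewrite distrC [leRHS]distrC !ger0_norm ?subr_ge0//; first by case/andP: h.
  by case/andP: h; rewrite subr_ge0.
apply/andP; move: (clamp01 x) (clamp01 y) (clamp01_cases x) (clamp01_cases y) cx0 cx1 cy0 cy1.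
move=> cx cy [[? ->]|[? ->]|->] [[? ->]|[? ->]|->] *; split; lra.
Qed.

(** Clamping makes the integrand continuous on the whole line, so that the
    primitive is differentiable at the end points as well. *)
Lemma path_primitive (g : R -> C) :
  (forall t, 0 <= t <= 1 -> forall e, 0 < e -> exists2 del : R, 0 < del &
     forall h, `|h| < del -> 0 <= t + h <= 1 -> cmod (g (t + h) - g t) <= e) ->
  exists P, forall t, 0 <= t <= 1 -> pderiv P (g t) t.
Proof.
move=> cg.
have cont (p : C -> R) : (forall z w, p z - p w = p (z - w)) ->
    (forall z, `|p z| <= cmod z) -> continuous (fun x => p (g (clamp01 x))).
  move=> pB pc x; apply: eps_del_continuous => e e0.
  have [del del0 H] := cg _ (clamp01_in x) e e0.
  exists del => // h hdel; rewrite pB (le_trans (pc _))//.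
  have -> : clamp01 (x + h) = clamp01 x + (clamp01 (x + h) - clamp01 x) by ring.
  apply: H; last by rewrite addrC subrK; exact: clamp01_in.
  by rewrite (le_lt_trans (clamp01_dist _ _))// addrC addKr.
have [G1 dG1] := primitive_exists (cont (@complex.Re R)
  (fun z w => esym (etrans (ReD z (- w)) (congr1 _ (ReN w)))) (@Re_le_cmod R)).
have [G2 dG2] := primitive_exists (cont (@complex.Im R)
  (fun z w => esym (etrans (ImD z (- w)) (congr1 _ (ImN w)))) (@Im_le_cmod R)).
exists (fun x => G1 x +i* G2 x) => t t01; split.
  by have := dG1 t t01; rewrite clamp01_id.
by have := dG2 t t01; rewrite clamp01_id.
Qed.

Definition seg a b t : C := a + t%:C * (b - a).

Definition is_cint f a b v := exists P,
  (forall t, 0 <= t <= 1 -> pderiv P (f (seg a b t) * (b - a)) t) /\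
  v = P 1 - P 0.

(** The integral of [f dz] along the segment, as the increment of a primitive of
    the integrand along the path, which exists when [f] is continuous there. *)
Definition cint f a b : C := xget 0 [set v | is_cint f a b v].

Definition cont_on_seg f a b := forall t, 0 <= t <= 1 -> ccont f (seg a b t).

Lemma pderivN P d t : pderiv P d t -> pderiv (fun x => - P x) (- d) t.
Proof.
move=> /(pderivZ (-1)); rewrite mulN1r; congr pderiv.
by apply/funext => x; rewrite mulN1r.
Qed.

(** Two primitives differ by a path of derivative 0, which is constant by the
    mean value bound. *)
Lemma is_cint_unique f a b v w : is_cint f a b v -> is_cint f a b w -> v = w.
Proof.
move=> [P [dP ->]] [P' [dP' ->]]; apply/eqP; rewrite -subr_eq0 -cmod_le0.
have -> : P 1 - P 0 - (P' 1 - P' 0) = (P 1 - P' 1) - (P 0 - P' 0) by ring.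
apply: (@mean_value_bound _ (fun t => P t - P' t) (fun=> 0)) => t t01.
  rewrite -(subrr (f (seg a b t) * (b - a))); apply: pderivD; first exact: dP.
  by apply: pderivN; exact: dP'.
by rewrite cmod0.
Qed.

Lemma cont_on_seg_cint f a b : cont_on_seg f a b -> is_cint f a b (cint f a b).
Proof.
move=> cf; have [|P dP] := @path_primitive (fun t => f (seg a b t) * (b - a)).
  move=> t t01 e e0; set c := cmod (b - a) + 1.
  have c0 : 0 < c by rewrite ltr_wpDl// cmod_ge0.
  have [|del del0 H] := cf t t01 (e / c); first by rewrite divr_gt0.
  exists (del / c); first by rewrite divr_gt0.
  move=> h hdel _; rewrite -mulrBl.
  have -> : seg a b (t + h) = seg a b t + h%:C * (b - a).
    by rewrite /seg rmorphD/=; ring.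
  have hc : cmod (h%:C * (b - a)) <= `|h| * c.
    by rewrite cmodM cmod_real ler_wpM2l// lerDl.
  have /H : cmod (h%:C * (b - a)) < del by rewrite (le_lt_trans hc)// -ltr_pdivlMr.
  rewrite cmodM ler_pdivlMr//; apply: le_trans.
  by rewrite ler_wpM2l ?cmod_ge0// lerDl.
rewrite /cint; case: xgetP => // /(_ (P 1 - P 0)); case.
by exists P.
Qed.

Lemma cintE f a b v : is_cint f a b v -> cint f a b = v.
Proof.
rewrite /cint; case: xgetP => [w -> /is_cint_unique h /h//|/(_ v) h hv].
by case: h.
Qed.

Lemma is_cintD f g a b v w : is_cint f a b v -> is_cint g a b w ->
  is_cint (fun z => f z + g z) a b (v + w).
Proof.
move=> [P [dP ->]] [P' [dP' ->]]; exists (fun t => P t + P' t); split; last ring.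
by move=> t t01; rewrite mulrDl; apply: pderivD; [exact: dP|exact: dP'].
Qed.

Lemma is_cintN f a b v : is_cint f a b v -> is_cint (fun z => - f z) a b (- v).
Proof.
move=> [P [dP ->]]; exists (fun t => - P t); split; last ring.
by move=> t t01; rewrite mulNr; apply: pderivN; exact: dP.
Qed.

Lemma is_cint_primitive F f a b :
  (forall t, 0 <= t <= 1 -> cdiff F (seg a b t) (f (seg a b t))) ->
  is_cint f a b (F b - F a).
Proof.
move=> dF; exists (fun t => F (seg a b t)); split.
  by move=> t /dF; exact: pderiv_segment.
by rewrite /seg mul1r mul0r addr0 [a + _]addrC subrK.
Qed.

Lemma is_cint_bound f a b v (M : R) : is_cint f a b v ->
  (forall t, 0 <= t <= 1 -> cmod (f (seg a b t)) <= M) ->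
  cmod v <= M * cmod (b - a).
Proof.
move=> [P [dP ->]] fM; apply: mean_value_bound dP _ => t t01.
by rewrite cmodM ler_wpM2r ?cmod_ge0// fM.
Qed.

Lemma pderiv_affine P d (al be : R) t : pderiv P d (al * t + be) ->
  pderiv (fun x => P (al * x + be)) (d * al%:C) t.
Proof.
have dl : is_derive t (1 : R) (fun x => al * x + be) al.
  apply: is_derive_approx => e e0; exists 1 => // h _.
  by rewrite (_ : _ - _ - _ = 0) ?normr0 ?mulr_ge0 ?(ltW e0)//; ring.
move=> [dr di]; split.
  apply: is_derive_eq; first exact: (@is_derive1_comp _ (fun x => complex.Re (P x)) _ t _ _ dr dl).
  by rewrite ReM/=; ring.
apply: is_derive_eq; first exact: (@is_derive1_comp _ (fun x => complex.Im (P x)) _ t _ _ di dl).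
by rewrite ImM/=; ring.
Qed.

Lemma is_cint_rev f a b v : is_cint f a b v -> is_cint f b a (- v).
Proof.
move=> [P [dP ->]]; exists (fun t => P (-1 * t + 1)); split; last first.
  by rewrite mulr0 add0r mulr1 addNr opprB.
move=> t /andP[t0 t1].
have -> : seg b a t = seg a b (-1 * t + 1).
  by rewrite /seg !(rmorphD, rmorphM, rmorphN, rmorph1)/=; ring.
have -> : f (seg a b (-1 * t + 1)) * (a - b) =
    f (seg a b (-1 * t + 1)) * (b - a) * (-1)%:C by rewrite rmorphN rmorph1; ring.
by apply: pderiv_affine; apply: dP; lra.
Qed.

Definition mid a b : C := (a + b) / 2.

Lemma is_cint_split f a b v : is_cint f a b v ->
  exists v1 v2, [/\ is_cint f a (mid a b) v1, is_cint f (mid a b) b v2 & v = v1 + v2].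
Proof.
move=> [P [dP ->]]; exists (P (1 / 2) - P 0), (P 1 - P (1 / 2)).
have h1 : ((1 / 2 : R))%:C = 1 / 2 :> C by rewrite rmorphM rmorph1 fmorphV rmorph_nat.
have n2 : (2 : C) != 0 by rewrite pnatr_eq0.
split; last ring.
- exists (fun t => P (1 / 2 * t + 0)); split; last by rewrite mulr0 addr0 mulr1 addr0.
  move=> t /andP[t0 t1].
  have -> : seg a (mid a b) t = seg a b (1 / 2 * t + 0).
    by rewrite /seg /mid rmorphD rmorphM /= ?rmorph0 h1; field.
  have -> : mid a b - a = (b - a) * (1 / 2 : R)%:C by rewrite h1 /mid; field.
  by rewrite mulrA; apply: pderiv_affine; apply: dP; lra.
- exists (fun t => P (1 / 2 * t + 1 / 2)); split; last first.
    by rewrite mulr0 add0r mulr1 -splitr.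
  move=> t /andP[t0 t1].
  have -> : seg (mid a b) b t = seg a b (1 / 2 * t + 1 / 2).
    by rewrite /seg /mid rmorphD rmorphM /= ?rmorph0 h1; field.
  have -> : b - mid a b = (b - a) * (1 / 2 : R)%:C by rewrite h1 /mid; field.
  by rewrite mulrA; apply: pderiv_affine; apply: dP; lra.
Qed.

End SegmentIntegral.

(** * Cauchy's theorem for triangles *)
Section Goursat.
Variables (R : realType).
Local Notation C := (Cplx R).
Implicit Types (a b c z w v : C) (r t : R).

(** The base points of the nested triangles: the distance to the limit is of the
    size of the current triangle. *)
Lemma halving_steps_converge (x : nat -> C) (s : R) :
  (forall n, cmod (x n.+1 - x n) <= s / 2 ^+ n) ->
  exists l, forall n, cmod (x n - l) <= 2 * s / 2 ^+ n.
Proof.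
move=> xs; pose u n k := x (n + k).+1 - x (n + k).
have geo m : \sum_(i < m) (2 ^+ i)^-1 = 2 - 2 / 2 ^+ m :> R.
  elim: m => [|m IH]; first by rewrite big_ord0 expr0 divr1 subrr.
  rewrite big_ord_recr/= IH exprS; have : (2 : R) ^+ m != 0 by rewrite expf_neq0.
  by move=> h; field.
have s0 : 0 <= s by have := le_trans (cmod_ge0 _) (xs 0%N); rewrite expr0 divr1.
have ub n : abs_bounded (u n) (2 * s / 2 ^+ n).
  move=> m; apply: (@le_trans _ _ (\sum_(i < m) s / 2 ^+ n * (2 ^+ i)^-1)).
    by apply: ler_sum => i _; rewrite (le_trans (xs _))// exprD invfM mulrA.
  rewrite -big_distrr/= geo [2 * s]mulrC [leRHS]mulrAC ler_wpM2l//.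
    by rewrite divr_ge0// exprn_ge0.
  by rewrite gerBl divr_ge0// exprn_ge0.
have usum n m : \sum_(i < m) u n i = x (n + m)%N - x n.
  elim: m => [|m IH]; first by rewrite big_ord0 addn0 subrr.
  by rewrite big_ord_recr/= IH /u addnS; ring.
have [S hS] := abs_summable_sums (ex_intro _ _ (ub 0%N)).
exists (x 0%N + S) => n; rewrite cmodBC.
apply: sums_to_bound (ub n).
move=> e e0; have [N HN] := hS e e0; exists N => m Nm.
have := HN (n + m)%N (leq_trans Nm (leq_addl _ _)); rewrite !usum add0n.
by congr (cmod _ <= _); ring.
Qed.

Lemma seg_disc a b t r : cmod a <= r -> cmod b <= r -> 0 <= t <= 1 ->
  cmod (seg a b t) <= r.
Proof.
move=> ar br /andP[t0 t1].
have -> : seg a b t = (1 - t)%:C * a + t%:C * b.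
  by rewrite /seg rmorphB rmorph1; ring.
rewrite (le_trans (cmodD _ _))// !cmodM !cmod_real !ger0_norm ?subr_ge0//.
have -> : r = (1 - t) * r + t * r by ring.
by rewrite lerD// ler_wpM2l// subr_ge0.
Qed.

Lemma cmod_half z : cmod (z / 2) = cmod z / 2.
Proof. by rewrite cmodM cmodV cmod_nat. Qed.

Lemma mid_disc a b r : cmod a <= r -> cmod b <= r -> cmod (mid a b) <= r.
Proof.
move=> ar br; rewrite cmod_half ler_pdivrMr// mulrDr !mulr1.
by rewrite (le_trans (cmodD _ _))// lerD.
Qed.

Lemma quadratic_cdiff (a b z d : C) : d = b + 2 * a * z ->
  cdiff (fun w => b * w + a * w ^+ 2) z d.
Proof.
move=> -> e e0; have c0 : 0 < cmod a + 1 by rewrite ltr_wpDl ?cmod_ge0.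
exists (e / (cmod a + 1)); first by rewrite divr_gt0.
move=> h; rewrite ltr_pdivlMr// => hd.
have -> : b * (z + h) + a * (z + h) ^+ 2 - (b * z + a * z ^+ 2) -
  (b + 2 * a * z) * h = a * h * h by ring.
rewrite !cmodM ler_wpM2r ?cmod_ge0// (le_trans _ (ltW hd))// mulrC.
by rewrite ler_wpM2l ?cmod_ge0// lerDl.
Qed.

Variables (f : C -> C) (rho : R).
Hypothesis df : forall z, cmod z < rho -> exists d, cdiff f z d.

Lemma disc_cint a b r : cmod a <= r -> cmod b <= r -> r < rho ->
  is_cint f a b (cint f a b).
Proof.
move=> ar br rrho; apply: cont_on_seg_cint => t t01.
have [|d] := df (z := seg a b t); last exact: cdiff_ccont.
by rewrite (le_lt_trans (seg_disc ar br t01)).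
Qed.

Definition tri a b c := cint f a b + cint f b c + cint f c a.

Definition perim a b c : R := cmod (b - a) + cmod (c - b) + cmod (a - c).

Lemma disc_cint_rev a b r : cmod a <= r -> cmod b <= r -> r < rho ->
  cint f b a = - cint f a b.
Proof. by move=> ar br rr; apply: cintE; apply: is_cint_rev; exact: disc_cint ar br rr. Qed.

Lemma disc_cint_mid a b r : cmod a <= r -> cmod b <= r -> r < rho ->
  cint f a b = cint f a (mid a b) + cint f (mid a b) b.
Proof.
move=> ar br rr; have [v1 [v2 [h1 h2 ->]]] := is_cint_split (disc_cint ar br rr).
by rewrite (cintE h1) (cintE h2).
Qed.

Lemma tri_split a b c r : cmod a <= r -> cmod b <= r -> cmod c <= r -> r < rho ->
  tri a b c = tri a (mid a b) (mid c a) + tri (mid a b) b (mid b c) +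
    tri (mid c a) (mid b c) c + tri (mid b c) (mid c a) (mid a b).
Proof.
move=> ar br cr rr; rewrite /tri.
have [[h1 h2] h3] := (mid_disc ar br, mid_disc br cr, mid_disc cr ar).
rewrite (disc_cint_mid ar br rr) (disc_cint_mid br cr rr) (disc_cint_mid cr ar rr).
rewrite (disc_cint_rev h1 h3 rr) (disc_cint_rev h2 h1 rr) (disc_cint_rev h3 h2 rr).
ring.
Qed.

(** The integral is the sum of those over the four triangles cut out by the
    midpoints, so that one of them carries at least a quarter of it. *)
Lemma tri_descent a b c r : cmod a <= r -> cmod b <= r -> cmod c <= r -> r < rho ->
  exists a' b' c', [/\ cmod a' <= r, cmod b' <= r & cmod c' <= r] /\
   [/\ cmod (tri a b c) <= 4 * cmod (tri a' b' c'),
      perim a' b' c' = perim a b c / 2 & cmod (a' - a) <= perim a b c].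
Proof.
move=> ar br cr rr.
have [[h1 h2] h3] := (mid_disc ar br, mid_disc br cr, mid_disc cr ar).
pose big a' b' c' := (cmod (tri a b c) <= 4 * cmod (tri a' b' c')).
have pos (x y : C) : 0 <= cmod (x - y) by exact: cmod_ge0.
have n2 : (2 : C) != 0 by rewrite pnatr_eq0.
have ma (x y : C) : cmod (mid x y - x) = cmod (y - x) / 2.
  by rewrite -cmod_half; congr cmod; rewrite /mid; field.
have mb (x y : C) : cmod (mid x y - y) = cmod (y - x) / 2.
  by rewrite [cmod (y - x)]cmodBC -cmod_half; congr cmod; rewrite /mid; field.
have mm (x y z : C) : cmod (mid x y - mid y z) = cmod (x - z) / 2.
  by rewrite -cmod_half; congr cmod; rewrite /mid; field.
have am (x y : C) : cmod (x - mid x y) = cmod (y - x) / 2 by rewrite cmodBC ma.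
have bm (x y : C) : cmod (y - mid x y) = cmod (y - x) / 2 by rewrite cmodBC mb.
have mm' (x y z : C) : cmod (mid y z - mid x y) = cmod (x - z) / 2 by rewrite cmodBC mm.
have p0 : 0 <= perim a b c by rewrite /perim !addr_ge0.
have [B|B1] := boolP (big a (mid a b) (mid c a)).
  exists a, (mid a b), (mid c a); split; split => //; last by rewrite subrr cmod0.
  by rewrite /perim !(ma, mb, am, bm, mm, mm') [cmod (c - b)]cmodBC; field.
have [B|B2] := boolP (big (mid a b) b (mid b c)).
  exists (mid a b), b, (mid b c); split; split => //.
    by rewrite /perim !(ma, mb, am, bm, mm, mm'); field.
  rewrite ma /perim; have := pos b a; have := pos c b; have := pos a c; lra.
have [B|B3] := boolP (big (mid c a) (mid b c) c).
  exists (mid c a), (mid b c), c; split; split => //.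
    by rewrite /perim !(ma, mb, am, bm, mm, mm') [cmod (b - a)]cmodBC; field.
  rewrite mb /perim; have := pos b a; have := pos c b; have := pos a c; lra.
exists (mid b c), (mid c a), (mid a b); split; split => //; last 2 first.
- rewrite /perim !(ma, mb, am, bm, mm, mm') [cmod (b - a)]cmodBC.
  by rewrite [cmod (c - b)]cmodBC; field.
- have -> : mid b c - a = (b - a) / 2 - (a - c) / 2 by rewrite /mid; field.
  rewrite (le_trans (cmodB _ _))// !cmod_half /perim.
  have := pos b a; have := pos c b; have := pos a c; lra.
move: B1 B2 B3; rewrite /big -!ltNge (tri_split ar br cr rr).
move: (tri a (mid a b) (mid c a)) (tri (mid a b) b (mid b c))
  (tri (mid c a) (mid b c) c) (tri (mid b c) (mid c a) (mid a b)) => x y z w.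
have := cmodD (x + y + z) w; have := cmodD (x + y) z; have := cmodD x y.
lra.
Qed.

(** After [n] descents the perimeter is divided by [2 ^ n] and the integral at most
    by [4 ^ n]. Near the common point of the triangles, [f] differs from an affine
    function by an error that is small compared with the distance, and its
    integral over the [n]-th triangle is small compared with [4 ^ - n]. *)
Lemma goursat a b c : cmod a < rho -> cmod b < rho -> cmod c < rho ->
  tri a b c = 0.
Proof.
move=> arho brho crho; set r := Num.max (cmod a) (Num.max (cmod b) (cmod c)).
have rr : r < rho by rewrite !gt_max arho brho.
have [ar br cr] : [/\ cmod a <= r, cmod b <= r & cmod c <= r].
  by rewrite /r !le_max !lexx !orbT.
pose T := (C * C * C)%type.
pose valid (x : T) := [/\ cmod x.1.1 <= r, cmod x.1.2 <= r & cmod x.2 <= r].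
have [next nextP] : exists next : T -> T, forall x, valid x -> valid (next x) /\
  [/\ cmod (tri x.1.1 x.1.2 x.2) <= 4 * cmod (tri (next x).1.1 (next x).1.2 (next x).2),
      perim (next x).1.1 (next x).1.2 (next x).2 = perim x.1.1 x.1.2 x.2 / 2 &
      cmod ((next x).1.1 - x.1.1) <= perim x.1.1 x.1.2 x.2].
  suff /boolp.choice[next H] : forall x, exists y : T, valid x -> valid y /\
    [/\ cmod (tri x.1.1 x.1.2 x.2) <= 4 * cmod (tri y.1.1 y.1.2 y.2),
        perim y.1.1 y.1.2 y.2 = perim x.1.1 x.1.2 x.2 / 2 &
        cmod (y.1.1 - x.1.1) <= perim x.1.1 x.1.2 x.2] by exists next.
  move=> x; have [[xa xb xc]|nv] := pselect (valid x); last by exists x.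
  have [a' [b' [c' [v' H]]]] := tri_descent xa xb xc rr.
  by exists (a', b', c').
pose X n := iter n next (a, b, c).
have Xv n : valid (X n) by elim: n => [|n IH] //=; case: (nextP _ IH).
set s := perim a b c.
have Xp n : perim (X n).1.1 (X n).1.2 (X n).2 = s / 2 ^+ n.
  elim: n => [|n IH]; first by rewrite expr0 divr1.
  by have [_ [_ -> _]] := nextP _ (Xv n); rewrite -/(X n) IH exprSr invfM mulrA.
have XT n : cmod (tri a b c) <= 4 ^+ n * cmod (tri (X n).1.1 (X n).1.2 (X n).2).
  elim: n => [|n IH]; first by rewrite expr0 mul1r.
  rewrite (le_trans IH)// exprSr -mulrA ler_wpM2l ?exprn_ge0//.
  by have [_ []] := nextP _ (Xv n).
have Xd n : cmod ((X n.+1).1.1 - (X n).1.1) <= s / 2 ^+ n.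
  by rewrite -Xp; have [_ []] := nextP _ (Xv n).
have [l lP] := halving_steps_converge Xd.
have s0 : 0 <= s by rewrite !addr_ge0 ?cmod_ge0.
have small n : s / 2 ^+ n <= s / n.+1%:R.
  rewrite ler_wpM2l// lef_pV2 ?posrE ?exprn_gt0// -natrX ler_nat.
  exact: ltn_expl.
have arch e : 0 < e -> exists n, s / 2 ^+ n <= e.
  move=> e0; exists (Num.truncn (s / e)); rewrite (le_trans (small _))//.
  rewrite ler_pdivrMr// mulrC -ler_pdivrMr// ltW// truncnS_gt//.
have lr : cmod l <= r.
  apply/ler_addgt0Pr => e e0; have [n Hn] := arch (e / 2) (divr_gt0 e0 (ltr0Sn R 1)).
  rewrite -(subrK (X n).1.1 l) (le_trans (cmodD _ _))// addrC lerD//.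
    by have [] := Xv n.
  by rewrite cmodBC (le_trans (lP n))// -mulrA mulrC -ler_pdivlMr.
have [d dl] := df (le_lt_trans lr rr).
apply: cmod_small_eq => e e0; rewrite subr0.
(* this constant gets multiplied by [3 * s ^+ 2]; adding 1 allows for [s = 0] *)
have e1 : 0 < e / (3 * s ^+ 2 + 1).
  by rewrite divr_gt0// ltr_wpDl// mulr_ge0// sqr_ge0.
have [del del0 H] := dl _ e1.
have [n Hn] := arch (del / 4) (divr_gt0 del0 (ltr0Sn R 3)).
rewrite (le_trans (XT n))//.
move: (lP n) (Xp n) (Xv n) Hn; case: (X n) => [[x y] z] /= xl pE [xr yr zr].
set q := s / 2 ^+ n in xl pE * => qdel.
have q0 : 0 <= q by rewrite divr_ge0// exprn_ge0.
have xl' : cmod (x - l) <= 2 * q by rewrite mulrA.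
pose err w := f w - f l - d * (w - l).
have perimE u v w : cmod (u - v) <= perim u v w.
  by rewrite cmodBC /perim -addrA lerDl addr_ge0 ?cmod_ge0.
have near_l w : cmod (w - x) <= q -> cmod (err w) <= e / (3 * s ^+ 2 + 1) * (3 * q).
  move=> wx; have wl : cmod (w - l) <= 3 * q.
    by have := cmod_dist_trans x w l; lra.
  apply: (@le_trans _ _ (e / (3 * s ^+ 2 + 1) * cmod (w - l))).
    have -> : err w = f (l + (w - l)) - f l - d * (w - l) by rewrite [l + _]addrC subrK.
    by apply: H; lra.
  by rewrite ler_wpM2l// ltW.
have dists : [/\ cmod (x - x) <= q, cmod (y - x) <= q & cmod (z - x) <= q].
  rewrite -pE /perim; have := cmod_ge0 (y - x); have := cmod_ge0 (z - y).
  by have := cmod_ge0 (x - z); rewrite subrr cmod0 [cmod (z - x)]cmodBC; split; lra.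
have [xx yx zx] := dists.
(* the affine part has a primitive, so only the error is integrated *)
pose A w := (f l - d * l) * w + d / 2 * w ^+ 2.
have step u v : cmod u <= r -> cmod v <= r -> cmod (u - x) <= q -> cmod (v - x) <= q ->
    cmod (cint f u v - (A v - A u)) <=
    e / (3 * s ^+ 2 + 1) * (3 * q) * cmod (v - u).
  move=> ur vr ux vx.
  have hA : is_cint (fun w => f l + d * (w - l)) u v (A v - A u).
    apply: is_cint_primitive => t _; apply: (@quadratic_cdiff (d / 2) (f l - d * l)).
    by have n2 : (2 : C) != 0 by [rewrite pnatr_eq0]; rewrite /=; field.
  have hf := is_cintD (disc_cint ur vr rr) (is_cintN hA).
  apply: is_cint_bound hf _ => t t01.
  rewrite opprD addrA near_l//.
  have -> : seg u v t - x = seg (u - x) (v - x) t by rewrite /seg; ring.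
  exact: seg_disc.
have -> : tri x y z = (cint f x y - (A y - A x)) + (cint f y z - (A z - A y)) +
    (cint f z x - (A x - A z)) by rewrite /tri; ring.
have h1 := step x y xr yr xx yx; have h2 := step y z yr zr yx zx.
have h3 := step z x zr xr zx xx.
apply: (@le_trans _ _ (4 ^+ n * (e / (3 * s ^+ 2 + 1) * (3 * q) * q))).
  rewrite ler_wpM2l ?exprn_ge0// -[X in _ <= _ * X]pE /perim !mulrDr.
  by rewrite (le_trans (cmodD _ _))// lerD// (le_trans (cmodD _ _))// lerD.
have -> : 4 ^+ n * (e / (3 * s ^+ 2 + 1) * (3 * q) * q) =
    e * (3 * s ^+ 2 / (3 * s ^+ 2 + 1)).
  have -> : (4 : R) = 2 ^+ 2 by rewrite -natrX.
  rewrite /q -exprM mulnC exprM; have : (2 : R) ^+ n != 0 by rewrite expf_neq0.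
  move: (2 ^+ n) => k k0; have : 3 * s ^+ 2 + 1 != 0.
    by rewrite gt_eqF// ltr_wpDl// mulr_ge0// sqr_ge0.
  by move: k0 => *; field; apply/andP.
rewrite ler_piMr ?(ltW e0)// ler_pdivrMr ?mul1r ?lerDl//.
by rewrite ltr_wpDl// mulr_ge0// sqr_ge0.
Qed.

(** By Cauchy's theorem for the triangle with vertices 0, [z] and [z + h], the
    increment of the integral from 0 is the integral from [z] to [z + h], where
    [f] is close to [f z]. *)
Lemma primitive_on_disc z : 0 < rho -> cmod z < rho -> cdiff (cint f 0) z (f z).
Proof.
move=> rho0 zrho e e0; have [d dz] := df zrho.
have [del del0 H] := cdiff_ccont dz e0.
exists (Num.min del (rho - cmod z)); first by rewrite lt_min del0 subr_gt0.
move=> h; rewrite lt_min => /andP[hdel hrho].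
have zhrho : cmod (z + h) < rho by have := cmodD z h; lra.
set r := Num.max (cmod z) (cmod (z + h)).
have rr : r < rho by rewrite gt_max zrho.
have zr : cmod z <= r by rewrite le_max lexx.
have zhr : cmod (z + h) <= r by rewrite le_max lexx orbT.
have r0 : cmod (0 : C) <= r by rewrite cmod0 (le_trans (cmod_ge0 z)).
have := @goursat 0 z (z + h); rewrite cmod0 => /(_ rho0 zrho zhrho).
rewrite /tri (disc_cint_rev r0 zhr rr) => /eqP; rewrite subr_eq0 => /eqP <-.
rewrite [_ + cint f z _ - _]addrAC subrr add0r.
have hA : is_cint (fun=> f z) z (z + h) (f z * h).
  have -> : f z * h = (f z * (z + h) + 0 * (z + h) ^+ 2) - (f z * z + 0 * z ^+ 2) by ring.
  apply: (@is_cint_primitive _ (fun w => f z * w + 0 * w ^+ 2)) => t _.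
  by apply: (@quadratic_cdiff 0 (f z)); ring.
have hf := is_cintD (disc_cint zr zhr rr) (is_cintN hA).
have hE : h = z + h - z by ring.
rewrite [X in _ <= _ * cmod X]hE; apply: is_cint_bound hf _ => t /andP[t0 t1].
rewrite /seg [z + h - z]addrC addKr H// cmodM cmod_real ger0_norm//.
by rewrite (le_lt_trans _ hdel)// ler_piMl ?cmod_ge0.
Qed.

End Goursat.

(** * Limits along an ultrafilter and compactness of the disc *)
Section UltraLimit.
Variables (R : realType) (U : set_system nat).
Hypotheses (UU : UltraFilter U) (Uoo : \oo `<=` U).
Local Notation C := (Cplx R).
Implicit Types (u v : nat -> C) (l : C).

Lemma ultra_eventually (P : nat -> Prop) N :
  (forall n, (N <= n)%N -> P n) -> U [set n | P n].
Proof. by move=> H; apply: Uoo; exists N. Qed.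

Definition ulim u l := forall e : R, 0 < e -> U [set n | cmod (u n - l) <= e].

(** An ultrafilter that contains a compact interval converges. *)
Lemma ultra_real_bounded (x : nat -> R) (M : R) : (forall n, `|x n| <= M) ->
  exists p : R, forall e : R, 0 < e -> U [set n | `|x n - p| <= e].
Proof.
move=> xM; have PU : ProperFilter U by exact: ultra_proper.
have xU : (x @ U) `[- M, M].
  by apply: (@filterS _ U _ setT) filterT => n _; rewrite /= in_itv/= -ler_norml.
have [p [_ clp]] := @segment_compact R (- M) M (x @ U) _ xU.
exists p => e e0; have [//|Uc] := in_ultra_setVsetC [set n | `|x n - p| <= e] UU.
have [y /= [ny yp]] : [set y | ~ `|y - p| <= e] `&` ball p e !=set0.
  by apply: clp; [exact: Uc|exact: nbhsx_ballx].
by case: ny; rewrite distrC; exact: ltW.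
Qed.

Lemma ultra_bounded u (M : R) : (forall n, cmod (u n) <= M) ->
  exists l, ulim u l.
Proof.
move=> uM; have PU : ProperFilter U by exact: ultra_proper.
have [p Hp] := ultra_real_bounded (fun n => le_trans (Re_le_cmod _) (uM n)).
have [q Hq] := ultra_real_bounded (fun n => le_trans (Im_le_cmod _) (uM n)).
exists (p +i* q) => e e0; have e2 : 0 < e / 2 by rewrite divr_gt0.
apply: filterS (filterI (Hp _ e2) (Hq _ e2)) => n /= [h1 h2].
rewrite (le_trans (cmod_le_ReIm _))// [leRHS]splitr.
by rewrite ReD ImD ReN ImN lerD.
Qed.

Lemma tends_ulim u l : tends u l -> ulim u l.
Proof. by move=> ul e /ul[N HN]; exact: ultra_eventually HN. Qed.

Lemma ulim_unique u l l' : ulim u l -> ulim u l' -> l = l'.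
Proof.
have PU : ProperFilter U by exact: ultra_proper.
move=> ul ul'; apply: cmod_small_eq => e e0.
have e2 : 0 < e / 2 by rewrite divr_gt0.
have [n [h1 h2]] := filter_ex (filterI (ul _ e2) (ul' _ e2)).
rewrite (le_trans (cmod_dist_trans (u n) _ _))// cmodBC [leRHS]splitr.
by rewrite lerD.
Qed.

Lemma ulimD u v l l' : ulim u l -> ulim v l' -> ulim (fun n => u n + v n) (l + l').
Proof.
have PU : ProperFilter U by exact: ultra_proper.
move=> ul vl e e0; have e2 : 0 < e / 2 by rewrite divr_gt0.
apply: filterS (filterI (ul _ e2) (vl _ e2)) => n /= [h1 h2].
rewrite (_ : _ - _ = (u n - l) + (v n - l')); last by ring.
by rewrite (le_trans (cmodD _ _))// [leRHS]splitr lerD.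
Qed.

Lemma ulimZ a u l : ulim u l -> ulim (fun n => a * u n) (a * l).
Proof.
have PU : ProperFilter U by exact: ultra_proper.
move=> ul e e0; have a0 : 0 < cmod a + 1 by rewrite ltr_wpDl ?cmod_ge0.
apply: filterS (ul (e / (cmod a + 1)) _) => [n /=|]; last by rewrite divr_gt0.
rewrite -mulrBr cmodM ler_pdivlMr// => h; apply: le_trans h.
by rewrite mulrC ler_wpM2l ?cmod_ge0// lerDl.
Qed.

Lemma ulim_sum (c : nat -> nat -> C) (g : nat -> C) K :
  (forall m, ulim (fun n => c n m) (g m)) ->
  ulim (fun n => \sum_(m < K) c n m) (\sum_(m < K) g m).
Proof.
move=> cg; elim: K => [|K IH].
  move=> e e0; apply: (@ultra_eventually _ 0) => n _.
  by rewrite !big_ord0 subrr cmod0 ltW.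
by under eq_fun do rewrite big_ord_recr; rewrite big_ord_recr; exact: ulimD.
Qed.

(** Dominated convergence: beyond a fixed rank all the series are within the tail
    of the majorant, and finitely many terms pass to the limit. *)
Lemma ulim_series (c : nat -> nat -> C) (g G : nat -> C) (S : C) (B : nat -> R) M :
  (forall n m, cmod (c n m) <= B m) -> (forall K, \sum_(m < K) B m <= M) ->
  (forall m, ulim (fun n => c n m) (g m)) ->
  (forall n, sums_to (c n) (G n)) -> sums_to g S -> ulim G S.
Proof.
move=> cB BM cg cG gS e e0.
have PU : ProperFilter U by exact: ultra_proper.
have e4 : 0 < e / 4 by rewrite divr_gt0.
have B0 m : 0 <= B m := le_trans (cmod_ge0 _) (cB 0%N m).
have mono : {homo (fun n => \sum_(i < n) B i) : m n / (m <= n)%N >-> m <= n}.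
  by move=> m n /subnK <-; rewrite addnC big_split_ord/= lerDl sumr_ge0.
have [K HK] := mono_bounded_cauchy mono BM e4.
have tail n k : (K <= k)%N ->
    cmod (\sum_(m < k) c n m - \sum_(m < K) c n m) <= e / 4.
  move=> Kk; apply: le_trans (HK _ Kk).
  move: Kk => /subnK <-; rewrite addnC !big_split_ord/= ![_ + _ - _]addrC !addKr.
  by rewrite (le_trans (cmod_sum _ _ _))// ler_sum.
have Gtail n : cmod (G n - \sum_(m < K) c n m) <= e / 4.
  apply/ler_addgt0Pr => d d0; have [N HN] := cG n d d0.
  have := HN (maxn N K) (leq_maxl _ _); have := tail n _ (leq_maxr N K).
  rewrite [X in _ -> X <= _ -> _]cmodBC => h1 h2.
  apply: (le_trans (cmod_dist_trans (\sum_(m < maxn N K) c n m) _ _)).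
  by rewrite addrC; exact: lerD h1 h2.
have [N HN] := gS _ e4.
apply: filterS (ulim_sum (maxn N K) cg e4) => n /= hn.
have := HN (maxn N K) (leq_maxl _ _); have := tail n _ (leq_maxr N K).
have := Gtail n; move: hn.
set x := \sum_(m < maxn N K) c n m; set y := \sum_(m < maxn N K) g m.
set w := \sum_(m < K) c n m => hn h1 h2 h3.
have -> : G n - S = (G n - w) - (x - w) + (x - y) + (y - S) by ring.
rewrite (le_trans (cmodD _ _))// (le_trans (lerD (cmodD _ _) (lexx _)))//.
rewrite (le_trans (lerD (lerD (cmodB _ _) (lexx _)) (lexx _)))//.
lra.
Qed.

End UltraLimit.

Section DiscCompactness.
Variable R : realType.
Local Notation C := (Cplx R).
Variables (f : C -> C) (r : R).
Hypothesis cf : forall z, cmod z <= r -> ccont f z.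

Lemma exists_ultra : exists U : set_system nat, UltraFilter U /\ \oo `<=` U.
Proof. exact: ultraFilterLemma. Qed.

Lemma ulim_disc (U : set_system nat) (UU : UltraFilter U) (z : nat -> C) l :
  (forall n, cmod (z n) <= r) -> ulim U z l -> cmod l <= r.
Proof.
have PU : ProperFilter U by exact: ultra_proper.
move=> zr zl; apply/ler_addgt0Pr => e /zl/filter_ex[n hn].
rewrite -(subrK (z n) l) (le_trans (cmodD _ _))// addrC lerD//.
by rewrite cmodBC.
Qed.

(** A sequence of points with unbounded values would have a limit in the closed
    disc along an ultrafilter, contrary to continuity there. *)
Lemma disc_bounded : exists M, forall z, cmod z <= r -> cmod (f z) <= M.
Proof.
apply: contrapT => nex.
have /boolp.choice[z zP] n : exists z, cmod z <= r /\ n%:R < cmod (f z).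
  apply: contrapT => nz; apply: nex; exists n%:R => w wr.
  by rewrite leNgt; apply/negP => h; apply: nz; exists w.
have [U [UU Uoo]] := exists_ultra; have PU : ProperFilter U by exact: ultra_proper.
have [l zl] := ultra_bounded UU (fun n => (zP n).1).
have lr := ulim_disc UU (fun n => (zP n).1) zl.
have [del del0 H] := cf lr ltr01.
have del2 : 0 < del / 2 by rewrite divr_gt0.
have big_n : U [set n | cmod (f l) + 1 <= n%:R].
  apply: (ultra_eventually Uoo (N := (Num.truncn (cmod (f l) + 1)).+1)) => n hn.
  by rewrite (le_trans (ltW (truncnS_gt _)))// ler_nat.
have [n [/= h1 h2]] := filter_ex (filterI (zl _ del2) big_n).
have := (zP n).2; rewrite ltNge => /negP; apply.
apply: le_trans h2; rewrite -(subrK (f l) (f (z n))) (le_trans (cmodD _ _))//.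
rewrite addrC lerD2l (_ : f (z n) = f (l + (z n - l))); last by congr f; ring.
rewrite H// (le_lt_trans h1)//.
by rewrite ltr_pdivrMr// ltr_pMr// ltr1n.
Qed.

Lemma disc_unif_cont e : 0 < e -> exists2 del : R, 0 < del &
  forall z w, cmod z <= r -> cmod w <= r -> cmod (z - w) <= del ->
  cmod (f z - f w) <= e.
Proof.
move=> e0; apply: contrapT => nex.
have /boolp.choice[p pP] n : exists p : C * C, [/\ cmod p.1 <= r, cmod p.2 <= r,
    cmod (p.1 - p.2) <= n.+1%:R^-1 & e < cmod (f p.1 - f p.2)].
  apply: contrapT => nz; apply: nex; exists n.+1%:R^-1 => // z w zr wr zw.
  by rewrite leNgt; apply/negP => h; apply: nz; exists (z, w).
have z1 n : cmod (p n).1 <= r by case: (pP n).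
have [U [UU Uoo]] := exists_ultra; have PU : ProperFilter U by exact: ultra_proper.
have [l zl] := ultra_bounded UU z1.
have lr := ulim_disc UU z1 zl.
have e2 : 0 < e / 2 by rewrite divr_gt0.
have [del del0 H] := cf lr e2.
have del4 : 0 < del / 4 by rewrite divr_gt0.
have big_n : U [set n | n.+1%:R^-1 <= del / 4].
  apply: (ultra_eventually Uoo (N := Num.truncn (del / 4)^-1)) => n hn.
  rewrite -[leRHS]invrK lef_pV2 ?posrE ?invr_gt0//.
  by rewrite (le_trans (ltW (truncnS_gt _)))// ler_nat.
have [n [/= h1 h2]] := filter_ex (filterI (zl _ del4) big_n).
have [_ _ h4 h3] := pP n; move: h3; rewrite ltNge => /negP; apply.
rewrite (le_trans (cmod_dist_trans (f l) _ _))// [leRHS]splitr lerD//.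
  rewrite (_ : f (p n).1 = f (l + ((p n).1 - l))); last by congr f; ring.
  by apply: H; lra.
rewrite cmodBC (_ : f (p n).2 = f (l + ((p n).2 - l))); last by congr f; ring.
apply: H.
have := cmod_dist_trans (p n).1 (p n).2 l; rewrite [cmod ((p n).2 - (p n).1)]cmodBC.
have h5 := le_trans h4 h2; clear h2 h4; lra.
Qed.

End DiscCompactness.

(** * Means over the vertices of a regular polygon *)
Section RootsOfUnity.
Variable R : realType.
Local Notation C := (Cplx R).

Definition unity_root (n : nat) : C := cexp ((2 * pi / n%:R : R)%:C * 'i).

Lemma cexp_imaginary (x : R) : cexp (x%:C * 'i) = cos x +i* sin x.
Proof.
have Re0 : complex.Re (x%:C * 'i : C) = 0 by rewrite ReM/=; ring.
have Imx : complex.Im (x%:C * 'i : C) = x by rewrite ImM/=; ring.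
by rewrite /cexp Re0 Imx expR0 mul1r.
Qed.

Lemma cmod_unity_root n : cmod (unity_root n) = 1.
Proof. by rewrite cmod_cexp ReM/= mulr0 mul0r subr0 expR0. Qed.

Lemma unity_rootX n m :
  unity_root n ^+ m = cexp ((2 * pi * (m%:R / n%:R) : R)%:C * 'i).
Proof.
have -> : 2 * pi * (m%:R / n%:R) = m%:R * (2 * pi / n%:R) :> R by ring.
transitivity (cexp ((m%:R : R)%:C * ((2 * pi / n%:R)%:C * 'i))).
  by rewrite rmorph_nat cexpMn.
by rewrite mulrA -rmorphM.
Qed.

Lemma unity_rootXn n : (0 < n)%N -> unity_root n ^+ n = 1.
Proof.
move=> n0; rewrite unity_rootX divff ?pnatr_eq0 -?lt0n// mulr1.
by rewrite cexp_imaginary mulr_natl cos2pi sin2pi.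
Qed.

(** The sine of an angle strictly between 0 and [pi] is positive, and this range
    is enough for the means over polygons with many vertices. *)
Lemma unity_rootX_neq1 n m : (0 < m)%N -> (m.*2 < n)%N -> unity_root n ^+ m != 1.
Proof.
move=> m0 mn; apply/eqP => /(congr1 (@complex.Im R)); rewrite unity_rootX.
rewrite cexp_imaginary /=.
apply/eqP; rewrite gt_eqF// sin_gt0_pi//; apply/andP; split.
  by rewrite !mulr_gt0 ?invr_gt0 ?pi_gt0 ?ltr0n// (leq_trans _ mn).
have n0 : 0 < n%:R :> R by rewrite ltr0n (leq_trans _ mn).
have : (m.*2)%:R < n%:R :> R by rewrite ltr_nat.
rewrite -mul2n natrM => h; rewrite mulrA ltr_pdivrMr// [2 * pi]mulrC -mulrA.
by rewrite ltr_pM2l ?pi_gt0.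
Qed.

Lemma sum_powers_root (x : C) n : x ^+ n = 1 -> x != 1 -> \sum_(j < n) x ^+ j = 0.
Proof.
move=> xn x1; have := subrX1 x n; rewrite xn subrr => /esym/eqP.
by rewrite mulf_eq0 subr_eq0 (negPf x1) => /eqP.
Qed.

Lemma unity_root_to1 e : 0 < e -> exists N, forall n, (N <= n)%N ->
  cmod (unity_root n - 1) <= e.
Proof.
move=> e0; set K : R := 2 * pi * expR (2 * pi).
have pi2 : 0 <= 2 * pi :> R by rewrite mulr_ge0 ?pi_ge0.
exists (Num.truncn (K / e)).+1 => n Nn.
have n0 : 0 < n%:R :> R by rewrite ltr0n (leq_trans _ Nn).
have n1 : 1 <= n%:R :> R by rewrite ler1n (leq_trans _ Nn).
rewrite (le_trans (cmod_cexp_sub1 _))// cmodM cmod_real.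
have -> : cmod 'i = 1 :> R by rewrite cmod_sqrt/= expr0n expr1n add0r sqrtr1.
rewrite mulr1 ger0_norm ?divr_ge0//.
apply: (@le_trans _ _ (K / n%:R)).
  rewrite /K mulrAC ler_wpM2r ?invr_ge0// ler_wpM2l// ler_expR.
  by rewrite ler_pdivrMr// ler_peMr.
rewrite ler_pdivrMr// mulrC -ler_pdivrMr// ltW// (lt_le_trans (truncnS_gt _))//.
by rewrite ler_nat.
Qed.

Lemma geometric_sums (q : C) : cmod q < 1 ->
  (forall n, \sum_(m < n) cmod q ^+ m <= (1 - cmod q)^-1) /\
  sums_to (fun m => q ^+ m) (1 - q)^-1.
Proof.
move=> q1; have q1' : 0 < 1 - cmod q by rewrite subr_gt0.
have bound n : \sum_(m < n) cmod q ^+ m <= (1 - cmod q)^-1.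
  rewrite -[leRHS]mul1r ler_pdivlMr// mulrC -opprB mulNr -subrX1 opprB.
  by rewrite gerBl exprn_ge0// cmod_ge0.
split=> //; have [|S hS] := @abs_summable_sums R (fun m => q ^+ m).
  by exists (1 - cmod q)^-1 => n; under eq_bigr do rewrite cmodX.
suff -> : (1 - q)^-1 = S by [].
have qn1 : 1 - q != 0.
  by rewrite subr_eq0; apply/eqP => q1E; move: q1; rewrite -q1E cmod1 ltxx.
apply: (mulfI qn1); rewrite mulfV//.
apply: (@tends_unique _ (fun n => 1)); first exact: tends_cst.
have qto0 : tends (fun n => q ^+ n) 0.
  have T := tendsB (u := fun n => \sum_(m < n.+1) q ^+ m) (l := S) _ hS.
  have {T} := T _; rewrite subrr => T.
  apply: (@eq_tends _ 0) (T _) => [n _|e /hS[N HN]].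
    by rewrite big_ord_recr/= addrAC subrr add0r.
  by exists N => n Nn; rewrite HN// leqW.
have := tendsD (tendsZ (1 - q) hS) qto0; rewrite addr0.
apply: (@eq_tends _ 0) => n _.
by rewrite -opprB mulNr -subrX1 opprB subrK.
Qed.

End RootsOfUnity.

Section PowerSeriesExpansion.
Variable R : realType.
Local Notation C := (Cplx R).
Variables (F f : C -> C) (rho0 rho : R).
Hypothesis (rho_gt0 : 0 < rho) (rho_lt : rho < rho0).
Hypothesis dF : forall z, cmod z < rho0 -> cdiff F z (f z).
Hypothesis cf : forall z, cmod z < rho0 -> ccont f z.

Lemma increment_bound a b (e : R) : cmod a <= rho -> cmod b <= rho ->
  (forall t, 0 <= t <= 1 -> cmod (f (seg a b t) - f a) <= e) ->
  cmod (F b - F a - f a * (b - a)) <= e * cmod (b - a).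
Proof.
move=> ar br H.
have -> : F b - F a - f a * (b - a) =
    (F (seg a b 1) + 1%:C * (- (f a * (b - a)))) -
    (F (seg a b 0) + 0%:C * (- (f a * (b - a)))).
  by rewrite /seg !mul1r !mul0r addrC !addr0 [a + _]addrC subrK; ring.
apply: (@mean_value_bound _ (fun t => F (seg a b t) + t%:C * (- (f a * (b - a))))
  (fun t => f (seg a b t) * (b - a) + - (f a * (b - a)))) => t t01.
  apply: pderivD; last exact: pderiv_id.
  apply: pderiv_segment; apply: dF.
  by rewrite (le_lt_trans _ rho_lt)// seg_disc.
by rewrite -mulrBl cmodM ler_wpM2r ?cmod_ge0// H.
Qed.

Local Notation om n := (unity_root R n).
Let pt n j := rho%:C * om n ^+ j.

Lemma cmod_pt n j : cmod (pt n j) = rho.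
Proof. by rewrite cmodM cmodX cmod_unity_root expr1n mulr1 cmod_real gtr0_norm. Qed.

Variable z : C.
Hypothesis zr : cmod z < rho.

(** The points [seg z (pt n j) t] form a closed polygon, so that the increments
    of [F] along it cancel; for large [n] they are close to [f] times the edges,
    which are proportional to [pt n j]. *)
Lemma polygon_sum_small (e : R) : 0 < e -> exists N, forall n, (N <= n)%N ->
  forall t, 0 <= t <= 1 ->
  cmod (\sum_(j < n) f (seg z (pt n j) t) * pt n j) <= e * n%:R.
Proof.
move=> e0.
have e1 : 0 < e / rho by rewrite divr_gt0.
have cfr w : cmod w <= rho -> ccont f w by move=> /le_lt_trans h; apply: cf; exact: h.
have [del del0 Hdel] := disc_unif_cont cfr e1.
have d1 : 0 < del / rho by rewrite divr_gt0.
have [N HN] := unity_root_to1 d1.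
exists (maxn N 3) => n; rewrite geq_max => /andP[Nn n3] t /andP[t0 t1].
have n0 : (0 < n)%N by exact: leq_trans n3.
have om1 : om n != 1 by have := @unity_rootX_neq1 R n 1; rewrite expr1 => ->.
have pr j : cmod (pt n j) <= rho by rewrite cmod_pt.
have [t0'|tn0] := eqVneq t 0.
  rewrite t0'; under eq_bigr do rewrite /seg mul0r addr0 /pt mulrA.
  rewrite -big_distrr/= sum_powers_root ?unity_rootXn// mulr0 cmod0.
  by rewrite mulr_ge0// ltW.
have tpos : 0 < t by rewrite lt_neqAle eq_sym tn0.
pose zeta j := seg z (pt n j) t.
have zj j : cmod (zeta j) <= rho by apply: seg_disc => //; [exact: ltW|apply/andP].
have edge j : zeta j.+1 - zeta j = t%:C * (om n - 1) * pt n j.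
  by rewrite /zeta /seg /pt exprS; ring.
have edgeC j : cmod (zeta j.+1 - zeta j) = t * cmod (om n - 1) * rho.
  by rewrite edge [LHS]cmodM cmod_pt cmodM cmod_real ger0_norm.
have edge_le j : cmod (zeta j.+1 - zeta j) <= del.
  rewrite edgeC.
  have := HN n Nn; rewrite ler_pdivlMr// => h; apply: le_trans h.
  by rewrite -mulrA ler_piMl// mulr_ge0 ?cmod_ge0// ltW.
have closed : \sum_(j < n) (F (zeta j.+1) - F (zeta j)) = 0.
  rewrite -(big_mkord xpredT (fun j => F (zeta j.+1) - F (zeta j))).
  rewrite telescope_sumr// /zeta /pt unity_rootXn// expr0; exact: subrr.
have step j : cmod (F (zeta j.+1) - F (zeta j) - f (zeta j) * (zeta j.+1 - zeta j)) <=
    e / rho * cmod (zeta j.+1 - zeta j).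
  apply: increment_bound => // u u01; apply: Hdel => //.
    exact: seg_disc.
  apply: le_trans (edge_le j); move: u01 => /andP[u0 u1].
  rewrite /seg [zeta j + _]addrC addrK cmodM cmod_real ger0_norm//.
  by rewrite ler_piMl ?cmod_ge0.
have tw : 0 < t * cmod (om n - 1) by rewrite mulr_gt0// cmod_gt0 subr_eq0.
rewrite -(ler_pM2l tw).
have -> : t * cmod (om n - 1) * cmod (\sum_(j < n) f (seg z (pt n j) t) * pt n j) =
    cmod (\sum_(j < n) f (zeta j) * (zeta j.+1 - zeta j)).
  rewrite -{1}(ger0_norm t0) -cmod_real -!cmodM big_distrr/=; congr cmod.
  by apply: eq_bigr => j _; rewrite edge; rewrite /zeta; ring.
have -> : \sum_(j < n) f (zeta j) * (zeta j.+1 - zeta j) =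
    - \sum_(j < n) (F (zeta j.+1) - F (zeta j) - f (zeta j) * (zeta j.+1 - zeta j)).
  by rewrite sumrB closed sub0r opprK.
rewrite cmodN (le_trans (cmod_sum _ _ _))//.
apply: (@le_trans _ _ (\sum_(j < n) e * (t * cmod (om n - 1)))).
  apply: ler_sum => j _; apply: le_trans (step j) _.
  rewrite edgeC.
  by rewrite [leLHS](_ : _ = e * (t * cmod (om n - 1)))//; field; rewrite gt_eqF.
by rewrite sumr_const card_ord [leLHS](_ : _ = t * cmod (om n - 1) * (e * n%:R))//; ring.
Qed.

Let ker n j := pt n j / (pt n j - z).

Lemma pt_neq n j : pt n j - z != 0.
Proof.
rewrite subr_eq0; apply/eqP => h; have := cmod_pt n j; rewrite h => h'.
by move: zr; rewrite h' ltxx.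
Qed.

(** The mean of [F (seg z (pt n j) t) * ker n j] over [j] is constant in [t] up to a
    small error, since its derivative is the sum bounded in [polygon_sum_small];
    its values at [t = 1] and [t = 0] are the two terms. *)
Lemma kernel_average_small (e : R) : 0 < e -> exists N, forall n, (N <= n)%N ->
  cmod (n%:R^-1 * \sum_(j < n) F (pt n j) * ker n j -
    F z * (n%:R^-1 * \sum_(j < n) ker n j)) <= e.
Proof.
move=> e0; have [N HN] := polygon_sum_small e0; exists N.+1 => n Nn.
have n0 : 0 < n%:R :> R by rewrite ltr0n (leq_trans _ Nn).
have n0' : (n%:R : C) != 0 by rewrite pnatr_eq0 -lt0n (leq_trans _ Nn).
have -> : n%:R^-1 * (\sum_(j < n) F (pt n j) * ker n j) -
    F z * (n%:R^-1 * \sum_(j < n) ker n j) =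
   n%:R^-1 * (\sum_(j < n) F (seg z (pt n j) 1) * ker n j -
    \sum_(j < n) F (seg z (pt n j) 0) * ker n j).
  rewrite mulrCA -mulrBr; congr (_ * (_ - _)).
    by apply: eq_bigr => j _; rewrite /seg mul1r addrC subrK.
  by rewrite big_distrr; apply: eq_bigr => j _; rewrite /seg mul0r addr0.
rewrite cmodM cmodV cmod_nat mulrC ler_pdivrMr//.
pose P t := \sum_(j < n) F (seg z (pt n j) t) * ker n j.
apply: (@mean_value_bound _ P (fun t => \sum_(j < n) f (seg z (pt n j) t) * pt n j)).
  move=> t t01; rewrite /P.
  have psum m : pderiv (fun t => \sum_(j < m) F (seg z (pt n j) t) * ker n j)
      (\sum_(j < m) f (seg z (pt n j) t) * pt n j) t.
    elim: m => [|m IH].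
      by under eq_fun do rewrite big_ord0; rewrite big_ord0; exact: pderiv_cst.
    under eq_fun do rewrite big_ord_recr/=; rewrite big_ord_recr/=.
    apply: pderivD => //.
    have -> : f (seg z (pt n m) t) * pt n m =
        ker n m * (f (seg z (pt n m) t) * (pt n m - z)).
      by rewrite /ker; field; exact: pt_neq.
    under eq_fun do rewrite mulrC; apply: pderivZ; apply: pderiv_segment.
    apply: dF; rewrite (le_lt_trans _ rho_lt)// seg_disc//; first exact: ltW.
    by rewrite cmod_pt.
  exact: psum.
by move=> t t01; apply: HN => //; exact: ltnW.
Qed.

Lemma ker_sums n j : sums_to (fun m => (z / pt n j) ^+ m) (ker n j).
Proof.
have pn0 : pt n j != 0 by rewrite -cmod_gt0 cmod_pt.
have -> : ker n j = (1 - z / pt n j)^-1.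
  rewrite /ker; have h := pt_neq n j; have h' : pt n j / pt n j - z / pt n j != 0.
    by rewrite -mulrBl mulf_neq0// invr_eq0.
  by field; rewrite h pn0.
apply: (geometric_sums _).2; rewrite cmodM cmodV cmod_pt ltr_pdivrMr//.
by rewrite mul1r.
Qed.

End PowerSeriesExpansion.

(** * Power series of holomorphic functions *)
Section PowerSeriesOfPrimitive.
Variable R : realType.
Local Notation C := (Cplx R).

Lemma sums_to_sum I (s : seq I) (u : I -> nat -> C) (S : I -> C) :
  (forall i, sums_to (u i) (S i)) ->
  sums_to (fun m => \sum_(i <- s) u i m) (\sum_(i <- s) S i).
Proof.
move=> uS; elim: s => [|i s IH].
  under eq_fun do rewrite big_nil; rewrite big_nil.
  by move=> e /ltW e0; exists 0%N => n _; rewrite big1// subrr cmod0.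
by under eq_fun do rewrite big_cons; rewrite big_cons; exact: sums_toD (uS i) IH.
Qed.

Variables (F f : C -> C) (rho0 rho : R).
Hypothesis (rho_gt0 : 0 < rho) (rho_lt : rho < rho0).
Hypothesis dF : forall z, cmod z < rho0 -> cdiff F z (f z).
Hypothesis cf : forall z, cmod z < rho0 -> ccont f z.

Local Notation om n := (unity_root R n).
Local Notation pt n j := (rho%:C * om n ^+ j).

Let avg (H : C -> C) n m := n%:R^-1 * \sum_(j < n) H (pt n j) / (pt n j) ^+ m.

(** Cauchy's estimate for the discrete Fourier coefficients. *)
Lemma cmod_avg H M n m : (forall w, cmod w <= rho -> cmod (H w) <= M) ->
  cmod (avg H n m) <= M / rho ^+ m.
Proof.
move=> HM; have M0 : 0 <= M.
  by rewrite (le_trans (cmod_ge0 _) (HM 0 _))// cmod0 ltW.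
rewrite cmodM cmodV cmod_nat; have [->|n0] := posnP n.
  by rewrite invr0 mul0r divr_ge0// exprn_ge0// ltW.
have n0' : 0 < n%:R :> R by rewrite ltr0n.
rewrite mulrC ler_pdivrMr// (le_trans (cmod_sum _ _ _))//.
apply: (@le_trans _ _ (\sum_(j < n) M / rho ^+ m)); last first.
  by rewrite sumr_const card_ord mulr_natr.
apply: ler_sum => j _; rewrite cmodM cmodV cmodX cmod_pt//.
by rewrite ler_wpM2r ?HM ?cmod_pt// invr_ge0 exprn_ge0// ltW.
Qed.

Lemma avg_sums H n z : cmod z < rho ->
  sums_to (fun m => avg H n m * z ^+ m)
    (n%:R^-1 * \sum_(j < n) H (pt n j) * (pt n j / (pt n j - z))).
Proof.
move=> zr; have := sums_toZ n%:R^-1 (sums_to_sum (index_enum 'I_n)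
  (fun j : 'I_n => sums_toZ (H (pt n j)) (ker_sums rho_gt0 zr n j))).
apply: eq_sums_to => m; rewrite /avg -mulrA big_distrl/=; congr (_ * _).
by apply: eq_bigr => j _; rewrite expr_div_n; ring.
Qed.

Lemma abs_geometric (q : R) (z : C) M : 0 < q -> cmod z < q -> 0 <= M ->
  forall K, \sum_(m < K) M / q ^+ m * cmod z ^+ m <= M / (1 - cmod z / q).
Proof.
move=> q0 zq M0 K; have qq : cmod (z / q%:C) = cmod z / q.
  by rewrite cmodM cmodV cmod_real gtr0_norm.
have zq1 : cmod (z / q%:C) < 1 by rewrite qq ltr_pdivrMr// mul1r.
have := (geometric_sums zq1).1 K; rewrite qq => h.
under eq_bigr do rewrite -mulrA [_ * (cmod z ^+ _)]mulrC -expr_div_n.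
by rewrite -big_distrr/= ler_wpM2l.
Qed.

(** The discrete Fourier coefficients of [F] on the polygon with [n] vertices are
    bounded by Cauchy's estimate, so that they have limits [g m] along an
    ultrafilter. By dominated convergence the means of the Cauchy kernel converge
    to the sum of [g m * z ^ m]; the same means for the constant function 1
    converge to 1, and [kernel_average_small] identifies the limit with [F z]. *)
Lemma c1_power_series : exists g : nat -> C, forall z, cmod z < rho ->
  abs_summable (fun m => g m * z ^+ m) /\ sums_to (fun m => g m * z ^+ m) (F z).
Proof.
have [U [UU Uoo]] := exists_ultra; have PU : ProperFilter U by exact: ultra_proper.
have cF w : cmod w <= rho -> ccont F w.
  by move=> /le_lt_trans h; apply: cdiff_ccont (dF _); exact: h.
have [M FM] := disc_bounded cF.
have M0 : 0 <= M by rewrite (le_trans (cmod_ge0 _) (FM 0 _))// cmod0 ltW.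
have bnd m n := cmod_avg n m FM.
have /boolp.choice[g gP] m : exists l, ulim U (fun n => avg F n m) l.
  exact: ultra_bounded (bnd m).
have gb m : cmod (g m) <= M / rho ^+ m.
  apply/ler_addgt0Pr => e /(gP m)/filter_ex[n hn].
  rewrite -(subrK (avg F n m) (g m)) (le_trans (cmodD _ _))// addrC lerD//.
  by rewrite cmodBC.
exists g => z zr.
have gsum : abs_summable (fun m => g m * z ^+ m).
  exists (M / (1 - cmod z / rho)) => K; apply: le_trans (abs_geometric rho_gt0 zr M0 K).
  by apply: ler_sum => m _; rewrite cmodM cmodX ler_wpM2r ?exprn_ge0 ?cmod_ge0.
split=> //; have [S hS] := abs_summable_sums gsum.
suff -> : F z = S by [].
have avg_lim H (L : nat -> C) (SL : C) (MH : R) :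
    (forall w, cmod w <= rho -> cmod (H w) <= MH) -> 0 <= MH ->
    (forall m, ulim U (fun n => avg H n m) (L m)) ->
    sums_to (fun m => L m * z ^+ m) SL ->
    ulim U (fun n => n%:R^-1 * \sum_(j < n) H (pt n j) * (pt n j / (pt n j - z))) SL.
  move=> HM MH0 HL hSL.
  apply: (ulim_series UU Uoo (B := fun m => MH / rho ^+ m * cmod z ^+ m) _
    (abs_geometric rho_gt0 zr MH0) _ (fun n => avg_sums H n zr) hSL).
    move=> n m; rewrite cmodM cmodX ler_wpM2r ?exprn_ge0 ?cmod_ge0//.
    exact: cmod_avg.
  move=> m; have := ulimZ UU (z ^+ m) (HL m); rewrite mulrC.
  by congr ulim; apply/funext => n; rewrite mulrC.
have limF := avg_lim F g S M FM M0 gP hS.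
have lim1 : ulim U (fun n => n%:R^-1 * \sum_(j < n) (pt n j / (pt n j - z))) 1.
  suff : ulim U (fun n => n%:R^-1 * \sum_(j < n) 1 * (pt n j / (pt n j - z))) 1.
    by congr ulim; apply/funext => n; congr (_ * _); apply: eq_bigr => j _; rewrite mul1r.
  apply: (@avg_lim (fun=> 1) (fun m => (m == 0%N)%:R) 1 1) => //.
  - by move=> w _; rewrite cmod1.
  - case=> [|m].
      apply: tends_ulim => //; apply: (@eq_tends _ 1) (@tends_cst R 1) => n n0.
      rewrite /avg; under eq_bigr do rewrite expr0 divr1.
      by rewrite sumr_const card_ord mulVf// pnatr_eq0 -lt0n.
    apply: tends_ulim => //; apply: (@eq_tends _ (m.+1).*2.+1) (@tends_cst R 0) => n nm.
    have n0 : (0 < n)%N by rewrite (leq_trans _ nm).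
    have powE (j : 'I_n) : 1 / pt n j ^+ m.+1 =
        (rho%:C^-1) ^+ m.+1 * ((om n)^-1 ^+ m.+1) ^+ j.
      by rewrite mul1r exprMn invfM -!exprVn -!exprM [(j * _)%N]mulnC.
    rewrite /avg (eq_bigr _ (fun j _ => powE j)) -big_distrr/= sum_powers_root ?mulr0//.
      by rewrite -exprM mulnC exprM exprVn unity_rootXn// invr1 expr1n.
    by rewrite exprVn invr_eq1 unity_rootX_neq1.
  - apply: (@eq_tends _ 1) (@tends_cst R 1) => n n0.
  case: n n0 => // n _; rewrite big_ord_recl expr0 mulr1 big1 ?addr0// => i _.
  by rewrite mul0r.
have limd : ulim U (fun n => (n%:R^-1 * \sum_(j < n) F (pt n j) * (pt n j / (pt n j - z))) -
    F z * (n%:R^-1 * \sum_(j < n) (pt n j / (pt n j - z)))) 0.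
  apply: tends_ulim => // e e0.
  have [N HN] := kernel_average_small rho_gt0 rho_lt dF cf zr e0.
  by exists N => n /HN; rewrite subr0.
have := ulimD UU limF (ulimZ UU (- F z) lim1); rewrite mulr1 => limd'.
have limdE := ulim_unique UU limd _.
apply/eqP; rewrite eq_sym -subr_eq0 -(limdE (S - F z))//.
by move: limd'; congr ulim; apply/funext => n; rewrite mulNr.
Qed.

End PowerSeriesOfPrimitive.

Section PowerSeriesDerivative.
Variable R : realType.
Local Notation C := (Cplx R).

(** Weighted by [del], the increment is bounded by a single power of
    [cmod z + del], and power series converge on a slightly larger disc. *)
Lemma power_increment (z h : C) (del : R) m : cmod h <= del ->
  cmod ((z + h) ^+ m - z ^+ m) * del <= cmod h * (cmod z + del) ^+ m.
Proof.
move=> hd; have h0 := cmod_ge0 h; have d0 := le_trans h0 hd.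
have q0 : 0 <= cmod z + del by rewrite addr_ge0 ?cmod_ge0.
elim: m => [|m IH]; first by rewrite subrr cmod0 mul0r mulr1.
have -> : (z + h) ^+ m.+1 - z ^+ m.+1 =
    z * ((z + h) ^+ m - z ^+ m) + h * (z + h) ^+ m by rewrite !exprS; ring.
apply: (@le_trans _ _ ((cmod z * cmod ((z + h) ^+ m - z ^+ m) +
    cmod h * (cmod z + del) ^+ m) * del)).
  rewrite ler_wpM2r// (le_trans (cmodD _ _))// !cmodM lerD2l ler_wpM2l//.
  rewrite cmodX lerXn2r ?nnegrE ?cmod_ge0//.
  by rewrite (le_trans (cmodD _ _))// lerD2l.
rewrite mulrDl -mulrA (le_trans (lerD (ler_wpM2l (cmod_ge0 z) IH) (lexx _)))//.
by rewrite exprS [leLHS](_ : _ = cmod h * ((cmod z + del) * (cmod z + del) ^+ m))//; ring.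
Qed.

Lemma power_increment2 (z h : C) (del : R) m : cmod h <= del ->
  cmod ((z + h) ^+ m - z ^+ m - m%:R * z ^+ m.-1 * h) * del ^+ 2 <=
  cmod h ^+ 2 * (cmod z + del) ^+ m.
Proof.
move=> hd; have h0 := cmod_ge0 h; have d0 := le_trans h0 hd.
elim: m => [|m IH].
  by rewrite !expr0 !mul0r !subrr cmod0 mul0r mulr1 sqr_ge0.
have -> : (z + h) ^+ m.+1 - z ^+ m.+1 - m.+1%:R * z ^+ m.+1.-1 * h =
    z * ((z + h) ^+ m - z ^+ m - m%:R * z ^+ m.-1 * h) +
    h * ((z + h) ^+ m - z ^+ m).
  rewrite -natr1 /=; case: m {IH} => [|m] /=; last by rewrite !exprS; ring.
  by rewrite !expr0 expr1; ring.
apply: (@le_trans _ _ (cmod z * (cmod h ^+ 2 * (cmod z + del) ^+ m) +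
    cmod h * del * (cmod h * (cmod z + del) ^+ m))); last first.
  rewrite (exprS (cmod z + del)).
  by rewrite [leLHS](_ : _ = cmod h ^+ 2 * ((cmod z + del) * (cmod z + del) ^+ m))//; ring.
apply: (@le_trans _ _ ((cmod z * cmod ((z + h) ^+ m - z ^+ m - m%:R * z ^+ m.-1 * h) +
    cmod h * cmod ((z + h) ^+ m - z ^+ m)) * del ^+ 2)).
  by rewrite ler_wpM2r ?sqr_ge0// (le_trans (cmodD _ _))// !cmodM.
rewrite mulrDl -[X in X + _]mulrA lerD ?ler_wpM2l ?cmod_ge0//.
rewrite [leLHS](_ : _ = cmod h * del * (cmod ((z + h) ^+ m - z ^+ m) * del)); last by ring.
by rewrite ler_wpM2l ?mulr_ge0// power_increment.
Qed.

Lemma power_derivative_bound (a del : R) m : 0 <= a -> 0 <= del ->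
  m%:R * a ^+ m.-1 * del <= (a + del) ^+ m.
Proof.
move=> a0 d0; elim: m => [|m IH]; first by rewrite !mul0r ler01.
have am : a ^+ m <= (a + del) ^+ m by rewrite lerXn2r ?nnegrE ?addr_ge0// lerDl.
have -> : m.+1%:R * a ^+ m.+1.-1 * del = a * (m%:R * a ^+ m.-1 * del) + del * a ^+ m.
  rewrite -natr1 /=; case: m {IH am} => [|m] /=; last by rewrite !exprS; ring.
  by rewrite !expr0; ring.
by rewrite exprS mulrDl lerD// ler_wpM2l.
Qed.

Lemma sums_to_shift (u : nat -> C) S : u 0%N = 0 -> sums_to u S ->
  sums_to (fun m => u m.+1) S.
Proof.
move=> u0 uS e e0; have [N HN] := uS e e0; exists N => n Nn.
have := HN n.+1 (leqW Nn); rewrite big_ord_recl u0 add0r.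
by congr (cmod (_ - _) <= _).
Qed.

Definition expands (f : C -> C) (g : nat -> C) (rho : R) :=
  forall z, cmod z < rho -> abs_summable (fun m => g m * z ^+ m) /\
    sums_to (fun m => g m * z ^+ m) (f z).

Definition deriv_coef (g : nat -> C) : nat -> C := fun m => m.+1%:R * g m.+1.

(** On the circle of radius [q], halfway between [cmod z] and [rho], the series still
    converges absolutely, and it dominates the quadratic errors of its terms. *)
Lemma expands_deriv f g rho z : expands f g rho -> cmod z < rho ->
  [/\ abs_summable (fun m => deriv_coef g m * z ^+ m),
      sums_to (fun m => deriv_coef g m * z ^+ m) (derive1 f z) &
      cdiff f z (derive1 f z)].
Proof.
move=> fg zr; set del := (rho - cmod z) / 2.
have del0 : 0 < del by rewrite divr_gt0// subr_gt0.
set q := cmod z + del; have q0 : 0 <= q by rewrite addr_ge0 ?cmod_ge0// ltW.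
have qr : q < rho by rewrite /q /del; move: zr; lra.
have [|[M gM] _] := fg q%:C; first by rewrite cmod_real ger0_norm.
have gM' n : \sum_(i < n) cmod (g i) * q ^+ i <= M.
  apply: le_trans (gM n); apply: ler_sum => i _.
  by rewrite cmodM cmodX cmod_real ger0_norm.
pose d m := m%:R * g m * z ^+ m.-1.
have dM : abs_bounded d (M / del).
  move=> n; apply: (@le_trans _ _ (\sum_(i < n) cmod (g i) * q ^+ i / del)).
    apply: ler_sum => i _; rewrite !cmodM cmodX cmod_nat [i%:R * _]mulrC -!mulrA.
    rewrite ler_wpM2l ?cmod_ge0// ler_pdivlMr// power_derivative_bound ?cmod_ge0//.
    exact: ltW.
  by rewrite -big_distrl/= ler_pM2r ?invr_gt0 ?gM'.
have [D dD] := abs_summable_sums (ex_intro _ _ dM).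
have fD : cdiff f z D.
  apply: (@cdiff_series R (fun m w => g m * w ^+ m) f d D z del (M / del ^+ 2)
    (fun m => cmod (g m) * q ^+ m / del ^+ 2)) => //.
  - by move=> n; rewrite -big_distrl/= ler_pM2r ?invr_gt0 ?exprn_gt0 ?gM'.
  - move=> m h hd.
    have -> : g m * (z + h) ^+ m - g m * z ^+ m - d m * h =
        g m * ((z + h) ^+ m - z ^+ m - m%:R * z ^+ m.-1 * h) by rewrite /d; ring.
    have := power_increment2 z m (ltW hd); rewrite -ler_pdivlMr ?exprn_gt0// => P.
    rewrite cmodM [leRHS](_ : _ = cmod (g m) * (cmod h ^+ 2 * q ^+ m / del ^+ 2)).
      by rewrite ler_wpM2l ?cmod_ge0.
    by ring.
  - move=> h hd; apply: (fg _ _).2; rewrite (le_lt_trans (cmodD _ _))//.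
    by apply: lt_trans qr; rewrite ltrD2l.
have DE : derive1 f z = D by exact: cdiff_derive1.
rewrite DE; split=> //.
  have dM' : abs_summable (fun m => d m.+1).
    exists (M / del) => n; have := dM n.+1; rewrite big_ord_recl; apply: le_trans.
    by rewrite lerDr cmod_ge0.
  by apply: (@abs_summable_le _ _ (fun m => d m.+1) 1) dM' => m; rewrite mul1r.
by apply: sums_to_shift dD; rewrite /d !mul0r.
Qed.

Lemma expands_derive1 f g rho : expands f g rho ->
  expands (derive1 f) (deriv_coef g) rho.
Proof. by move=> fg z zr; have [] := expands_deriv fg zr. Qed.

Lemma expands_at0 f g rho : 0 < rho -> expands f g rho -> f 0 = g 0%N.
Proof.
move=> rho0 /(_ 0); rewrite cmod0 => /(_ rho0)[_ h].
apply: tends_unique h _; apply: (@eq_tends _ 1 (fun=> g 0%N)); last exact: tends_cst.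
move=> [//|n] _; rewrite big_ord_recl mulr1 big1 ?addr0// => i _.
by rewrite exprS mul0r mulr0.
Qed.

(** All derivatives are again sums of power series, whose constant terms are
    read off at 0. *)
Lemma taylor_expands f g rho : 0 < rho -> expands f g rho -> taylor f =1 g.
Proof.
move=> rho0 fg n.
have it m : expands (derive1n m f) (iter m deriv_coef g) rho.
  by elim: m => [//|m IH]; rewrite derive1nS; exact: expands_derive1.
have itE m k : iter m deriv_coef g k * k`!%:R = (k + m)`!%:R * g (k + m)%N.
  elim: m k => [|m IH] k; first by rewrite addn0 mulrC.
  rewrite iterS /deriv_coef mulrAC -natrM -factS mulrC IH.
  by rewrite addSnnS.
rewrite /taylor (expands_at0 rho0 (it n)); have := itE n 0%N.
rewrite add0n fact0 mulr1 => ->; rewrite mulrC mulKf// pnatr_eq0 -lt0n fact_gt0.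
Qed.

Lemma eq_expands f f' g rho : (forall z, cmod z < rho -> f z = f' z) ->
  expands f g rho -> expands f' g rho.
Proof. by move=> ff' fg z zr; rewrite -ff'//; exact: fg. Qed.

(** The function is the derivative of its primitive [cint f 0], which is
    continuously differentiable and hence the sum of a power series. *)
Theorem holomorphic_expands f rho :
  (forall z, cmod z < rho -> exists d, cdiff f z d) -> expands f (taylor f) rho.
Proof.
move=> df z zr; set r := (cmod z + rho) / 2.
have rho0 : 0 < rho by exact: le_lt_trans (cmod_ge0 _) zr.
have zr' : cmod z < r by rewrite /r; lra.
have r0 : 0 < r by exact: le_lt_trans (cmod_ge0 _) zr'.
have rr : r < rho by rewrite /r; lra.
have dF w : cmod w < rho -> cdiff (cint f 0) w (f w).
  exact: primitive_on_disc.
have cf w : cmod w < rho -> ccont f w by move=> /df[d]; exact: cdiff_ccont.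
have [g Fg] := c1_power_series r0 rr dF cf.
have fg : expands f (deriv_coef g) r.
  apply: eq_expands (expands_derive1 (Fg : expands _ g r)) => w wr.
  exact: cdiff_derive1 (dF _ (lt_trans wr rr)).
have tE := taylor_expands r0 fg.
have [h1 h2] := fg z zr'; split.
  by apply: (@abs_summable_le _ _ _ 1) h1 => m; rewrite tE mul1r.
by apply: eq_sums_to h2 => m; rewrite tE.
Qed.

End PowerSeriesDerivative.

(** * Formal logarithms *)
Section FormalLogarithm.
Variable F : numFieldType.
Implicit Types (a b l : nat -> F) (p q u : {poly F}).

Lemma coef_trunc a m k : (trunc_poly a m)`_k = if (k <= m)%N then a k else 0.
Proof. by rewrite coef_poly ltnS. Qed.

Definition eq_upto m p q := forall k, (k <= m)%N -> p`_k = q`_k.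

Lemma eq_uptoM m p p' q q' : eq_upto m p p' -> eq_upto m q q' ->
  eq_upto m (p * q) (p' * q').
Proof.
move=> pp qq k km; rewrite !coefM; apply: eq_bigr => i _.
have ik : (i <= k)%N by rewrite -ltnS.
by rewrite pp ?qq// ?(leq_trans _ km)// leq_subr.
Qed.

Lemma eq_uptoX m p q j : eq_upto m p q -> eq_upto m (p ^+ j) (q ^+ j).
Proof. by move=> pq; elim: j => [|j IH] //; rewrite !exprS; exact: eq_uptoM. Qed.

Lemma eq_upto_trunc a m n k : (k <= m)%N -> (k <= n)%N ->
  eq_upto k (trunc_poly a m) (trunc_poly a n).
Proof.
by move=> km kn i ik; rewrite !coef_trunc (leq_trans ik km) (leq_trans ik kn).
Qed.

Lemma coefM_exp_low p u j k : u`_0 = 0 -> (k < j)%N -> (p * u ^+ j)`_k = 0.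
Proof.
move=> u0 kj; have -> : u = drop_poly 1 u * 'X.
  by apply/polyP => -[|i]; rewrite coefMX//= coef_drop_poly addn1.
by rewrite exprMn mulrA coefMXn kj.
Qed.

(** [l] is the logarithm of [a] up to its constant term: [a' = l' a], coefficient
    by coefficient. *)
Definition log_deriv a l := forall n,
  n.+1%:R * a n.+1 = \sum_(i < n.+1) i.+1%:R * l i.+1 * a (n - i)%N.

(** Modulo powers of ['X], the relation holds between polynomials, where the
    rules for derivatives are at hand. *)
Lemma log_derivP a l : log_deriv a l <-> (forall m n, (n < m)%N ->
  (deriv (trunc_poly a m))`_n = (deriv (trunc_poly l m) * trunc_poly a m)`_n).
Proof.
have E m n : (n < m)%N -> (deriv (trunc_poly a m))`_n = n.+1%:R * a n.+1.
  by move=> nm; rewrite coef_deriv coef_trunc nm mulr_natl.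
have E' m n : (n < m)%N -> (deriv (trunc_poly l m) * trunc_poly a m)`_n =
    \sum_(i < n.+1) i.+1%:R * l i.+1 * a (n - i)%N.
  move=> nm; rewrite coefM; apply: eq_bigr => i _.
  rewrite coef_deriv !coef_trunc (leq_trans (leq_subr _ _) (ltnW nm)) mulr_natl.
  by rewrite (leq_trans _ nm).
split=> [al m n nm|H n]; first by rewrite E// E'.
by have := H n.+1 n (ltnSn n); rewrite E// E'.
Qed.

Lemma coef_trunc_sub1_0 a m : a 0%N = 1 -> (trunc_poly a m - 1)`_0 = 0.
Proof. by move=> a0; rewrite coefB coef1 coef_trunc a0 subrr. Qed.

Let log_poly a m := \sum_(1 <= k < m.+1)
  ((-1) ^+ k.+1 / k%:R) *: (trunc_poly a m - 1) ^+ k.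

Lemma fps_log_coef a m n : a 0%N = 1 -> (n <= m)%N -> fps_log a n = (log_poly a m)`_n.
Proof.
move=> a0 nm; rewrite /fps_log /log_poly coef_sum [RHS](big_cat_nat (n := n.+1))//=.
rewrite [X in _ = _ + X]big_nat [X in _ = _ + X]big1 ?addr0.
  rewrite big_nat [RHS]big_nat; apply: eq_bigr => k _; rewrite coefZ; congr (_ * _).
  have e : eq_upto n (trunc_poly a n - 1) (trunc_poly a m - 1).
    by move=> i im; rewrite !coefB (@eq_upto_trunc a n m n).
  exact: (eq_uptoX k e).
move=> k /andP[nk _]; rewrite coefZ -[(_ - 1) ^+ k]mul1r coefM_exp_low ?mulr0//.
exact: coef_trunc_sub1_0.
Qed.

(** With [a = 1 + u], the derivative of the truncated logarithm is a geometric
    sum in [- u], so that its product by [a] telescopes to [u' (1 - (- u) ^ m)]. *)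
Lemma fps_log_deriv a : a 0%N = 1 -> log_deriv a (fps_log a).
Proof.
move=> a0; apply/log_derivP => m n nm.
set T := trunc_poly a m; set u : {poly F} := T - 1.
have -> : (deriv (trunc_poly (fps_log a) m) * T)`_n = (deriv (log_poly a m) * T)`_n.
  apply: (eq_uptoM (m := n)) => // k kn; rewrite !coef_deriv coef_trunc.
  by rewrite (leq_ltn_trans kn nm) (@fps_log_coef a m k.+1)// (leq_ltn_trans kn nm).
have dT : deriv T = deriv u by rewrite /u derivB derivC subr0.
have key : deriv (log_poly a m) * T = deriv u * (1 - (- u) ^+ m).
  have dL : deriv (log_poly a m) = deriv u * \sum_(k < m) (- u) ^+ k.
    rewrite /log_poly raddf_sum/= big_add1 big_mkord big_distrr/=.
    apply: eq_bigr => k _; rewrite derivZ deriv_exp /= -[(_ * _) *+ _]scaler_nat scalerA.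
    rewrite mulfVK ?pnatr_eq0// -/T -/u -[- u]scaleN1r exprZn -scalerAr.
    by congr (_ *: _); rewrite !exprS !mulN1r opprK.
  rewrite dL -mulrA; congr (_ * _); have -> : T = - (- u - 1).
    by rewrite opprB opprK /u addrC subrK.
  by rewrite mulrC mulNr -subrX1 opprB.
rewrite key mulrBr mulr1 coefB [X in _ - X](_ : _ = 0).
  by rewrite subr0 -dT.
rewrite exprNn mulrA coefM_exp_low//; exact: coef_trunc_sub1_0.
Qed.

Lemma fps_log0 a : fps_log a 0%N = 0.
Proof. by rewrite /fps_log big_geq. Qed.

Let exp_poly l m := \sum_(0 <= k < m.+1) (k`!%:R^-1) *: (trunc_poly l m) ^+ k.

Lemma fps_exp_coef l m n : l 0%N = 0 -> (n <= m)%N -> fps_exp l n = (exp_poly l m)`_n.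
Proof.
move=> l0 nm; rewrite /fps_exp /exp_poly coef_sum [RHS](big_cat_nat (n := n.+1))//=.
rewrite [X in _ = _ + X]big_nat [X in _ = _ + X]big1 ?addr0.
  rewrite big_nat [RHS]big_nat; apply: eq_bigr => k _; rewrite coefZ; congr (_ * _).
  exact: (eq_uptoX k (@eq_upto_trunc l n m n (leqnn n) nm)).
move=> k /andP[nk _]; rewrite coefZ -[_ ^+ k]mul1r coefM_exp_low ?mulr0//.
by rewrite coef_trunc.
Qed.

(** Differentiating the truncated exponential of [u] multiplies it by [u'], up to
    the last term, which is a multiple of [u ^ m]. *)
Lemma fps_exp_deriv l : l 0%N = 0 -> log_deriv (fps_exp l) l.
Proof.
move=> l0; apply/log_derivP => m n nm; set u := trunc_poly l m.
have -> : (deriv (trunc_poly (fps_exp l) m))`_n = (deriv (exp_poly l m))`_n.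
  by rewrite !coef_deriv coef_trunc nm (@fps_exp_coef l m).
have -> : (deriv u * trunc_poly (fps_exp l) m)`_n = (deriv u * exp_poly l m)`_n.
  apply: (eq_uptoM (m := n)) => // k kn; rewrite coef_trunc.
  by rewrite (leq_trans kn (ltnW nm)) (@fps_exp_coef l m)// (leq_trans kn (ltnW nm)).
have key : deriv (exp_poly l m) = deriv u * exp_poly l m - (m`!%:R^-1) *: (deriv u * u ^+ m).
  rewrite /exp_poly raddf_sum/= big_nat_recl// big_nat_recr//= expr0 derivZ.
  have -> : deriv (1 : {poly F}) = 0 by rewrite -polyC1 derivC.
  rewrite scaler0 add0r mulrDr -scalerAr addrK.
  rewrite big_distrr/=; apply: eq_bigr => k _; rewrite derivZ deriv_exp /=.
  rewrite -[(_ * _) *+ _]scaler_nat scalerA factS natrM invfM mulrC mulVKf ?pnatr_eq0//.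
  by rewrite -scalerAr.
rewrite key coefB coefZ coefM_exp_low ?mulr0 ?subr0//.
by rewrite coef_trunc.
Qed.

Lemma fps_exp0 l : fps_exp l 0%N = 1.
Proof. by rewrite /fps_exp big_nat1 expr0 coef1 fact0 invr1 mulr1. Qed.

Lemma fps_pow_deriv a (c : F) :
  log_deriv (fps_pow a c) (fun m => c * fps_log a m).
Proof. by apply: fps_exp_deriv; rewrite fps_log0 mulr0. Qed.

Lemma fps_pow0 a (c : F) : fps_pow a c 0%N = 1.
Proof. exact: fps_exp0. Qed.

Lemma log_deriv_unique a l l' : a 0%N = 1 -> log_deriv a l -> log_deriv a l' ->
  forall m, l m.+1 = l' m.+1.
Proof.
move=> a0 al al' m; have [n] := ubnP m; elim: n m => // n IH m mn.
have := al m; rewrite al' !big_ord_recr/= subnn a0 !mulr1.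
rewrite (eq_bigr (fun i : 'I_m => i.+1%:R * l i.+1 * a (m - i)%N)).
  by move=> /addrI/mulfI; rewrite pnatr_eq0 => /(_ isT) ->.
by move=> i _; rewrite IH// (leq_trans (ltn_ord i)).
Qed.

Lemma fps_logE a l : a 0%N = 1 -> log_deriv a l -> forall m, fps_log a m.+1 = l m.+1.
Proof. by move=> a0 al; apply: log_deriv_unique a0 (fps_log_deriv a0) al. Qed.

(** The relation gives [a] recursively in terms of [l]. *)
Lemma log_deriv_vanish a l N : log_deriv a l ->
  (forall m, (m < N)%N -> l m.+1 = 0) -> forall m, (m < N)%N -> a m.+1 = 0.
Proof.
move=> al l0 m mN; have /eqP := al m; rewrite big1.
  by rewrite mulf_eq0 pnatr_eq0 /= => /eqP.
by move=> i _; rewrite l0 ?mulr0 ?mul0r// (leq_ltn_trans _ mN)// -ltnS.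
Qed.

Lemma convE a b m : conv addn a b m = \sum_(i < m.+1) a i * b (m - i)%N.
Proof.
apply: eq_bigr => i _; have mi : (m - i < m.+1)%N by rewrite ltnS leq_subr.
rewrite (big_pred1 (Ordinal mi))// => j /=.
by rewrite -val_eqE/=; have := ltn_ord i; case: eqP; case: eqP; lia.
Qed.

Lemma conv_trunc a b m n : (n <= m)%N ->
  conv addn a b n = (trunc_poly a m * trunc_poly b m)`_n.
Proof.
move=> nm; rewrite convE coefM; apply: eq_bigr => i _; rewrite !coef_trunc.
by rewrite !(leq_trans _ nm) ?leq_subr// -ltnS.
Qed.

(** The Leibniz rule turns the product of series into the sum of logarithms. *)
Lemma log_derivM a b l l' : log_deriv a l -> log_deriv b l' ->
  log_deriv (conv addn a b) (fun m => l m + l' m).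
Proof.
move=> /log_derivP al /log_derivP bl; apply/log_derivP => m n nm.
set A := trunc_poly a m; set B := trunc_poly b m.
set L := trunc_poly l m; set L' := trunc_poly l' m.
have -> : (deriv (trunc_poly (conv addn a b) m))`_n = (deriv (A * B))`_n.
  by rewrite !coef_deriv coef_trunc nm (@conv_trunc a b m).
have -> : trunc_poly (fun m0 => l m0 + l' m0) m = L + L'.
  by apply/polyP => i; rewrite coefD !coef_trunc; case: ifP; rewrite ?addr0.
have -> : (deriv (L + L') * trunc_poly (conv addn a b) m)`_n =
   (deriv (L + L') * (A * B))`_n.
  apply: (eq_uptoM (m := n)) => // k kn; rewrite coef_trunc.
  by rewrite (leq_trans kn (ltnW nm)) (@conv_trunc a b m)// (leq_trans kn (ltnW nm)).
rewrite derivM coefD derivD.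
have -> : (deriv A * B)`_n = (deriv L * A * B)`_n.
  by apply: (eq_uptoM (m := n)) => // k kn; apply: al; exact: leq_ltn_trans kn nm.
have -> : (A * deriv B)`_n = (A * (deriv L' * B))`_n.
  by apply: (eq_uptoM (m := n)) => // k kn; apply: bl; exact: leq_ltn_trans kn nm.
rewrite -coefD (_ : _ + _ = (deriv L + deriv L') * (A * B))//; ring.
Qed.

Lemma log_deriv1 : log_deriv (fun m => (m == 0%N)%:R) (fun=> 0).
Proof. by move=> n; rewrite mulr0 big1// => i _; rewrite mulr0 mul0r. Qed.

End FormalLogarithm.

Section Inflation.
Variable F : numFieldType.
Implicit Types (a l : nat -> F).

(** The coefficients of [a (z ^ n)]. *)
Definition inflate n a : nat -> F := fun m => if (n %| m)%N then a (m %/ n)%N else 0.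

Lemma trunc_inflate n a m k : (0 < n)%N -> (k <= m)%N ->
  (trunc_poly (inflate n a) m)`_k = (trunc_poly a m \Po 'X^n)`_k.
Proof.
move=> n0 km; rewrite coef_trunc km coef_comp_poly_Xn// /inflate coef_trunc.
by rewrite (leq_trans (leq_div _ _) km).
Qed.

(** The chain rule multiplies both sides by the derivative of ['X^n]. *)
Lemma log_deriv_inflate n a l : (0 < n)%N -> log_deriv a l ->
  log_deriv (inflate n a) (inflate n l).
Proof.
move=> n0 /log_derivP al; apply/log_derivP => m k km.
set A := trunc_poly a m; set Lp := trunc_poly l m.
have dI (c : nat -> F) i : (i < m)%N ->
    (deriv (trunc_poly (inflate n c) m))`_i = (deriv (trunc_poly c m \Po 'X^n))`_i.
  by move=> im; rewrite !coef_deriv trunc_inflate.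
rewrite dI//.
have -> : (deriv (trunc_poly (inflate n l) m) * trunc_poly (inflate n a) m)`_k =
    (deriv (Lp \Po 'X^n) * (A \Po 'X^n))`_k.
  apply: (eq_uptoM (m := k)) => // i ik.
    by apply: dI; exact: leq_ltn_trans km.
  by apply: trunc_inflate => //; exact: leq_trans ik (ltnW km).
rewrite !deriv_comp mulrAC -comp_polyM.
apply: (eq_uptoM (m := k)) => // i ik; rewrite !coef_comp_poly_Xn//.
case: ifP => // _; apply: al; apply: leq_ltn_trans (leq_div _ _) _.
exact: leq_ltn_trans km.
Qed.

End Inflation.

(** * Growth of the coefficients of a power *)
Section PowerGrowth.
Variable R : realType.
Local Notation C := (Cplx R).

Lemma hockey_stick K m : (\sum_(i < m.+1) 'C(K + i, i) = 'C(K.+1 + m, m))%N.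
Proof.
elim: m => [|m IH]; first by rewrite big_ord1 !bin0.
by rewrite big_ord_recr/= IH !addSn !addnS [RHS]binS addnC.
Qed.

(** The expansion of [(1 - x) ^ - (K + 1)]; multiplication by [1 - x] lowers [K] by
    the hockey-stick identity. *)
Lemma negative_binomial_bound K (x : R) M : 0 <= x < 1 ->
  \sum_(m < M) 'C(K + m, m)%:R * x ^+ m <= (1 - x)^-1 ^+ K.+1.
Proof.
move=> /andP[x0 x1]; have x1' : 0 < 1 - x by rewrite subr_gt0.
elim: K M => [|K IH] M.
  under eq_bigr do rewrite add0n binn mul1r.
  rewrite expr1 -[leRHS]mul1r ler_pdivlMr// mulrC -opprB mulNr -subrX1 opprB.
  by rewrite gerBl exprn_ge0.
rewrite exprSr ler_pdivlMr//; apply: le_trans (IH M).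
pose d M := (\sum_(i < M) 'C(K + i, i))%N.
suff -> : (\sum_(m < M) 'C(K.+1 + m, m)%:R * x ^+ m) * (1 - x) =
    \sum_(m < M) 'C(K + m, m)%:R * x ^+ m - (d M)%:R * x ^+ M.
  by rewrite gerBl mulr_ge0// exprn_ge0.
elim: M => [|M IHM]; first by rewrite /d !big_ord0 !mul0r subr0.
rewrite !big_ord_recr/= mulrDl IHM -(hockey_stick K M) -/(d M.+1).
have -> : (d M.+1)%:R = (d M)%:R + 'C(K + M, M)%:R :> R.
  by rewrite -natrD /d big_ord_recr.
by rewrite exprS; ring.
Qed.

(** The exponential of a series with coefficients at most [(K + 1) / m] is
    majorized by that of [(K + 1) log (1 - z)^-1], whose coefficients are
    binomial. *)
Lemma log_deriv_growth (a l : nat -> C) K : a 0%N = 1 -> log_deriv a l ->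
  (forall m, cmod (m.+1%:R * l m.+1) <= K.+1%:R) ->
  forall m, cmod (a m) <= 'C(K + m, m)%:R.
Proof.
move=> a0 al lK m; have [n] := ubnP m; elim: n m => // n IH [|m] mn.
  by rewrite a0 cmod1 bin0.
have m0 : 0 < m.+1%:R :> R by rewrite ltr0n.
rewrite -(ler_pM2l m0) -(cmod_nat R m.+1) -cmodM al (le_trans (cmod_sum _ _ _))//.
rewrite cmod_nat.
apply: (@le_trans _ _ (\sum_(i < m.+1) K.+1%:R * 'C(K + (m - i), m - i)%:R)).
  apply: ler_sum => i _; rewrite cmodM ler_pM ?cmod_ge0// IH//.
  by rewrite (leq_ltn_trans (leq_subr _ _)).
rewrite -big_distrr/= (reindex_inj rev_ord_inj)/=.
under eq_bigr => i _ do rewrite subSS subKn -1?ltnS//.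
rewrite -natr_sum hockey_stick -!natrM ler_nat mul_bin_left addnS -addSn addnK.
by rewrite leqnn.
Qed.

Lemma abs_summable_growth (a l : nat -> C) (M : R) (z : C) : a 0%N = 1 ->
  log_deriv a l -> (forall m, cmod (m.+1%:R * l m.+1) <= M) -> cmod z < 1 ->
  abs_summable (fun m => a m * z ^+ m).
Proof.
move=> a0 al lM z1; set K := Num.truncn M.
have lK m : cmod (m.+1%:R * l m.+1) <= K.+1%:R.
  by rewrite (le_trans (lM m))// ltW// truncnS_gt.
exists ((1 - cmod z)^-1 ^+ K.+1) => n.
have z01 : 0 <= cmod z < 1 by rewrite cmod_ge0.
apply: le_trans (negative_binomial_bound K n z01).
apply: ler_sum => m _; rewrite cmodM cmodX ler_wpM2r ?exprn_ge0 ?cmod_ge0//.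
exact: log_deriv_growth lK m.
Qed.

(** A product with the series 1, for the index [n * i + j]. *)
Lemma sums_to_inflate (c : nat -> C) n (z S : C) : (0 < n)%N ->
  abs_summable (fun m => c m * (z ^+ n) ^+ m) ->
  sums_to (fun m => c m * (z ^+ n) ^+ m) S ->
  abs_summable (fun m => inflate n c m * z ^+ m) /\
  sums_to (fun m => inflate n c m * z ^+ m) S.
Proof.
move=> n0 ca cS.
have kP : increasing_index (fun i j => n * i + j)%N.
  by move=> i j; split; [rewrite (leq_trans (leq_pmull i n0))// leq_addr|rewrite leq_addl].
have E m :
    conv (fun i j => n * i + j)%N (fun i => c i * (z ^+ n) ^+ i) (unit_seq C) m =
    inflate n c m * z ^+ m.
  rewrite /conv /inflate; have inner (i : 'I_m.+1) :
      \sum_(j < m.+1 | (n * i + j == m)%N) c i * (z ^+ n) ^+ i * unit_seq C j =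
      if (n * i == m)%N then c i * (z ^+ n) ^+ i else 0.
    rewrite big_mkcond big_ord_recl/= addn0 big1 ?addr0 ?mulr1// => j _.
    by rewrite mulr0 if_same.
  under eq_bigr do rewrite inner; rewrite -big_mkcond/=.
  case: ifPn => [/dvdnP[q mE]|nm].
    have qm : (q < m.+1)%N by rewrite ltnS mE leq_pmulr.
    rewrite (big_pred1 (Ordinal qm)) => [|i /=].
      have -> : (m %/ n)%N = q by rewrite mE mulnK.
      by rewrite /= -exprM mulnC -mE.
    by rewrite -val_eqE/= [in X in _ == X]mE mulnC eqn_pmul2r.
  rewrite big_pred0 ?mul0r// => i; apply/negP => /eqP mE.
  by case/negP: nm; rewrite -mE dvdn_mulr.
split.
  have := abs_summable_conv kP ca (@abs_summable_unit R).
  by apply: (@abs_summable_le _ _ _ 1) => m; rewrite E mul1r.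
have := sums_to_conv kP ca (@abs_summable_unit R) cS (@sums_to_unit R); rewrite mulr1.
exact: eq_sums_to.
Qed.

End PowerGrowth.

(** * Characteristic polynomials of matrices of finite order *)
Section FiniteOrderMatrix.
Variable F : numClosedFieldType.

(** The minimal polynomial divides the separable polynomial ['X^e - 1]. *)
Lemma finite_order_diagonalizable n (A : 'M[F]_n.+1) e : (0 < e)%N ->
  A ^+ e = 1 -> diagonalizable A.
Proof.
move=> e0 Ae; apply/diagonalizableP.
have [rs rsE] := closed_field_poly_normal ('X^e - 1 : {poly F}).
have lc : lead_coef ('X^e - 1 : {poly F}) = 1.
  by rewrite lead_coefE size_XnsubC// coefB coefXn eqxx coef1 gtn_eqF// subr0.
rewrite lc scale1r in rsE; exists rs.
  rewrite -separable_prod_XsubC -rsE separable_Xn_sub_1// pnatr_eq0.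
  by rewrite -lt0n.
rewrite -rsE mxminpoly_min// rmorphB rmorphXn /= horner_mx_X Ae.
by rewrite rmorph1 subrr.
Qed.

(** The family [B] of powers stands for [A ^+ k] in a form that also makes sense
    for matrices of size 0. *)
Lemma finite_order_eigenvalues d (A : 'M[F]_d) (B : nat -> 'M[F]_d) e :
  (0 < e)%N -> B 0%N = 1%:M -> (forall k, B k.+1 = A *m B k) -> B e = 1%:M ->
  exists lam : 'I_d -> F, [/\ forall i, lam i ^+ e = 1,
    forall n, det_poly A n = \prod_i (1 - lam i *: 'X^n) &
    forall k, \tr (B k) = \sum_i lam i ^+ k].
Proof.
case: d A B => [|d] A B e0 B0 BS Be.
  exists (fun=> 1); split=> [i|n|k]; first by rewrite expr1n.
    by rewrite /det_poly det_mx00 big_ord0.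
  by rewrite /mxtrace !big_ord0.
have BE k : B k = A ^+ k by elim: k => [//|k IH]; rewrite BS IH exprS.
have Ae : A ^+ e = 1 by rewrite -BE Be.
have [P Pu /(similar_diagLR Pu)[D AE]] := finite_order_diagonalizable e0 Ae.
rewrite conjVmx// in AE.
have PV : P *m invmx P = 1%:M by rewrite mulmxV.
have VP : invmx P *m P = 1%:M by rewrite mulVmx.
have diagX k : (diag_mx D : 'M[F]_d.+1) ^+ k = diag_mx (\row_i D 0 i ^+ k).
  elim: k => [|k IH].
    rewrite expr0 -[1]/(1%:M) -diag_const_mx; congr diag_mx.
    by apply/rowP => i; rewrite !mxE expr0.
  rewrite exprS IH -[_ * _]/(_ *m _) mulmx_diag; congr diag_mx.
  by apply/rowP => i; rewrite !mxE exprS.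
have AX k : A ^+ k = invmx P *m (diag_mx D ^+ k) *m P.
  elim: k => [|k IH]; first by rewrite !expr0 mulmx1 VP.
  rewrite exprS IH -[A * _]/(A *m _) AE exprS -[diag_mx D * _]/(diag_mx D *m _).
  by rewrite !mulmxA -[_ *m P *m invmx P]mulmxA PV mulmx1.
exists (fun i => D 0 i); split=> [i|n|k].
- have : diag_mx D ^+ e = 1 :> 'M[F]_d.+1.
    have -> : diag_mx D ^+ e = P *m (A ^+ e) *m invmx P.
      by rewrite AX !mulmxA PV mul1mx -mulmxA PV mulmx1.
    by rewrite Ae mulmx1 PV.
  by rewrite diagX => /matrixP/(_ i i); rewrite !mxE eqxx.
- rewrite /det_poly; set M := map_mx polyC.
  have Mm : M P *m M (invmx P) = 1%:M by rewrite -map_mxM PV map_mx1.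
  have mM : M (invmx P) *m M P = 1%:M by rewrite -map_mxM VP map_mx1.
  have -> : 1%:M - 'X^n *: M A =
      M (invmx P) *m (1%:M - 'X^n *: M (diag_mx D)) *m M P.
    rewrite mulmxBr mulmx1 mulmxBl mM AE /M !map_mxM.
    by rewrite -scalemxAr -scalemxAl.
  rewrite !det_mulmx mulrC mulrA -det_mulmx Mm det1 mul1r.
  have -> : 1%:M - 'X^n *: M (diag_mx D) =
      diag_mx (\row_i (1 - D 0 i *: 'X^n)).
    apply/matrixP => i j; rewrite !mxE; case: eqVneq => [->|_] /=.
      by rewrite !mulr1n mulrC mul_polyC.
    by rewrite !mulr0n mulr0 subr0.
  by rewrite det_diag; apply: eq_bigr => i _; rewrite mxE.
- rewrite BE AX -mulmxA mxtrace_mulC -mulmxA PV mulmx1 diagX mxtrace_diag.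
  by apply: eq_bigr => i _; rewrite mxE.
Qed.

End FiniteOrderMatrix.

Section DeterminantLogarithm.
Variable R : realType.
Local Notation C := (Cplx R).

Definition coefs (p : {poly R[i]}) : nat -> C := fun k => p`_k.

Lemma det_poly_coef0 d (A : 'M[R[i]]_d) n : (0 < n)%N -> coefs (det_poly A n) 0 = 1.
Proof.
move=> n0; rewrite /coefs -horner_coef0 /det_poly -[_.[0]]/(horner_eval 0 _).
rewrite -det_map_mx; have -> : map_mx (horner_eval 0) (1%:M - 'X^n *: map_mx polyC A) = 1%:M.
  apply/matrixP => i j; rewrite !mxE /horner_eval hornerD hornerN hornerM hornerXn.
  by rewrite expr0n gtn_eqF// mul0r subr0 hornerMn hornerC.
by rewrite det1.
Qed.

Lemma det_poly_inflate d (A : 'M[R[i]]_d) n : (0 < n)%N ->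
  coefs (det_poly A n) =1 inflate n (coefs (det_poly A 1)).
Proof.
move=> n0 m; rewrite /coefs /inflate.
have -> : det_poly A n = det_poly A 1 \Po 'X^n.
  rewrite /det_poly -[_ \Po _]/(comp_poly 'X^n _) -det_map_mx; congr (\det _).
  apply/matrixP => i j; rewrite !mxE rmorphB rmorphM /= expr1 comp_polyX comp_polyC.
  by rewrite rmorphMn rmorph1.
by rewrite coef_comp_poly_Xn.
Qed.

Lemma log_deriv_linear (x : C) :
  log_deriv (coefs (1 - x *: 'X^1)) (fun m => - (x ^+ m / m%:R)).
Proof.
move=> n; rewrite big_ord_recr/= subnn.
have ca k : coefs (1 - x *: 'X^1) k = (k == 0%N)%:R - x * (k == 1%N)%:R.
  by rewrite /coefs coefB coefZ coef1 coefXn.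
have S (k : nat) : k.+1%:R * - (x ^+ k.+1 / k.+1%:R) = - x ^+ k.+1.
  by rewrite mulrN mulrC divfK// pnatr_eq0.
under eq_bigr => i _ do rewrite S ca.
rewrite S !ca; case: n => [|n].
  by rewrite big_ord0 /=; ring.
rewrite big_ord_recr/= big1 => [|i _].
  by rewrite subSnn; rewrite /= !exprS; ring.
have h : (n.+1 - i)%N = (n - i.+1).+2 by have := ltn_ord i; lia.
by rewrite h /=; ring.
Qed.

(** The determinant is a product of factors [1 - lam z] with [lam] a root of unity,
    and [log (1 - lam z)] has the coefficients [- lam ^ m / m]. *)
Lemma log_det_poly d (A : 'M[R[i]]_d) (B : nat -> 'M[R[i]]_d) e :
  (0 < e)%N -> B 0%N = 1%:M -> (forall k, B k.+1 = A *m B k) -> B e = 1%:M ->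
  log_deriv (coefs (det_poly A 1)) (fun m => - (\tr (B m) / m%:R) : C) /\
  forall k, cmod (\tr (B k) : C) <= d%:R.
Proof.
move=> e0 B0 BS Be; have [lam [lam1 detE trE]] := finite_order_eigenvalues e0 B0 BS Be.
split; last first.
  move=> k; rewrite trE; apply: le_trans (cmod_sum _ _ _) _.
  apply: (@le_trans _ _ (\sum_(i < d) 1)); last by rewrite sumr_const card_ord.
  apply: ler_sum => i _; rewrite cmodX.
  suff -> : cmod (lam i : C) = 1 by rewrite expr1n.
  have /(congr1 (@cmod R)) := lam1 i; rewrite cmodX cmod1 => /eqP.
  by rewrite pexpr_eq1 ?cmod_ge0// => /eqP.
rewrite detE.
have H (s : seq 'I_d) : log_deriv (coefs (\prod_(i <- s) (1 - lam i *: 'X^1)))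
    (fun m => - ((\sum_(i <- s) lam i ^+ m) / m%:R) : C).
  elim: s => [|i s IH].
    have := @log_deriv1 C; congr log_deriv; apply/funext => m.
      by rewrite big_nil /coefs coef1.
    by rewrite big_nil mul0r oppr0.
  have := log_derivM (log_deriv_linear (lam i)) IH; congr log_deriv; apply/funext => m.
    by rewrite convE big_cons /coefs coefM.
  by rewrite big_cons mulrDl opprD.
have := H (index_enum _); congr log_deriv; apply/funext => m.
by rewrite trE.
Qed.

End DeterminantLogarithm.

(** * Class functions and the exponents *)
Section ClassFunctions.
Variables (F : closedFieldType) (gT : finGroupType) (G : {group gT}).
Hypothesis F'G : ([pchar F]^'.-group G)%g.
Hypothesis char0 : forall n, (n.+1%:R : F) != 0.
Variable sG : irrType F G.

Lemma trace_repr_conj d (rG : mx_representation F G d) g h :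
  g \in G -> h \in G -> \tr (rG (g ^ h)%g) = \tr (rG g).
Proof.
move=> Gg Gh; rewrite conjgE !repr_mxM ?groupM ?groupV//.
by rewrite mxtrace_mulC -mulmxA -repr_mxM ?groupV// mulgV repr_mx1 mulmx1.
Qed.

(** Evaluating a linear relation between the characters at the Wedderburn
    idempotents shows that it is trivial; as there are as many irreducible
    characters as conjugacy classes, they span the class functions. *)
Lemma characters_span (v : gT -> F) :
  (forall g h, g \in G -> h \in G -> v (g ^ h)%g = v g) ->
  exists c : sG -> F, forall g, g \in G ->
    v g = \sum_W c W * \tr (irr_repr W g).
Proof.
move=> vJ; pose rep (k : 'I_#|classes G|) := repr (enum_val k).
have repG k : rep k \in G.
  have /imsetP[x Gx kE] := enum_valP k; rewrite /rep kE.
  apply: (fintype.subsetP (class_subG Gx (subxx G))).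
  by apply: (@mem_repr_classes _ G); exact: mem_classes.
pose T : 'M[F]_(#|sG|, #|classes G|) :=
  \matrix_(i, k) \tr (irr_repr (enum_val i) (rep k)).
have classE g : g \in G -> exists k, exists2 h, h \in G & rep k = (g ^ h)%g.
  move=> Gg; have gc : (g ^: G)%g \in classes G by rewrite mem_classes.
  exists (enum_rank_in gc (g ^: G)%g); rewrite /rep enum_rankK_in//.
  by have /imsetP[h Gh ->] := mem_repr_classes gc; exists h.
(* the character table, with a representative of each class, is square *)
have rfT : row_free T.
  rewrite -kermx_eq0; apply/rowV0P => u /sub_kermxP uT; apply/rowP => i.
  have rel g : g \in G -> \sum_j u 0 j * \tr (irr_repr (enum_val j) g) = 0.
    move=> Gg; have [k [h Gh kE]] := classE g Gg.
    have := congr1 (fun M : 'rV_ _ => M 0 k) uT; rewrite mxE [X in _ = X]mxE => uTk.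
    rewrite -[RHS]uTk; apply: eq_bigr => j _.
    by rewrite mxE kE trace_repr_conj.
  have relA A : (A \in enveloping_algebra_mx (regular_repr F G))%MS ->
      \sum_j u 0 j * \tr (gring_op (irr_repr (enum_val j)) A) = 0.
    move=> /envelop_mxP[a ->].
    under eq_bigr do rewrite !linear_sum big_distrr /=.
    rewrite exchange_big big1 //= => x Gx.
    under eq_bigr do rewrite !linearZ /= gring_opG// mulrCA.
    by rewrite -big_distrr rel//= mulr0.
  have eR (W : sG) : (Wedderburn_id W \in enveloping_algebra_mx (regular_repr F G))%MS.
    rewrite -(Wedderburn_sum_pchar sG F'G).
    apply: submx_trans (Wedderburn_id_mem _) _; exact: (sumsmx_sup W).
  have := relA (Wedderburn_id (enum_val i)); rewrite (bigD1 i)//=.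
  rewrite op_Wedderburn_id_pchar// mxtrace1 big1 ?addr0 => [|j ji].
    move=> /(_ (eR _))/eqP; rewrite mulf_eq0 mxE.
    case: (irr_degree _) (irr_degree_gt0 (enum_val i)) => // n _.
    by rewrite (negPf (char0 n)) orbF => /eqP.
  rewrite (irr_repr'_op0_pchar F'G (j := enum_val i))//.
  - by rewrite mxtrace0 mulr0.
  - by rewrite (inj_eq enum_val_inj) eq_sym.
  - exact: Wedderburn_id_mem.
have fullT : row_full T.
  have := rfT; rewrite /row_free /row_full => /eqP ->.
  by rewrite card_irr_pchar//; exact: group_closure_closed_field.
have /submxP[u uE] : (\row_k v (rep k) <= T)%MS by exact: submx_full.
exists (fun W => u 0 (enum_rank W)) => g Gg; have [k [h Gh kE]] := classE g Gg.
rewrite -(vJ g h)// -kE; have := congr1 (fun M : 'rV_ _ => M 0 k) uE; rewrite !mxE => ->.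
rewrite (reindex (@enum_rank sG)); last by exists enum_val => ? _; rewrite ?enum_rankK ?enum_valK.
by apply: eq_bigr => W _; rewrite mxE enum_rankK kE trace_repr_conj.
Qed.

End ClassFunctions.

Section Exponents.
Variables (R : realType) (gT : finGroupType) (G : {group gT}).
Local Notation C := (Cplx R).
Variable sG : irrType R[i] G.

Lemma pchar_complex : [pchar R[i]] =i pred0.
Proof. exact: pchar_num. Qed.

Lemma log_det_repr d (rG : mx_representation R[i] G d) g : g \in G ->
  log_deriv (coefs (det_poly (rG g) 1)) (fun m => - (\tr (rG (g ^+ m)%g) / m%:R) : C)
  /\ forall k, cmod (\tr (rG (g ^+ k)%g) : C) <= d%:R.
Proof.
move=> Gg; apply: (@log_det_poly R d (rG g) (fun k => rG (g ^+ k)%g) #[g]%g).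
- exact: order_gt0.
- by rewrite repr_mx1.
- by move=> k; rewrite expgS repr_mxM ?groupX.
- by rewrite expg_order repr_mx1.
Qed.

Lemma fps_log_det_repr d (rG : mx_representation R[i] G d) g n m : g \in G -> (0 < n)%N ->
  fps_log (coefs (det_poly (rG g) n)) m.+1 =
  inflate n (fun k => - (\tr (rG (g ^+ k)%g) / k%:R) : C) m.+1.
Proof.
move=> Gg n0; apply: fps_logE; first exact: det_poly_coef0.
have -> : coefs (det_poly (rG g) n) = inflate n (coefs (det_poly (rG g) 1)).
  by apply/funext; exact: det_poly_inflate.
by apply: log_deriv_inflate => //; exact: (log_det_repr rG Gg).1.
Qed.

Lemma fps_log_det_repr_big d (rG : mx_representation R[i] G d) g n m : g \in G ->
  (m.+1 < n)%N -> fps_log (coefs (det_poly (rG g) n)) m.+1 = 0.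
Proof.
move=> Gg mn; rewrite fps_log_det_repr// ?(leq_ltn_trans _ mn)// /inflate.
by case: ifP => // /dvdn_leq-/(_ isT); rewrite leqNgt mn.
Qed.

Lemma fps_log_det_repr_conj d (rG : mx_representation R[i] G d) g h n m :
  g \in G -> h \in G -> (0 < n)%N ->
  fps_log (coefs (det_poly (rG (g ^ h)%g) n)) m.+1 =
  fps_log (coefs (det_poly (rG g) n)) m.+1.
Proof.
move=> Gg Gh n0.
have GJ : (g ^ h)%g \in G by exact: groupJ.
apply: etrans (fps_log_det_repr rG m GJ n0) (etrans _ (esym (fps_log_det_repr rG m Gg n0))).
rewrite /inflate; case: ifP => // _.
by rewrite -conjXg (trace_repr_conj rG (groupX _ Gg) Gh).
Qed.

Lemma fps_log_det_repr_top d (rG : mx_representation R[i] G d) g m : g \in G ->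
  fps_log (coefs (det_poly (rG g) m.+1)) m.+1 = - \tr (rG g).
Proof.
move=> Gg; rewrite fps_log_det_repr// /inflate dvdnn divnn /= expg1.
by rewrite divr1.
Qed.

(** The coefficient of degree [m] of the identity only involves the exponents of
    index at most [m], and those of index [m] through the characters
    themselves, so that it can be solved for them. *)
Lemma exponents_exist (v : nat -> gT -> C) :
  (forall m g h, g \in G -> h \in G -> v m (g ^ h)%g = v m g) ->
  exists b : nat -> sG -> C, forall m g, g \in G ->
    v m.+1 g = - \sum_(1 <= n < m.+2) \sum_W
      b n W * fps_log (coefs (det_poly (irr_repr W g) n)) m.+1.
Proof.
move=> vJ.
pose lower m (b : nat -> sG -> C) g : C := v m.+1 g + \sum_(1 <= n < m.+1) \sum_W
  b n W * fps_log (coefs (det_poly (irr_repr W g) n)) m.+1.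
have lowerJ m b g h : g \in G -> h \in G -> lower m b (g ^ h)%g = lower m b g.
  move=> Gg Gh; rewrite /lower (vJ _ _ _ Gg Gh).
  apply: (congr1 (fun z => v m.+1 g + z)).
  apply: eq_big_nat => n /andP[n0 _].
  apply: eq_bigr => W _; apply: (congr1 (fun z => b n W * z)).
  exact: fps_log_det_repr_conj.
have F'G : ([pchar R[i]]^'.-group G)%g.
  by apply/pgroupP => p _ _; rewrite inE /= pchar_complex.
have c0 n : (n.+1%:R : R[i]) != 0 by rewrite pnatr_eq0.
have /boolp.choice[solve solveP] : forall x : nat * (nat -> sG -> C),
    exists s : sG -> C, forall g, g \in G ->
    lower x.1 x.2 g = \sum_W s W * \tr (irr_repr W g).
  move=> [m b].
  by apply: (@characters_span R[i] gT G F'G c0 sG) => g h; exact: lowerJ.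
pose fix bs m : nat -> sG -> C := if m is m'.+1 then
  fun n => if n == m then solve (m', bs m') else bs m' n else fun _ _ => 0.
have bsE k n : (n <= k)%N -> bs k n = bs n n.
  elim: k n => [|k IH] n; first by rewrite leqn0 => /eqP ->.
  by rewrite leq_eqVlt => /orP[/eqP ->//|nk]; rewrite /= ltn_eqF// IH.
exists (fun n => bs n n) => m g Gg; rewrite big_nat_recr//=.
have bsS : bs m.+1 m.+1 = solve (m, bs m) by rewrite /= eqxx.
have top : \sum_W bs m.+1 m.+1 W * fps_log (coefs (det_poly (irr_repr W g) m.+1)) m.+1 =
    - lower m (bs m) g.
  transitivity (- (\sum_W solve (m, bs m) W * \tr (irr_repr W g)) : C).
    rewrite -sumrN bsS; apply: eq_bigr => W _.
    rewrite (fps_log_det_repr_top (irr_repr W) m Gg).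
    exact: mulrN.
  by rewrite -(solveP (m, bs m) g Gg).
have low : \sum_(1 <= n < m.+1) \sum_W
    bs n n W * fps_log (coefs (det_poly (irr_repr W g) n)) m.+1 =
    lower m (bs m) g - v m.+1 g.
  rewrite /lower addrAC subrr add0r; apply: eq_big_nat => n /andP[_ nm].
  by rewrite bsE.
apply: etrans (esym (congr1 -%R (congr2 +%R low top))).
by rewrite addrAC subrr add0r opprK.
Qed.

End Exponents.

(** * Inertia groups and Artin polynomials *)
Section AlgebraicIntegers.
Variable L : splittingFieldType rat.
Local Notation iota := (intr : int -> L).

Lemma alg_intD (x y : L) : alg_int x -> alg_int y -> alg_int (x + y).
Proof. exact: integral_add. Qed.
Lemma alg_intB (x y : L) : alg_int x -> alg_int y -> alg_int (x - y).
Proof. exact: integral_sub. Qed.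
Lemma alg_intM (x y : L) : alg_int x -> alg_int y -> alg_int (x * y).
Proof. exact: integral_mul. Qed.
Lemma alg_int_int (n : int) : alg_int (n%:~R : L).
Proof. exact: integral_id. Qed.

Lemma int_horner_alg_int (q : {poly int}) (x : L) : alg_int x ->
  alg_int (map_poly iota q).[x].
Proof.
move=> hx; rewrite horner_poly; elim/big_ind: _ => [|u w|i _].
- exact: (alg_int_int 0).
- exact: alg_intD.
apply: alg_intM; first exact: alg_int_int.
elim: (nat_of_ord i) => [|k IH]; first exact: (alg_int_int 1).
by rewrite exprS; exact: alg_intM.
Qed.

Lemma gal_alg_int (g : gal_of {:L}) (x : L) : alg_int x -> alg_int (g x).
Proof.
move=> [p pm px]; exists p => //; move: px; rewrite !rootE => /eqP px.
have -> : map_poly iota p = map_poly g (map_poly iota p).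
  rewrite -map_poly_comp; apply: eq_map_poly => n /=.
  by rewrite rmorph_int.
by rewrite horner_map /= px rmorph0.
Qed.

Lemma intr_eq0_ext (n : int) : (n%:~R == 0 :> L) = (n == 0).
Proof. by rewrite -(rmorph_int (in_alg L)) fmorph_eq0 intr_eq0. Qed.

Lemma intrX_ext (n : int) k : (n ^+ k)%:~R = n%:~R ^+ k :> L.
Proof. by elim: k => [//|k IH]; rewrite !exprS intrM IH. Qed.

(** With [q] an integral polynomial of degree [d] that has [x] as a root and [l]
    its leading coefficient, [l x] is a root of the monic polynomial [l ^ (d - 1) q ('X / l)]. *)
Lemma int_multiple_alg_int (x : L) : exists n : int, n != 0 /\ alg_int (n%:~R * x).
Proof.
have [p pE] : exists p : {poly rat}, minPoly 1 x = map_poly (in_alg L) p.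
  by apply/polyOver1P; exact: minPolyOver.
have [q [a a0 pq]] := rat_poly_scale p.
have ia (m : int) : (in_alg L) (m%:~R) = m%:~R by rewrite rmorph_int.
have p0 : p != 0.
  by rewrite -(map_poly_eq0 (in_alg L)) -pE monic_neq0// monic_minPoly.
have qx : (map_poly iota q).[x] = 0.
  have qp : map_poly intr q = a%:~R *: p by rewrite pq scalerA mulfV ?intr_eq0// scale1r.
  have -> : map_poly iota q = map_poly (in_alg L) (map_poly intr q).
    by rewrite -map_poly_comp; apply: eq_map_poly => n; exact: esym (ia n).
  rewrite qp map_polyZ.
  by rewrite hornerZ -pE (eqP (root_minPoly _ _)) mulr0.
have q0 : q != 0 by apply: contraNneq p0 => q0; rewrite pq q0 map_poly0 scaler0.
set l := lead_coef q; have l0 : l != 0 by rewrite lead_coef_eq0.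
exists l; split=> //; case sq : (size q) => [|n].
  by move/eqP: sq; rewrite size_poly_eq0 (negPf q0).
case: n sq => [|n] sq.
  have qE : q = (q`_0)%:P by apply: size1_polyC; rewrite sq.
  have lE : l = q`_0 by rewrite /l {1}qE lead_coefC.
  move: qx; rewrite {1}qE map_polyC hornerC /= -lE => /eqP.
  by rewrite intr_eq0_ext (negPf l0).
have lE : l = q`_n.+1 by rewrite /l lead_coefE sq.
pose r : {poly int} := \poly_(i < n.+1) (q`_i * l ^+ (n - i)).
have sr : (size r < size ('X^(n.+1) : {poly int})%R)%N by rewrite size_polyXn ltnS size_poly.
exists ('X^(n.+1) + r); first by rewrite monicE lead_coefDl// lead_coefXn.
rewrite rootE rmorphD /= map_polyXn hornerD hornerXn.
have -> : (map_poly iota r).[l%:~R * x] = \sum_(i < n.+1) (q`_i)%:~R * l%:~R ^+ n * x ^+ i.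
  rewrite (@horner_coef_wide _ n.+1); last first.
    by rewrite (leq_trans (size_poly _ _))// size_poly.
  apply: eq_bigr => i _; rewrite coef_map coef_poly ltn_ord /= intrM intrX_ext exprMn.
  have -> : (l%:~R : L) ^+ n = l%:~R ^+ (n - i) * l%:~R ^+ i.
    by rewrite -exprD subnK// -ltnS.
  by ring.
have : l%:~R ^+ n * (map_poly iota q).[x] = 0 by rewrite qx mulr0.
rewrite (@horner_coef_wide _ n.+2); last by rewrite (leq_trans (size_poly _ _))// sq.
rewrite big_ord_recr/= coef_map /= -lE mulrDr addrC => h; apply/eqP; rewrite -[RHS]h.
congr (_ + _); first by rewrite exprMn exprS; ring.
rewrite big_distrr/=; apply: eq_bigr => i _; rewrite coef_map /=; ring.
Qed.

(** The number [y] divides the constant term of any integral polynomial that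
    vanishes at [y], and this term can be made non-zero by dividing by ['X]. *)
Lemma alg_int_divides_int (y : L) : alg_int y -> y != 0 ->
  exists2 a : int, a != 0 & exists2 z, alg_int z & a%:~R = y * z.
Proof.
move=> yi y0; have [p pm py] := yi.
have [n] := ubnP (size p); elim: n p pm py => // n IH p pm py sp.
have [c [q pE]] : exists c q, p = q * 'X + c%:P.
  by exists p`_0, (drop_poly 1 p); apply/polyP => -[|i];
    rewrite coefD coefMX coefC /= ?add0r// coef_drop_poly addn1 addr0.
have qy : (map_poly iota p).[y] = (map_poly iota q).[y] * y + c%:~R.
  by rewrite pE rmorphD rmorphM /= map_polyX map_polyC hornerD hornerM hornerX hornerC.
move: py; rewrite rootE qy => /eqP py.
have [c0|c0] := eqVneq c 0.
  apply: (IH q).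
  - by move: pm; rewrite pE c0 addr0 !monicE lead_coefMX.
  - by move: py; rewrite c0 addr0 rootE => /eqP; rewrite mulf_eq0 (negPf y0) orbF.
  - have q0 : q != 0.
      by apply: contraTneq pm => q0; rewrite pE c0 q0 mul0r addr0 monicE lead_coef0 eq_sym oner_eq0.
    by move: sp; rewrite pE c0 addr0 size_mulX.
exists c => //; exists (- (map_poly iota q).[y]).
  by rewrite -[- _]sub0r; apply: alg_intB; [exact: (alg_int_int 0)|exact: int_horner_alg_int].
by rewrite mulrN mulrC; apply/eqP; rewrite -addr_eq0 addrC py.
Qed.

(** Every element of [L] has a non-zero integral multiple that is an algebraic
    integer. *)
Lemma gal_moves_alg_int (h : gal_of {:L}) : h != 1%g ->
  exists2 x, alg_int x & h x != x.
Proof.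
move=> h1; have [x hx] : exists x, h x != x.
  apply: contrapT => nx; case/negP: h1; apply/gal_eqP => x _; rewrite gal_id.
  by apply/eqP; rewrite -[_ == _]negbK; apply/negP => hx; apply: nx; exists x.
have [n [n0 nx]] := int_multiple_alg_int x.
exists (n%:~R * x) => //; rewrite rmorphM /= rmorph_int.
by apply: contraNneq hx => /mulfI -> //; rewrite intr_eq0_ext.
Qed.

(** Otherwise [p] and [a] would be coprime, and the ideal would contain 1. *)
Lemma prime_above_dvd p (P : set L) (a : int) : prime p -> Defs.prime_above p P ->
  P a%:~R -> (p %| `|a|)%N.
Proof.
move=> pp [[PO P0 PD PM] P1 _ Pp] Pa; apply: contraT => npa.
have : coprimez p a by rewrite coprimezE prime_coprime.
case/coprimezP => -[u v] /= uv; exfalso; apply: P1.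
have -> : (1 : L) = u%:~R * p%:R + v%:~R * a%:~R.
  by rewrite -[p%:R]/((p%:Z)%:~R) -!intrM -intrD uv.
by apply: PD; apply: PM => //; exact: alg_int_int.
Qed.

(** A non-trivial [h] moves an algebraic integer [x], and a prime ideal whose
    inertia group contains [h] also contains [h x - x], which divides a fixed
    non-zero integer. *)
Lemma inertia_trivial : exists B : nat, forall p (P : set L), prime p -> (B < p)%N ->
  Defs.prime_above p P -> Defs.inertia P = 1%g.
Proof.
have /boolp.choice[a aP] : forall h : gal_of {:L}, exists a : int, h != 1%g ->
    a != 0 /\ forall p (P : set L), Defs.prime_above p P -> h \in Defs.inertia P -> P a%:~R.
  move=> h; have [->|h1] := eqVneq h 1%g; first by exists 0.
  have [x xi hx] := gal_moves_alg_int h1.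
  have hxi : alg_int (h x - x) by apply: alg_intB => //; exact: gal_alg_int.
  have [|a a0 [z zi aE]] := alg_int_divides_int hxi; first by rewrite subr_eq0.
  exists a => _; split=> // p P [[_ _ _ PM] _ _ _].
  rewrite inE => /andP[_ /asboolP hP]; rewrite aE mulrC; apply: PM => //; exact: hP.
exists (\max_h `|a h|)%N => p P pp Bp pP; apply/finset.setP => h; rewrite set1gE !inE.
have [h1|h1] := eqVneq h 1%g.
  rewrite h1 group1 /=; apply/asboolP => x _; rewrite gal_id subrr.
  by case: pP => -[].
apply/negP => hI; have [a0 aPP] := aP h h1.
have hI' : h \in Defs.inertia P by rewrite inE.
have := dvdn_leq _ (prime_above_dvd pp pP (aPP _ _ pP hI')).
rewrite absz_gt0 a0 => /(_ isT) pa.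
have := leq_trans Bp pa; rewrite ltnNge => /negP; apply.
exact: (@leq_bigmax _ (fun h => `|a h|%N) h).
Qed.

Lemma frobenius_stabilizes p (P : set L) g x : prime p -> frobenius_at p P g ->
  P x -> P (g x).
Proof.
move=> pp [[[PO P0 PD PM] _ _ _] _ gP] Px; have xi : alg_int x by exact: PO.
rewrite -(subrK (x ^+ p) (g x)); apply: PD; first exact: gP.
case: p pp gP => // p _ _; rewrite exprSr; apply: PM => //.
elim: p => [|p IH]; first exact: (alg_int_int 1).
by rewrite exprS; exact: alg_intM.
Qed.

(** The Frobenius element stabilizes [P], so that conjugation by it preserves
    the condition on [h x - x]. *)
Lemma frobenius_normalizes_inertia p (P : set L) g : prime p -> frobenius_at p P g ->
  g \in 'N(Defs.inertia P)%g.
Proof.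
move=> pp gP; rewrite inE; apply/fintype.subsetP => _ /imsetP[h hI ->].
have [_ Gg _] := gP; move: hI; rewrite !inE => /andP[Gh /asboolP hP].
rewrite groupJ//=; apply/asboolP => x xi; rewrite conjgE !galM ?memvf//.
set y := (g^-1)%g x; have yi : alg_int y by exact: gal_alg_int.
have -> : x = g y by rewrite /y -galM ?memvf// mulVg gal_id.
by rewrite -rmorphB; apply: frobenius_stabilizes pp gP _; exact: hP.
Qed.

End AlgebraicIntegers.

Section ArtinPolynomial.
Variables (R : realType) (L : splittingFieldType rat).
Local Notation C := (Cplx R).
Local Notation G := (galQ L).
Variables (d : nat) (rho : mx_representation R[i] G d).

Lemma rfix_stable (H : {set gal_of {:L}}) g : H \subset G -> g \in G ->
  g \in 'N(H)%g -> stablemx (rfix_mx rho H) (rho g).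
Proof.
move=> HG Gg gN; apply/rfix_mxP => h Hh.
have Gh : h \in G by exact: (fintype.subsetP HG).
have hg : (h ^ g^-1)%g \in H by rewrite memJ_norm// groupV.
rewrite -mulmxA -repr_mxM//; have -> : (g * h = (h ^ g^-1) * g)%g.
  by rewrite conjgE invgK !mulgA mulgKV.
rewrite repr_mxM ?groupJ ?groupV// mulmxA; congr (_ *m _).
exact: rfix_mx_id.
Qed.

Variables (p : nat) (P : set L) (g : gal_of {:L}).
Hypotheses (pp : prime p) (gP : frobenius_at p P g).

Lemma inertia_sub : Defs.inertia P \subset G.
Proof. by apply/fintype.subsetP => h; rewrite inE => /andP[]. Qed.

Let V := rfix_mx rho (Defs.inertia P).
Let B k := restrictmx V (rho (g ^+ k)%g).

Lemma artin_power_stable k : stablemx (row_base V) (rho (g ^+ k)%g).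
Proof.
have [_ Gg _] := gP; rewrite stablemx_row_base.
apply: rfix_stable; [exact: inertia_sub|exact: groupX|].
by apply: groupX; exact: frobenius_normalizes_inertia gP.
Qed.

Lemma log_artin_poly :
  log_deriv (coefs (artin_poly rho P g)) (fun m => - (\tr (B m) / m%:R) : C) /\
  forall k, cmod (\tr (B k) : C) <= (\rank V)%:R.
Proof.
have [_ Gg _] := gP.
have B0 : B 0%N = 1%:M by rewrite /B expg0 repr_mx1 conjmx_scalar ?row_base_free.
have BS k : B k.+1 = restrictmx V (rho g) *m B k.
  rewrite /B expgS repr_mxM ?groupX// conjmxM//; last exact: artin_power_stable.
  by have := artin_power_stable 1; rewrite expg1.
have Be : B #[g]%g = 1%:M by rewrite /B expg_order repr_mx1 conjmx_scalar ?row_base_free.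
exact: (@log_det_poly R _ _ B #[g]%g (order_gt0 g) B0 BS Be).
Qed.

Lemma artin_poly_coef0 : coefs (artin_poly rho P g) 0 = 1.
Proof. exact: det_poly_coef0. Qed.

(** When inertia is trivial the invariants are the whole space. *)
Lemma artin_trace_unramified k : Defs.inertia P = 1%g -> \tr (B k) = \tr (rho (g ^+ k)%g).
Proof.
move=> I1; have Vfull : row_full V.
  rewrite -sub1mx; apply/rfix_mxP => h; rewrite I1 => /set1gP ->.
  by rewrite repr_mx1 mulmx1.
have rbfull : row_full (row_base V).
  by rewrite /row_full eq_row_base; exact: Vfull.
by rewrite /B /conjmx -mulmxA mxtrace_mulC -mulmxA mulVpmx// mulmx1.
Qed.

(** The Euler factor converges on the unit disc because a Frobenius element
    acts on the invariants of inertia through a matrix of finite order. *)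
Lemma artin_pow_growth (b : C) : exists2 l : nat -> C,
  log_deriv (fps_pow (coefs (artin_poly rho P g)) b) l &
  exists M : R, forall m, cmod (m.+1%:R * l m.+1) <= M.
Proof.
exists (fun m => b * fps_log (coefs (artin_poly rho P g)) m).
  exact: fps_pow_deriv.
have [al tr_le] := log_artin_poly.
exists (cmod b * (\rank V)%:R) => m.
rewrite (fps_logE artin_poly_coef0 al) mulrCA cmodM ler_wpM2l ?cmod_ge0//.
by rewrite mulrN cmodN mulrC divfK ?pnatr_eq0.
Qed.

End ArtinPolynomial.

(** * Euler products and Dirichlet series *)
Section PSeries.
Variable R : realType.

(** Telescoping: [tau (n + 1) ^ - (1 + tau)] is at most
    [n ^ - tau - (n + 1) ^ - tau], because [ln (n + 1) - ln n] is at least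
    [1 / (n + 1)]. *)
Lemma p_series_bound (tau : R) N : 0 < tau ->
  \sum_(m < N) expR (- (1 + tau) * ln m.+1%:R) <= 1 + tau^-1.
Proof.
move=> tau0; pose q (n : nat) : R := expR (- tau * ln n.+1%:R).
have step n : tau * expR (- (1 + tau) * ln n.+2%:R) <= q n - q n.+1.
  have n1 : 0 < n.+1%:R :> R by rewrite ltr0n.
  have n2 : 0 < n.+2%:R :> R by rewrite ltr0n.
  have u : n.+2%:R^-1 <= ln n.+2%:R - ln n.+1%:R :> R.
    rewrite -ler_expR expRB !lnK ?posrE// -[leLHS]invrK -[leRHS]invrK.
    rewrite lef_pV2 ?posrE ?invr_gt0 ?divr_gt0 ?expR_gt0// -expRN invf_div.
    apply: le_trans (expR_ge1Dx _); rewrite -[n.+2%:R]natr1.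
    have n2' : (n.+1%:R + 1 : R) != 0 by rewrite natr1 gt_eqF.
    by rewrite [leLHS](_ : _ = 1 + - (n.+1%:R + 1)^-1)//; field.
  have -> : expR (- (1 + tau) * ln n.+2%:R) = q n.+1 * n.+2%:R^-1.
    rewrite /q -[in RHS](@lnK _ n.+2%:R) ?posrE// -expRN -expRD; congr expR.
    by rewrite lnK ?posrE//; ring.
  have -> : q n = q n.+1 * expR (tau * (ln n.+2%:R - ln n.+1%:R)).
    by rewrite /q -expRD; congr expR; ring.
  rewrite -{3}[q n.+1]mulr1 -mulrBr mulrCA ler_wpM2l ?expR_ge0//.
  by rewrite lerBrDl (le_trans _ (expR_ge1Dx _))// lerD2l ler_wpM2l// ltW.
have tel n : tau * \sum_(m < n) expR (- (1 + tau) * ln m.+2%:R) <= q 0%N - q n.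
  elim: n => [|n IH]; first by rewrite big_ord0 mulr0 subrr.
  by rewrite big_ord_recr/= mulrDr; have := step n; lra.
case: N => [|N]; first by rewrite big_ord0 addr_ge0// invr_ge0 ltW.
rewrite big_ord_recl ln1 mulr0 expR0 lerD2l.
rewrite -(ler_pM2l tau0) mulfV ?gt_eqF//; apply: le_trans (tel N) _.
by rewrite /q ln1 mulr0 expR0 gerBl expR_ge0.
Qed.

End PSeries.

Section DirichletProduct.

Definition mul_index i j := (i.+1 * j.+1).-1.

Lemma mul_indexP : increasing_index mul_index.
Proof. by move=> i j; rewrite /mul_index; split; nia. Qed.

(** The index of [p ^ i] when Dirichlet series are indexed from 0. The second index
    only serves to make this a product with [unit_seq]. *)
Definition prime_power_index p i j := ((p ^ i).-1 + j)%N.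

Lemma prime_power_indexP p : (1 < p)%N -> increasing_index (prime_power_index p).
Proof.
move=> p1 i j; rewrite /prime_power_index leq_addl; split=> //.
by have := ltn_expl i p1; lia.
Qed.

(** The Dirichlet series, with index shifted by one, of the power series [u]
    evaluated at [p ^ - s]. *)
Definition prime_power_series (T : pzSemiRingType) p (u : nat -> T) :=
  conv (prime_power_index p) u (unit_seq T).

(** The Dirichlet series of the product over the primes below [N]. *)
Fixpoint euler_coef (T : pzSemiRingType) (f : nat -> nat -> T) N : nat -> T :=
  if N is N'.+1 then
    if prime N' then conv mul_index (euler_coef f N') (prime_power_series N' (f N'))
    else euler_coef f N'
  else unit_seq T.

Variable T : pzSemiRingType.
Implicit Types (f : nat -> nat -> T) (u : nat -> T).

Lemma prime_power_series0 p u : prime_power_series p u 0 = u 0%N.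
Proof.
by rewrite /prime_power_series /conv big_ord1 (big_pred1 ord0) ?mulr1// => j; rewrite ord1.
Qed.

Lemma prime_power_series_small p u m : (0 < m)%N -> (m.+1 < p)%N ->
  prime_power_series p u m = 0.
Proof.
move=> m0 mp; rewrite /prime_power_series /conv big1// => i _; rewrite big1// => j.
rewrite /prime_power_index /unit_seq => /eqP E.
have [j0|j0] := eqVneq (nat_of_ord j) 0%N; last by rewrite mulr0.
move: E; rewrite j0 addn0; case: (nat_of_ord i) => [|k].
  by rewrite expn0 /= => m0'; move: m0; rewrite -m0'.
have : (p <= p ^ k.+1)%N by rewrite expnS leq_pmulr// expn_gt0; lia.
by move=> h1 h2; exfalso; lia.
Qed.

Lemma conv_mul_index1 a b m : b 0%N = 1 :> T ->
  (forall k, (0 < k)%N -> (k <= m)%N -> b k = 0) -> conv mul_index a b m = a m.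
Proof.
move=> b0 bk; rewrite /conv (bigD1 ord_max)//= [X in _ + X]big1 ?addr0 => [|i im].
  rewrite (bigD1 ord0) /=; last by rewrite /mul_index muln1.
  rewrite b0 mulr1 big1 ?addr0// => j /andP[_ j0].
  by rewrite bk ?mulr0 ?lt0n// -ltnS.
rewrite big1// => j /eqP E; have [j0|j0] := eqVneq (nat_of_ord j) 0%N.
  move: E; rewrite /mul_index j0 muln1 /= => E; case/eqP: im; exact: val_inj.
by rewrite bk ?mulr0 ?lt0n// -ltnS.
Qed.

End DirichletProduct.

Section DirichletWeights.
Variable T : comPzSemiRingType.
Variable W : nat -> T.
Hypothesis W0 : W 0%N = 1.
Hypothesis WM : forall i j, W (mul_index i j) = W i * W j.

(** A completely multiplicative weight, here [n ^ - s] or its modulus, goes through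
    Dirichlet products. *)
Lemma weighted_mul_conv (a b : nat -> T) m :
  conv mul_index (fun i => a i * W i) (fun j => b j * W j) m =
  conv mul_index a b m * W m.
Proof.
rewrite /conv big_distrl/=; apply: eq_bigr => i _; rewrite big_distrl/=.
apply: eq_bigr => j /eqP E; have -> : W m = W i * W j by rewrite -WM E.
by rewrite mulrACA.
Qed.

Lemma weight_prime_power p i : (0 < p)%N -> W (p ^ i).-1 = W p.-1 ^+ i.
Proof.
move=> p0; elim: i => [|i IH]; first by rewrite W0.
rewrite exprS -IH -WM /mul_index prednK// prednK ?expn_gt0 ?p0//.
by rewrite expnS.
Qed.

Lemma weighted_prime_power (u : nat -> T) p m : (0 < p)%N ->
  conv (prime_power_index p) (fun i => u i * W p.-1 ^+ i) (unit_seq T) m =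
  prime_power_series p u m * W m.
Proof.
move=> p0; rewrite /prime_power_series /conv big_distrl/=; apply: eq_bigr => i _.
rewrite big_distrl/=; apply: eq_bigr => j /eqP; rewrite /prime_power_index /unit_seq => E.
have [j0|j0] := eqVneq (nat_of_ord j) 0%N; last by rewrite !mulr0 mul0r.
move: E; rewrite j0 addn0 => E; have -> : W m = W (p ^ i).-1 by rewrite E.
by rewrite !mulr1 weight_prime_power.
Qed.

End DirichletWeights.

(** The coefficient of [(m + 1) ^ - s] only receives contributions from the
    primes up to [m + 1]. *)
Lemma euler_coef_stable (T : pzSemiRingType) (f : nat -> nat -> T) m N :
  (forall p, prime p -> f p 0%N = 1) -> (m.+2 <= N)%N ->
  euler_coef f N m = euler_coef f m.+2 m.
Proof.
move=> f0; elim: N => // N IH; rewrite leq_eqVlt => /orP[/eqP <-//|mN].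
rewrite -IH// /=; case: ifPn => // pN; apply: conv_mul_index1.
  by rewrite prime_power_series0 f0.
by move=> k k0 km; apply: prime_power_series_small => //; lia.
Qed.

Lemma big_prime_recr (A : Type) (idx : A) (op : Monoid.law idx) (F : nat -> A) N :
  \big[op/idx]_(0 <= p < N.+1 | prime p) F p =
  op (\big[op/idx]_(0 <= p < N | prime p) F p) (if prime N then F N else idx).
Proof. by rewrite big_mkcond big_nat_recr//= -big_mkcond. Qed.

Section EulerProduct.
Variable R : realType.
Local Notation C := (Cplx R).

Lemma conv_le k (u u' v v' : nat -> R) m : (forall i, 0 <= u i <= u' i) ->
  (forall i, 0 <= v i <= v' i) -> 0 <= conv k u v m <= conv k u' v' m.
Proof.
move=> uu vv; apply/andP; split.
  apply: sumr_ge0 => i _; apply: sumr_ge0 => j _.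
  by case/andP: (uu i) => ? _; case/andP: (vv j) => ? _; rewrite mulr_ge0.
apply: ler_sum => i _; apply: ler_sum => j _.
by case/andP: (uu i) => ? ?; case/andP: (vv j) => ? ?; rewrite ler_pM.
Qed.

Lemma cmod_prime_power_series p (u : nat -> C) m :
  cmod (prime_power_series p u m) <= prime_power_series p (fun i => cmod (u i)) m.
Proof.
rewrite (le_trans (cmod_conv _ _ _ _))// /prime_power_series.
have -> : (fun i => cmod (unit_seq C i)) = unit_seq R by apply/funext; exact: cmod_unit_seq.
exact: lexx.
Qed.

Lemma unit_seq_ge0 m : 0 <= unit_seq R m.
Proof. exact: ler0n. Qed.

Lemma prime_power_series_ge0 p (u : nat -> R) m : (forall i, 0 <= u i) ->
  0 <= prime_power_series p u m.
Proof.
move=> u0; have [] := andP (@conv_le (prime_power_index p) u u (unit_seq R) (unit_seq R) m _ _) => //.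
  by move=> i; rewrite u0 lexx.
by move=> i; rewrite unit_seq_ge0 lexx.
Qed.

Lemma euler_coef_ge0 (g : nat -> nat -> R) N m : (forall p i, 0 <= g p i) ->
  0 <= euler_coef g N m.
Proof.
move=> g0; elim: N m => [|N IH] m /=; first exact: unit_seq_ge0.
case: ifP => // _; have [] := andP (@conv_le mul_index (euler_coef g N) (euler_coef g N)
   (prime_power_series N (g N)) (prime_power_series N (g N)) m _ _) => //.
  by move=> i; rewrite IH lexx.
by move=> i; rewrite prime_power_series_ge0 ?lexx.
Qed.

Lemma cmod_euler_coef (f : nat -> nat -> C) N m :
  cmod (euler_coef f N m) <= euler_coef (fun p i => cmod (f p i)) N m.
Proof.
elim: N m => [|N IH] m /=; first by rewrite cmod_unit_seq.
case: ifP => // _; apply: le_trans (cmod_conv _ _ _ _) _.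
have [] := andP (@conv_le mul_index (fun i => cmod (euler_coef f N i)) (euler_coef (fun p i => cmod (f p i)) N)
   (fun i => cmod (prime_power_series N (f N) i))
   (prime_power_series N (fun i => cmod (f N i))) m _ _) => //.
  by move=> i; rewrite cmod_ge0 IH.
by move=> i; rewrite cmod_ge0 cmod_prime_power_series.
Qed.

Lemma euler_coef_mono (g : nat -> nat -> R) N m : (forall p i, 0 <= g p i) ->
  (forall p, prime p -> g p 0%N = 1) -> euler_coef g N m <= euler_coef g N.+1 m.
Proof.
move=> g0 g1 /=; case: ifP => // pN; rewrite /conv (bigD1 ord_max)//= (bigD1 ord0) /=; last first.
  by rewrite /mul_index muln1.
rewrite prime_power_series0 g1// mulr1 -addrA lerDl addr_ge0//.
  apply: sumr_ge0 => j _; rewrite mulr_ge0 ?euler_coef_ge0//.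
  by rewrite prime_power_series_ge0.
apply: sumr_ge0 => i _; apply: sumr_ge0 => j _; rewrite mulr_ge0 ?euler_coef_ge0//.
by rewrite prime_power_series_ge0.
Qed.

Lemma euler_coef_le_limit (g : nat -> nat -> R) N m : (forall p i, 0 <= g p i) ->
  (forall p, prime p -> g p 0%N = 1) -> euler_coef g N m <= euler_coef g m.+2 m.
Proof.
move=> g0 g1; rewrite -(@euler_coef_stable _ g m (maxn N m.+2) g1) ?leq_maxr//.
have := leq_maxl N m.+2; move: (maxn _ _) => M NM.
elim: M NM => [|M IH]; first by rewrite leqn0 => /eqP ->.
rewrite leq_eqVlt => /orP[/eqP ->//|NM].
by apply: le_trans (IH NM) _; exact: euler_coef_mono.
Qed.

Lemma sums_to_tail (u : nat -> C) (be : nat -> R) S K (e : R) : sums_to u S ->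
  (forall m, cmod (u m) <= be m) ->
  (forall n, (K <= n)%N -> \sum_(m < n) be m - \sum_(m < K) be m <= e) ->
  cmod (S - \sum_(m < K) u m) <= e.
Proof.
move=> uS ub tail; apply/ler_addgt0Pr => d d0; have [N HN] := uS d d0.
apply: (le_trans (cmod_dist_trans (\sum_(m < maxn N K) u m) _ _)).
rewrite addrC lerD//; last by rewrite cmodBC HN// leq_maxl.
apply: le_trans (tail _ (leq_maxr N K)).
have /subnK <- := leq_maxr N K.
rewrite addnC !big_split_ord/= ![_ + _ - _]addrC !addKr.
by apply: le_trans (cmod_sum _ _ _) _; apply: ler_sum.
Qed.

Variables (f : nat -> nat -> C) (w : C) (F : nat -> C) (t : nat -> R) (T : R).
Hypothesis f0 : forall p, prime p -> f p 0%N = 1.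
Hypothesis fF : forall p, prime p -> sums_to (fun i => f p i * npow p w ^+ i) (F p).
Hypothesis ft : forall p, prime p -> forall n,
  \sum_(i < n) cmod (f p i) * cmod (npow p w) ^+ i <= 1 + t p.
Hypothesis tT : forall N, \sum_(0 <= p < N | prime p) t p <= T.

Local Notation Wc := (fun m => npow m.+1 w).
Local Notation Wr := (fun m => cmod (npow m.+1 w)).

Let Wc0 : Wc 0%N = 1. Proof. exact: npow1. Qed.
Let WcM i j : Wc (mul_index i j) = Wc i * Wc j.
Proof. by rewrite /mul_index prednK ?muln_gt0// npowM. Qed.
Let Wr0 : Wr 0%N = 1. Proof. by rewrite /= Wc0 cmod1. Qed.
Let WrM i j : Wr (mul_index i j) = Wr i * Wr j.
Proof. by rewrite /= WcM cmodM. Qed.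

Let al := euler_coef (fun p i => cmod (f p i)).

Lemma prime_power_weight_bound p n : prime p ->
  \sum_(m < n) prime_power_series p (fun i => cmod (f p i)) m * Wr m <= 1 + t p.
Proof.
move=> pp; have p0 := prime_gt0 pp.
rewrite (eq_bigr (fun m : 'I_n => conv (prime_power_index p)
    (fun i => cmod (f p i) * Wr p.-1 ^+ i) (unit_seq R) m)); last first.
  by move=> m _; rewrite (weighted_prime_power Wr0 WrM _ m p0).
rewrite -[leRHS]mulr1; apply: sum_conv_le.
- exact: prime_power_indexP (prime_gt1 pp).
- by move=> i; rewrite mulr_ge0 ?exprn_ge0 ?cmod_ge0.
- exact: unit_seq_ge0.
- by move=> k; rewrite /= prednK//; exact: ft.
- exact: unit_seq_bounded.
Qed.

(** The sum of the majorants is at most the product of the [1 + t p]. *)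
Lemma euler_majorant_bound N n : \sum_(m < n) al N m * Wr m <= expR T.
Proof.
have cf0 p i : 0 <= cmod (f p i) by exact: cmod_ge0.
have : \sum_(m < n) al N m * Wr m <= expR (\sum_(0 <= p < N | prime p) t p).
  elim: N n => [|N IH] n.
    rewrite big_geq// expR0; apply: le_trans (unit_seq_bounded R n).
    apply: ler_sum => -[m /= _] _; rewrite /unit_seq; case: m => [|m] /=.
      by rewrite Wc0 cmod1 mulr1.
    by rewrite mul0r.
  rewrite big_prime_recr /al /=; case: ifPn => pN.
    rewrite (eq_bigr (fun m : 'I_n => conv mul_index (fun i => al N i * Wr i)
      (fun i => prime_power_series N (fun i => cmod (f N i)) i * Wr i) m)); last first.
      by move=> m _; rewrite (weighted_mul_conv WrM).
    rewrite expRD; apply: sum_conv_le => //.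
    - exact: mul_indexP.
    - by move=> i; rewrite mulr_ge0 ?cmod_ge0 ?euler_coef_ge0.
    - by move=> i; rewrite mulr_ge0 ?cmod_ge0 ?prime_power_series_ge0.
    - move=> k; apply: le_trans (prime_power_weight_bound k pN) _.
      exact: expR_ge1Dx.
  by rewrite addr0; exact: IH.
by move=> h; apply: le_trans h _; rewrite ler_expR.
Qed.

Lemma euler_partial_sums N :
  sums_to (fun m => euler_coef f N m * Wc m) (\prod_(0 <= p < N | prime p) F p).
Proof.
have asA M : abs_summable (fun m => euler_coef f M m * Wc m).
  exists (expR T) => n; apply: le_trans (euler_majorant_bound M n).
  by apply: ler_sum => m _; rewrite cmodM ler_wpM2r ?cmod_ge0// cmod_euler_coef.
elim: N => [|N IH].
  rewrite big_geq//; apply: eq_sums_to (@sums_to_unit R) => -[|m] /=.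
    by rewrite Wc0 mulr1.
  by rewrite /unit_seq /= mul0r.
rewrite big_prime_recr /=; case: ifPn => pN; last by rewrite mulr1.
have p0 := prime_gt0 pN; have pi := prime_power_indexP (prime_gt1 pN).
have asf : abs_summable (fun i => f N i * Wc N.-1 ^+ i).
  exists (1 + t N) => n; apply: le_trans (ft pN n); apply: ler_sum => i _.
  by rewrite prednK// cmodM cmodX.
have sf : sums_to (fun i => f N i * Wc N.-1 ^+ i) (F N).
  by apply: eq_sums_to (fF pN) => i; rewrite prednK.
have pE m : conv (prime_power_index N) (fun i => f N i * Wc N.-1 ^+ i) (unit_seq C) m =
    prime_power_series N (f N) m * Wc m by exact: (weighted_prime_power Wc0 WcM).
have sp : sums_to (fun m => prime_power_series N (f N) m * Wc m) (F N).
  by apply: eq_sums_to pE _; rewrite -[F N]mulr1;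
  exact: (sums_to_conv pi asf (@abs_summable_unit R) sf (@sums_to_unit R)).
have ap : abs_summable (fun m => prime_power_series N (f N) m * Wc m).
  apply: (@abs_summable_le _ _ _ 1) (abs_summable_conv pi asf (@abs_summable_unit R)) => m.
  by rewrite mul1r pE.
apply: eq_sums_to (sums_to_conv mul_indexP (asA N) ap IH sp) => m.
exact: (weighted_mul_conv WcM).
Qed.

(** The coefficients of the partial products are dominated by those for the
    absolute values of [f], which increase with the number of factors, and each
    coefficient is eventually constant: this is dominated convergence. *)
Theorem euler_product : exists S, let a m := euler_coef f m.+2 m in
  [/\ abs_summable (fun m => a m * npow m.+1 w),
      sums_to (fun m => a m * npow m.+1 w) S &
      tends (fun N => \prod_(0 <= p < N | prime p) F p) S].
Proof.
pose be m := al m.+2 m * Wr m.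
have cf0 p i : 0 <= cmod (f p i) by exact: cmod_ge0.
have cf1 p : prime p -> cmod (f p 0%N) = 1 by move=> /f0 ->; exact: cmod1.
have le_be N m : cmod (euler_coef f N m * Wc m) <= be m.
  rewrite cmodM ler_wpM2r ?cmod_ge0// (le_trans (cmod_euler_coef _ _ _))//.
  exact: euler_coef_le_limit.
have beT n : \sum_(m < n) be m <= expR T.
  apply: le_trans (euler_majorant_bound n.+1 n); apply: ler_sum => m _.
  rewrite /be /al -(@euler_coef_stable _ _ m n.+1 cf1) ?lexx//.
  by rewrite ltnS ltn_ord.
have aS : abs_summable (fun m => euler_coef f m.+2 m * Wc m).
  by exists (expR T) => n; apply: le_trans (beT n); exact: ler_sum.
have [S hS] := abs_summable_sums aS; exists S; split=> // e e0.
have e2 : 0 < e / 2 by rewrite divr_gt0.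
have be0 m : 0 <= be m := le_trans (cmod_ge0 _) (le_be 0%N m).
have mono : {homo (fun n => \sum_(i < n) be i) : m n / (m <= n)%N >-> m <= n}.
  by move=> m n /subnK <-; rewrite addnC big_split_ord/= lerDl sumr_ge0.
have [K HK] := mono_bounded_cauchy mono beT e2.
exists K.+1 => N KN.
apply: (le_trans (cmod_dist_trans (\sum_(m < K) euler_coef f N m * Wc m) _ _)).
rewrite [leRHS]splitr lerD//; first exact: sums_to_tail (euler_partial_sums N) (le_be N) HK.
rewrite cmodBC (eq_bigr (fun m : 'I_K => euler_coef f m.+2 m * Wc m)).
  exact: sums_to_tail hS (fun m => le_be m.+2 m) HK.
move=> m _; rewrite (@euler_coef_stable _ f m N f0)//.
by rewrite (leq_trans _ KN)// ltnS ltn_ord.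
Qed.

End EulerProduct.

(** * The functions on the cut disc *)
Section CutDisk.
Variable R : realType.
Local Notation C := (Cplx R).

(** The cuts start at singularities and run outwards, so that the disc below the
    smallest singularity is left intact. *)
Lemma cut_disk_cdiff (f : C -> C) (Sing : set C) (r : R) :
  holomorphic_cut_disk f Sing -> (forall c, Sing c -> r <= cmod c) ->
  forall z, cmod z < Num.min r 1 -> exists d, cdiff f z d.
Proof.
move=> [branch [cut [_ bS cutP [_ fD] _]]] Sr z; rewrite lt_min => /andP[zr z1].
exists (derive1 f z); apply: derivable_cdiff; apply: fD; split.
  by rewrite /unit_disk /= cmodE -(rmorph1 (real_complex R)) ltcR.
case=> [/Sr|[a ba [t t01 tz]]]; first by rewrite leNgt zr.
have [cut0 _ mono] := cutP a ba.
have tI : t \in (`[0, 1[ : set R) by rewrite inE.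
have zI : 0 \in (`[0, 1[ : set R) by rewrite inE /= in_itv /= lexx ltr01.
have t0 : 0 <= t by move: t01; rewrite /= in_itv /= => /andP[].
have := mono 0 t zI tI t0.
rewrite cut0 tz !cmodE lecR => az; have := le_trans (Sr a (bS a ba)) az.
by rewrite leNgt zr.
Qed.

Lemma smallest_singularityP (Q : nat -> C -> C) (Sing : nat -> set C) (r : R) :
  (forall p, prime p -> ~ Sing p 0 /\ Q p 0 = 1) -> smallest_singularity Sing r ->
  0 < r /\ forall p c, prime p -> Sing p c -> r <= cmod c.
Proof.
move=> Q0 [[p [a [pp Sa ar rmin]]]|[S0 r1]].
  split; last by move=> q c qp /(rmin q c qp); rewrite cmodE lecR.
  have -> : r = cmod a by apply: complexI; rewrite -cmodE ar.
  by rewrite cmod_gt0; apply/eqP => a0; case: (Q0 p pp) => + _; rewrite -a0.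
split; first exact: lt_le_trans ltr01 r1.
by move=> p c pp; rewrite S0.
Qed.

Lemma cmod_prime_power_lt1 p (s : C) : prime p -> 0 < complex.Re s -> cmod (npow p (- s)) < 1.
Proof.
move=> pp s0; rewrite cmod_npow ReN expR_lt1 mulNr oppr_lt0 mulr_gt0// ln_gt0//.
by rewrite ltr1n prime_gt1.
Qed.

(** The bound on [p] says that [p ^ - eps < r], and [Re s] exceeds [eps]. *)
Lemma cmod_prime_power_lt_radius p (s : C) (r eps : R) : prime p -> 0 < r -> 0 < eps ->
  eps < complex.Re s -> ~~ (p%:R <= r `^ (- eps^-1)) ->
  cmod (npow p (- s)) < Num.min r 1.
Proof.
move=> pp r0 e0 es; rewrite -ltNge => rp.
have s0 : 0 < complex.Re s := lt_trans e0 es.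
rewrite lt_min cmod_prime_power_lt1// andbT cmod_npow ReN.
have p1 : 1 < p%:R :> R by rewrite ltr1n prime_gt1.
have lnp : 0 < ln p%:R :> R by rewrite ln_gt0.
rewrite -[ltRHS](@lnK _ r) ?posrE// ltr_expR.
have : ln (r `^ (- eps^-1)) < ln (p%:R : R).
  by rewrite ltr_ln ?posrE ?powR_gt0// (lt_trans ltr01).
rewrite ln_powR => h; apply: (@le_lt_trans _ _ (- eps * ln p%:R)).
  by rewrite !mulNr lerN2 ler_wpM2r ?(ltW lnp) ?(ltW es).
rewrite -(ltr_pM2l (_ : 0 < eps^-1)) ?invr_gt0// mulrA mulrN mulVf ?gt_eqF// mulN1r.
by rewrite ltrNl -mulNr.
Qed.

End CutDisk.

(** * Holomorphy of Dirichlet series *)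
Section DirichletSeries.
Variable R : realType.
Local Notation C := (Cplx R).

(** Differentiation brings in powers of [ln n], which are absorbed by an
    arbitrarily small power of [n]. *)
Lemma sqr_le_expR (x del : R) : 0 <= x -> 0 < del ->
  x ^+ 2 <= 4 / del ^+ 2 * expR (del * x).
Proof.
move=> x0 d0; have h : del * x / 2 <= expR (del * x / 2).
  by apply: le_trans (expR_ge1Dx _); rewrite lerDr.
have h0 : 0 <= del * x / 2 by rewrite divr_ge0// mulr_ge0// ltW.
have : (del * x / 2) ^+ 2 <= expR (del * x).
  have -> : expR (del * x) = expR (del * x / 2) ^+ 2.
    by rewrite expr2 -expRD -splitr.
  by rewrite lerXn2r ?nnegrE ?expR_ge0.
move=> h2; have -> : x ^+ 2 = 4 / del ^+ 2 * (del * x / 2) ^+ 2.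
  by field; rewrite gt_eqF.
by rewrite ler_wpM2l// divr_ge0// exprn_ge0// ltW.
Qed.

(** The series converges absolutely at a point to the left of [s]; what is gained
    there dominates the quadratic errors of the terms. *)
Lemma dirichlet_cdiff (a : nat -> C) (D : C -> C) (eps : R) :
  (forall s, eps < complex.Re s -> abs_summable (fun m => a m * npow m.+1 (- s)) /\
     sums_to (fun m => a m * npow m.+1 (- s)) (D s)) ->
  forall s, eps < complex.Re s -> exists d, cdiff D s d.
Proof.
move=> aD s es; set del := (complex.Re s - eps) / 4.
have del0 : 0 < del by rewrite divr_gt0// subr_gt0.
have es' : eps < complex.Re (s - (2 * del)%:C).
  by rewrite ReD ReN /= /del; move: es; lra.
have [[M aM] _] := aD _ es'.
pose x m : R := ln m.+1%:R.
have x0 m : 0 <= x m by rewrite ln_ge0// ler1n.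
(* the modulus of the term of index [m] at [s - 2 * del] *)
pose be m := cmod (a m) * expR (- complex.Re s * x m) * expR (2 * del * x m).
have beM n : \sum_(m < n) be m <= M.
  apply: le_trans (aM n); apply: ler_sum => m _.
  rewrite cmodM cmod_npow /be -mulrA -expRD ler_wpM2l ?cmod_ge0// ler_expR.
  by rewrite ReN ReD ReN /= -/(x m); lra.
pose d m : C := a m * npow m.+1 (- s) * (- x m)%:C.
have npow_le m : cmod (a m * npow m.+1 (- s)) = cmod (a m) * expR (- complex.Re s * x m).
  by rewrite cmodM cmod_npow ReN.
have ex m : 0 <= cmod (a m) * expR (- complex.Re s * x m).
  by rewrite mulr_ge0 ?cmod_ge0 ?expR_ge0.
have dM : abs_summable d.
  exists (del^-1 * M) => n; apply: (@le_trans _ _ (\sum_(m < n) del^-1 * be m)).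
    apply: ler_sum => m _; rewrite cmodM npow_le cmod_real normrN ger0_norm// /be.
    rewrite mulrCA ler_wpM2l// -ler_pdivrMl ?invr_gt0// invrK.
    apply: le_trans (expR_ge1Dx _); have := x0 m; move: del0.
    move: (del) (x m) => dd y d1 y1; have : 0 <= dd * y by rewrite mulr_ge0// ltW.
    by lra.
  by rewrite -big_distrr/= ler_pM2l ?invr_gt0// beM.
have [Dd hD] := abs_summable_sums dM; exists Dd.
apply: (@cdiff_series R (fun m w => a m * npow m.+1 (- w)) D d Dd s del (4 / del ^+ 2 * M)
  (fun m => 4 / del ^+ 2 * be m)) => //.
- move=> n; rewrite -big_distrr/= ler_wpM2l ?beM//.
  by rewrite divr_ge0// exprn_ge0// ltW.
- move=> m h hd; set y : C := - h * (x m)%:C.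
  have -> : a m * npow m.+1 (- (s + h)) - a m * npow m.+1 (- s) - d m * h =
      a m * npow m.+1 (- s) * (cexp y - 1 - y).
    by rewrite opprD npowD /d /y /npow -/(x m) rmorphN; ring.
  rewrite cmodM npow_le.
  have yE : cmod y = cmod h * x m by rewrite cmodM cmodN cmod_real ger0_norm.
  have yb : cmod (cexp y - 1 - y) <= cmod h ^+ 2 * (4 / del ^+ 2 * expR (2 * del * x m)).
    apply: le_trans (cmod_cexp_sub1_sub y) _; rewrite yE exprMn -[leLHS]mulrA ler_wpM2l ?sqr_ge0//.
    have -> : 2 * del * x m = del * x m + del * x m by ring.
    rewrite expRD mulrA ler_pM ?sqr_ge0 ?expR_ge0 ?sqr_le_expR//.
    by rewrite ler_expR ler_wpM2r// ltW.
  apply: le_trans (ler_wpM2l (ex m) yb) _.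
  by rewrite [leLHS](_ : _ = cmod h ^+ 2 * (4 / del ^+ 2 * be m))// /be; ring.
- move=> h hd; apply: (aD _ _).2; rewrite ReD.
  have := le_lt_trans (Re_le_cmod h) hd; rewrite ltr_norml => /andP[h1 _].
  by move: es h1; rewrite /del; lra.
Qed.

Lemma dirichlet_holomorphic (a : nat -> C) (D : C -> C) (eps : R) :
  (forall s, eps < complex.Re s -> abs_summable (fun m => a m * npow m.+1 (- s)) /\
     sums_to (fun m => a m * npow m.+1 (- s)) (D s)) ->
  holomorphic_on [set s : C | eps < complex.Re s] D.
Proof.
move=> aD; split; last first.
  by move=> s /(dirichlet_cdiff aD)[d]; exact: cdiff_derivable.
rewrite openE => s /= es; apply/nbhs_ballP.
exists (complex.Re s - eps)%:C; first by rewrite /= ltcR subr_gt0.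
move=> z; rewrite -ball_normE /= ltr_cmod => h.
have := le_lt_trans (Re_le_cmod _) h; rewrite ReD ReN ltr_norml => /andP[_].
lra.
Qed.

End DirichletSeries.

(** * Local factors *)
Section ConvolutionProduct.
Variable R : realType.
Local Notation C := (Cplx R).
Variable I : eqType.
Implicit Types (s : seq I) (u l : I -> nat -> C).

Definition conv_prod s u : nat -> C :=
  foldr (fun i acc => conv addn (u i) acc) (unit_seq C) s.

Lemma addn_increasing : increasing_index addn.
Proof. by move=> i j; rewrite leq_addr leq_addl. Qed.

Lemma conv_addn0 (a b : nat -> C) : conv addn a b 0 = a 0%N * b 0%N.
Proof. by rewrite convE big_ord1. Qed.

Lemma conv_prod0 s u : {in s, forall i, u i 0%N = 1} -> conv_prod s u 0 = 1.
Proof.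
elim: s => [//|i s IH] u1 /=; rewrite conv_addn0 u1 ?mem_head// mul1r IH// => j js.
by rewrite u1// inE js orbT.
Qed.

Lemma conv_prod_log_deriv s u l : {in s, forall i, log_deriv (u i) (l i)} ->
  log_deriv (conv_prod s u) (fun m => \sum_(i <- s) l i m).
Proof.
elim: s => [|i s IH] ul /=.
  have := @log_deriv1 C; congr log_deriv; apply/funext => m; by rewrite big_nil.
have h1 : log_deriv (u i) (l i) by apply: ul; exact: mem_head.
have h2 : log_deriv (conv_prod s u) (fun m => \sum_(i <- s) l i m).
  by apply: IH => j js; apply: ul; rewrite inE js orbT.
have := log_derivM h1 h2; congr log_deriv; apply/funext => m; by rewrite big_cons.
Qed.

Lemma eval_conv (a b : nat -> C) (z A B : C) :
  abs_summable (fun m => a m * z ^+ m) -> abs_summable (fun m => b m * z ^+ m) ->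
  sums_to (fun m => a m * z ^+ m) A -> sums_to (fun m => b m * z ^+ m) B ->
  abs_summable (fun m => conv addn a b m * z ^+ m) /\
  sums_to (fun m => conv addn a b m * z ^+ m) (A * B).
Proof.
move=> aa ab sA sB.
have E m : conv addn (fun i => a i * z ^+ i) (fun j => b j * z ^+ j) m =
    conv addn a b m * z ^+ m.
  rewrite !convE big_distrl/=; apply: eq_bigr => i _.
  have -> : z ^+ m = z ^+ i * z ^+ (m - i) by rewrite -exprD subnKC// -ltnS.
  by ring.
split.
  apply: (@abs_summable_le _ _ _ 1) (abs_summable_conv addn_increasing aa ab) => m.
  by rewrite E mul1r.
exact: eq_sums_to E (sums_to_conv addn_increasing aa ab sA sB).
Qed.

Lemma eval_unit_seq (z : C) : abs_summable (fun m => unit_seq C m * z ^+ m) /\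
  sums_to (fun m => unit_seq C m * z ^+ m) 1.
Proof.
have E m : unit_seq C m = unit_seq C m * z ^+ m.
  by case: m => [|m]; rewrite /unit_seq ?mulr1// mul0r.
split; last exact: eq_sums_to E (@sums_to_unit R).
by apply: (@abs_summable_le _ _ _ 1) (@abs_summable_unit R) => m; rewrite mul1r -E.
Qed.

Lemma eval_conv_prod s u (S : I -> C) (z : C) :
  {in s, forall i, abs_summable (fun m => u i m * z ^+ m) /\
     sums_to (fun m => u i m * z ^+ m) (S i)} ->
  abs_summable (fun m => conv_prod s u m * z ^+ m) /\
  sums_to (fun m => conv_prod s u m * z ^+ m) (\prod_(i <- s) S i).
Proof.
elim: s => [|i s IH] us /=; first by rewrite big_nil; exact: eval_unit_seq.
have [h1 h2] := us i (mem_head _ _).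
have [|h3 h4] := IH; first by move=> j js; apply: us; rewrite inE js orbT.
by rewrite big_cons; exact: eval_conv.
Qed.

End ConvolutionProduct.

Section Majorants.
Variable R : realType.
Local Notation C := (Cplx R).

(** Without terms of degree between 1 and [N], each term of the sum except the
    first gains a factor [(x / y) ^ (N + 1)] when [y] is replaced by [x]. *)
Lemma tail_ratio (u : nat -> C) (x y M : R) N n : 0 < y -> 0 <= x <= y ->
  u 0%N = 1 -> (forall m, (m < N)%N -> u m.+1 = 0) ->
  (forall n, \sum_(i < n) cmod (u i) * y ^+ i <= M) ->
  \sum_(i < n) cmod (u i) * x ^+ i <= 1 + M * (x / y) ^+ N.+1.
Proof.
move=> y0 /andP[x0 xy] u0 uN uM; set q := x / y.
have q0 : 0 <= q by rewrite divr_ge0// ltW.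
have q1 : q <= 1 by rewrite ler_pdivrMr// mul1r.
have xE : x = y * q by rewrite /q mulrC divfK// gt_eqF.
apply: (@le_trans _ _ (\sum_(i < n) (unit_seq R i + cmod (u i) * y ^+ i * q ^+ N.+1))).
  apply: ler_sum => -[i /= _] _; have yi : 0 <= y ^+ i by rewrite exprn_ge0// ltW.
  have cy : 0 <= cmod (u i) * y ^+ i by rewrite mulr_ge0 ?cmod_ge0.
  have [i0|i0] := posnP i.
    have qN : 0 <= q ^+ N.+1 by exact: exprn_ge0.
    by rewrite i0 /unit_seq eqxx u0 cmod1 !expr0 !mul1r lerDl.
  case: i i0 yi cy => // i _ yi cy; rewrite /unit_seq add0r.
  have [iN|iN] := ltnP i N; first by rewrite uN// cmod0 !mul0r.
  by rewrite xE exprMn mulrA ler_wpM2l// ler_wiXn2l// ?q0.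
rewrite big_split/= -big_distrl/= lerD ?unit_seq_bounded//.
by rewrite ler_wpM2r ?uM// exprn_ge0.
Qed.

Lemma prime_sum_bound (tau : R) N : 0 < tau ->
  \sum_(0 <= p < N | prime p) expR (- (1 + tau) * ln p%:R) <= 1 + tau^-1.
Proof.
move=> tau0; case: N => [|N].
  by rewrite big_geq// addr_ge0// invr_ge0 ltW.
apply: le_trans (p_series_bound N tau0).
rewrite big_mkcond big_nat_recl//= add0r big_mkord; apply: ler_sum => m _.
by case: ifP => // _; exact: expR_ge0.
Qed.

End Majorants.

Section EulerFactor.
Variable R : realType.
Local Notation C := (Cplx R).

Lemma log_deriv_inj (a a' l l' : nat -> C) : a 0%N = a' 0%N ->
  log_deriv a l -> log_deriv a' l' -> (forall m, l m.+1 = l' m.+1) -> a =1 a'.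
Proof.
move=> aa al al' ll m; have [n] := ubnP m; elim: n m => // n IH [|m] mn //.
have m0 : (m.+1%:R : C) != 0 by rewrite pnatr_eq0.
apply: (mulfI m0); rewrite al al'; apply: eq_bigr => i _.
by rewrite ll IH// (leq_ltn_trans (leq_subr _ _)).
Qed.

Lemma fps_log_inflate (a : nat -> C) n m : (0 < n)%N -> a 0%N = 1 ->
  fps_log (inflate n a) m.+1 = inflate n (fps_log a) m.+1.
Proof.
move=> n0 a0; apply: fps_logE; first by rewrite /inflate dvdn0 div0n.
by apply: log_deriv_inflate => //; exact: fps_log_deriv.
Qed.

Lemma inflate_big n (l : nat -> C) m : (m.+1 < n)%N -> inflate n l m.+1 = 0.
Proof.
move=> mn; rewrite /inflate; case: ifP => // /dvdn_leq -/(_ isT).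
by rewrite leqNgt mn.
Qed.

Variable I : finType.
Implicit Types (head : nat -> C) (N : nat) (b : nat -> I -> C) (c : I -> nat -> C).

(** The power series in [z] of [head z * \prod_n \prod_W (c W (z ^ n)) ^ (b n W)]. *)
Definition factor_coef head N b c : nat -> C :=
  conv addn head (conv_prod (index_iota 1 N.+1) (fun n =>
    conv_prod (index_enum I) (fun W => inflate n (fps_pow (c W) (b n W))))).

Lemma factor_coef0 head N b c : head 0%N = 1 -> factor_coef head N b c 0 = 1.
Proof.
move=> h0; rewrite /factor_coef conv_addn0 h0 mul1r; apply: conv_prod0 => n _.
by apply: conv_prod0 => W _; rewrite /inflate dvdn0 div0n fps_pow0.
Qed.

Lemma factor_coef_eval head N b c (z H : C) : cmod z < 1 ->
  abs_summable (fun m => head m * z ^+ m) -> sums_to (fun m => head m * z ^+ m) H ->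
  (forall W (e : C), exists2 l : nat -> C, log_deriv (fps_pow (c W) e) l &
     exists M : R, forall m, cmod (m.+1%:R * l m.+1) <= M) ->
  abs_summable (fun m => factor_coef head N b c m * z ^+ m) /\
  sums_to (fun m => factor_coef head N b c m * z ^+ m)
    (H * \prod_(1 <= n < N.+1) \prod_W fps_eval (fps_pow (c W) (b n W)) (z ^+ n)).
Proof.
move=> z1 ha hH growth.
have inner n : (n \in index_iota 1 N.+1) -> forall W,
    abs_summable (fun m => inflate n (fps_pow (c W) (b n W)) m * z ^+ m) /\
    sums_to (fun m => inflate n (fps_pow (c W) (b n W)) m * z ^+ m)
      (fps_eval (fps_pow (c W) (b n W)) (z ^+ n)).
  rewrite mem_index_iota => /andP[n0 _] W.
  have [l al [M lM]] := growth W (b n W).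
  have zn : cmod (z ^+ n) < 1.
    by rewrite cmodX exprn_ilt1 ?cmod_ge0// -lt0n.
  have as1 := abs_summable_growth (fps_pow0 _ _) al lM zn.
  have [S hS] := abs_summable_sums as1.
  have -> : fps_eval (fps_pow (c W) (b n W)) (z ^+ n) = S by exact: sums_to_limn hS.
  exact: sums_to_inflate.
have [h1 h2] := eval_conv_prod (s := index_iota 1 N.+1)
  (S := fun n => \prod_W fps_eval (fps_pow (c W) (b n W)) (z ^+ n))
  (u := fun n => conv_prod (index_enum I) (fun W => inflate n (fps_pow (c W) (b n W))))
  (fun n nN => eval_conv_prod (s := index_enum I) (fun W _ => inner n nN W)).
exact: eval_conv.
Qed.

(** The exponents [b n W] with [n <= N] cancel the terms of degree at most [N] of
    the logarithm of [head]. *)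
Lemma factor_coef_vanish head N b c : head 0%N = 1 -> (forall W, c W 0%N = 1) ->
  (forall m, fps_log head m.+1 = - \sum_(1 <= n < m.+2) \sum_W
     b n W * inflate n (fps_log (c W)) m.+1) ->
  forall m, (m < N)%N -> factor_coef head N b c m.+1 = 0.
Proof.
move=> h0 c0 hlog.
pose lf n W m : C := b n W * inflate n (fps_log (c W)) m.
have dl : log_deriv (factor_coef head N b c) (fun m => fps_log head m +
    \sum_(n <- index_iota 1 N.+1) \sum_(W <- index_enum I) lf n W m).
  apply: log_derivM; first exact: fps_log_deriv.
  apply: conv_prod_log_deriv => n; rewrite mem_index_iota => /andP[n0 _].
  apply: conv_prod_log_deriv => W _.
  have := log_deriv_inflate n0 (fps_pow_deriv (c W) (b n W)); congr log_deriv.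
  apply/funext => m; rewrite /lf /inflate; case: ifP => // _; exact/esym/mulr0.
apply: log_deriv_vanish dl _ => m mN.
have -> : \sum_(n <- index_iota 1 N.+1) \sum_(W <- index_enum I) lf n W m.+1 =
    \sum_(1 <= n < m.+2) \sum_W lf n W m.+1.
  rewrite (big_cat_nat (n := m.+2))//= [X in _ + X]big_nat_cond.
  rewrite [X in _ + X]big1 ?addr0// => n /andP[/andP[mn _] _].
  by apply: big1 => W _; rewrite /lf inflate_big ?mulr0.
by rewrite hlog addNr.
Qed.

(** Primes with the same class have the same coefficients, so that the smallest
    prime in each class provides a bound for all the others. *)
Lemma class_bound (J : finType) (Fg : J -> nat -> C) (cls : nat -> J) (good : pred nat)
    (x : nat -> R) N :
  (forall p, good p -> 0 < x p) -> (forall p q, good p -> good q -> (p <= q)%N -> x q <= x p) ->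
  (forall p, good p -> Fg (cls p) 0%N = 1) ->
  (forall p, good p -> forall m, (m < N)%N -> Fg (cls p) m.+1 = 0) ->
  (forall p, good p -> exists M, forall n, \sum_(i < n) cmod (Fg (cls p) i) * x p ^+ i <= M) ->
  exists2 K : R, 0 <= K & forall p, good p -> forall n,
    \sum_(i < n) cmod (Fg (cls p) i) * x p ^+ i <= 1 + K * x p ^+ N.+1.
Proof.
move=> x0 xmono F0 FN FM.
have /boolp.choice[K KP] : forall g : J, exists K : R, 0 <= K /\
    forall p, good p -> cls p = g -> forall n,
    \sum_(i < n) cmod (Fg (cls p) i) * x p ^+ i <= 1 + K * x p ^+ N.+1.
  move=> g; have [exg|np] := pselect (exists p, good p && (cls p == g)); last first.
    by exists 0; split=> // p gp pg; case: np; exists p; rewrite gp pg eqxx.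
  case: (ex_minnP exg) => q /andP[gq /eqP qg] qmin.
  have [M hM] := FM q gq.
  have M0 : 0 <= M by have := hM 0%N; rewrite big_ord0.
  have xq0 := x0 q gq.
  exists (M * (x q)^-1 ^+ N.+1); split=> [|p gp pg n].
    by rewrite mulr_ge0// exprn_ge0// invr_ge0 ltW.
  have pq : (q <= p)%N by apply: qmin; rewrite gp pg eqxx.
  have -> : M * (x q)^-1 ^+ N.+1 * x p ^+ N.+1 = M * (x p / x q) ^+ N.+1.
    by rewrite exprMn; ring.
  apply: tail_ratio => //.
  - by rewrite (ltW (x0 p gp)) xmono.
  - exact: F0.
  - exact: FN.
  - by rewrite pg -qg.
exists (\sum_g K g); first by apply: sumr_ge0 => g _; case: (KP g).
move=> p gp n; have [K0 h] := KP (cls p); apply: le_trans (h p gp erefl n) _.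
rewrite lerD2l ler_wpM2r ?exprn_ge0 ?(ltW (x0 p gp))//.
by rewrite (bigD1 (cls p))//= lerDl; apply: sumr_ge0 => g _; case: (KP g).
Qed.

End EulerFactor.

Section UnramifiedFactor.
Variables (R : realType) (L : splittingFieldType rat).
Local Notation C := (Cplx R).

Lemma artin_poly_unramified d (rho : mx_representation R[i] (galQ L) d) p
    (P : set L) g : prime p -> frobenius_at p P g -> Defs.inertia P = 1%g ->
  coefs (artin_poly rho P g) =1 coefs (det_poly (rho g) 1).
Proof.
move=> pp gP I1; have [_ Gg _] := gP.
apply: log_deriv_inj (log_artin_poly rho pp gP).1 (log_det_repr rho Gg).1 _.
  by rewrite artin_poly_coef0 det_poly_coef0.
by move=> m; rewrite artin_trace_unramified.
Qed.

End UnramifiedFactor.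

(** * The residual product *)
Section ResidualProduct.
Variables (R : realType) (L : splittingFieldType rat).
Local Notation C := (Cplx R).
Local Notation G := (galQ L).
Local Notation irr := (irr_classes R L).
Implicit Types (b : nat -> irr -> C) (g : gal_of {:L}) (P : set L) (s : C).

Definition artin_coef P g (W : irr) : nat -> C := coefs (artin_poly (irr_repr W) P g).

Definition det_coef g (W : irr) : nat -> C := coefs (det_poly (irr_repr W g) 1).

(** The factor [Q p (p ^ - s)] of the residual product is absent for the small
    primes, where the series of [Q p] might diverge. *)
Definition residual_head (Q : nat -> C -> C) (r eps : R) p : nat -> C :=
  if p%:R <= r `^ (- eps^-1) then unit_seq C else taylor (Q p).

Lemma residual_factor_eval (Q : nat -> C -> C) (r eps : R) b P g p s :
  prime p -> frobenius_at p P g -> 0 < r -> 0 < eps -> eps < complex.Re s ->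
  expands (Q p) (taylor (Q p)) (Num.min r 1) ->
  let a := factor_coef (residual_head Q r eps p) (Num.truncn eps^-1) b (artin_coef P g) in
  abs_summable (fun m => a m * npow p (- s) ^+ m) /\
  sums_to (fun m => a m * npow p (- s) ^+ m) (residual_factor Q r eps b P g p s).
Proof.
move=> pp gP r0 e0 es Qe a; set z := npow p (- s).
have z1 : cmod z < 1 by apply: cmod_prime_power_lt1 => //; exact: lt_trans es.
have [h1 h2] : abs_summable (fun m => residual_head Q r eps p m * z ^+ m) /\
    sums_to (fun m => residual_head Q r eps p m * z ^+ m)
      (if p%:R <= r `^ (- eps^-1) then 1 else Q p z).
  rewrite /residual_head; case: ifPn => pr; first exact: eval_unit_seq.
  exact: Qe (cmod_prime_power_lt_radius pp r0 e0 es pr).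
have [h3 h4] := factor_coef_eval (Num.truncn eps^-1) b z1 h1 h2
  (fun W e => artin_pow_growth (irr_repr W) pp gP e).
split; first exact: h3.
have -> : residual_factor Q r eps b P g p s =
    (if p%:R <= r `^ (- eps^-1) then 1 else Q p z) *
    \prod_(1 <= n < (Num.truncn eps^-1).+1) \prod_W
      fps_eval (fps_pow (artin_coef P g W) (b n W)) (z ^+ n).
  rewrite /residual_factor; apply: congr1; apply: eq_big_nat => n _.
  apply: eq_bigr => W _; rewrite /artin_pow.
  have -> : npow p (- (n%:R * s)) = z ^+ n by rewrite -mulrN npowMn.
  by [].
exact: h4.
Qed.

(** At a prime with trivial inertia the Artin polynomials are those of the
    Frobenius element, so that the local series only depends on it. *)
Lemma residual_coef_good (Q : nat -> C -> C) (r eps : R) N b P g p (q : C -> C) :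
  prime p -> frobenius_at p P g -> Defs.inertia P = 1%g ->
  ~~ (p%:R <= r `^ (- eps^-1)) -> Q p = q ->
  factor_coef (residual_head Q r eps p) N b (artin_coef P g) =
  factor_coef (taylor q) N b (det_coef g).
Proof.
move=> pp gP I1 pr Qp; rewrite /residual_head (negPf pr) Qp; congr factor_coef.
apply/funext => W; apply/funext => k.
exact: (artin_poly_unramified (irr_repr W) pp gP I1).
Qed.

Lemma fps_log_det_inflate g (W : irr) n m : (0 < n)%N ->
  fps_log (coefs (det_poly (irr_repr W g) n)) m.+1 = inflate n (fps_log (det_coef g W)) m.+1.
Proof.
move=> n0; have -> : coefs (det_poly (irr_repr W g) n) = inflate n (det_coef g W).
  by apply/funext; exact: (det_poly_inflate (irr_repr W g) n0).
by apply: fps_log_inflate => //; exact: (det_poly_coef0 (irr_repr W g)).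
Qed.

(** Beyond [B] the local factors are [1 + O(p ^ - ((N + 1) s))], with an exponent
    of real part greater than 1; below [B] any bounds will do, as there are
    finitely many primes. *)
Lemma local_bounds (f : nat -> nat -> C) (Fg : gal_of {:L} -> nat -> C)
    (Fr : nat -> gal_of {:L}) (B N : nat) (s : C) :
  0 < complex.Re s -> 1 < N.+1%:R * complex.Re s ->
  (forall p, prime p -> (B < p)%N -> [/\ f p = Fg (Fr p), Fg (Fr p) 0%N = 1 &
     forall m, (m < N)%N -> Fg (Fr p) m.+1 = 0]) ->
  (forall p, prime p -> abs_summable (fun m => f p m * npow p (- s) ^+ m)) ->
  exists t T,
    (forall p, prime p -> forall n,
      \sum_(i < n) cmod (f p i) * cmod (npow p (- s)) ^+ i <= 1 + t p) /\
    (forall K, \sum_(0 <= p < K | prime p) t p <= T :> R).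
Proof.
move=> s0 Ns good fsum; pose x p := cmod (npow p (- s)) : R.
pose gd p := prime p && (B < p)%N.
have bnd p : prime p -> exists M, forall n, \sum_(i < n) cmod (f p i) * x p ^+ i <= M.
  move=> /fsum[M fM]; exists M => n; apply: le_trans (fM n).
  by apply: ler_sum => i _; rewrite cmodM cmodX.
have [K K0 hK] : exists2 K : R, 0 <= K & forall p, gd p -> forall n,
    \sum_(i < n) cmod (Fg (Fr p) i) * x p ^+ i <= 1 + K * x p ^+ N.+1.
  apply: class_bound.
  - by move=> p _; rewrite /x cmod_npow expR_gt0.
  - move=> p q /andP[pp _] /andP[pq _] pleq; rewrite /x !cmod_npow ler_expR ReN.
    rewrite !mulNr lerN2 ler_wpM2l ?(ltW s0)// ler_ln ?posrE ?ltr0n ?prime_gt0//.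
    by rewrite ler_nat.
  - by move=> p /andP[pp Bp]; have [] := good p pp Bp.
  - by move=> p /andP[pp Bp]; have [] := good p pp Bp.
  - move=> p /andP[pp Bp]; have [<- _ _] := good p pp Bp; exact: bnd.
have /boolp.choice[M MP] : forall p, exists M : R, 0 <= M /\ (prime p -> forall n,
    \sum_(i < n) cmod (f p i) * x p ^+ i <= M).
  move=> p; have [/bnd[M hM]|_] := boolP (prime p); last by exists 0.
  by exists M; split=> //; have := hM 0%N; rewrite big_ord0.
have M0 p : 0 <= M p by case: (MP p).
have x0 p : 0 <= x p ^+ N.+1 by rewrite exprn_ge0// cmod_ge0.
(* [M p] majorizes the whole series at a small prime, [1 + t p] all of them *)
pose t p := (if (p <= B)%N then M p else 0) + K * x p ^+ N.+1.
pose tau := N.+1%:R * complex.Re s - 1; have tau0 : 0 < tau by rewrite subr_gt0.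
exists t, (\sum_(0 <= p < B.+1) M p + K * (1 + tau^-1)); split.
  move=> p pp n; rewrite /t; case: leqP => Bp.
    apply: le_trans ((MP p).2 pp n) _.
    by have := mulr_ge0 K0 (x0 p); lra.
  have [-> _ _] := good p pp Bp; rewrite add0r; apply: hK; exact/andP.
move=> k; rewrite big_split/= lerD//.
  apply: (@le_trans _ _ (\sum_(0 <= p < k) if (p <= B)%N then M p else 0)).
    by rewrite big_mkcond; apply: ler_sum => p _; case: ifP => // _; case: ifP.
  apply: (@le_trans _ _ (\sum_(0 <= p < maxn k B.+1) if (p <= B)%N then M p else 0)).
    rewrite [leRHS](big_cat_nat (n := k)) ?leq_maxl//= lerDl.
    by apply: sumr_ge0 => p _; case: ifP.
  rewrite (big_cat_nat (n := B.+1)) ?leq_maxr//= [X in _ + X]big_nat_cond.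
  rewrite [X in _ + X]big1 ?addr0 => [|p /andP[/andP[Bp _] _]]; last by rewrite leqNgt Bp.
  rewrite big_nat_cond [leRHS]big_nat_cond; apply: ler_sum => p /andP[/andP[_ pB] _].
  by rewrite -ltnS pB.
rewrite -big_distrr/= ler_wpM2l//; apply: le_trans (prime_sum_bound k tau0).
apply: ler_sum => p _; rewrite /x cmod_npow -expRM_natl ler_expR ReN /tau.
by rewrite [leLHS](_ : _ = - (1 + (N.+1%:R * complex.Re s - 1)) * ln p%:R)//; ring.
Qed.

End ResidualProduct.

Theorem theorem10p2 (R : realType) (L : splittingFieldType rat)
    (galL : galois 1 {:L})
    (Q : nat -> Cplx R -> Cplx R) (Sing : nat -> set (Cplx R)) (r : R)
    (frobQ : frobenian L Q)
    (holQ : forall p, prime p -> holomorphic_cut_disk (Q p) (Sing p))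
    (Q0 : forall p, prime p -> ~ Sing p 0 /\ Q p 0 = 1)
    (rE : smallest_singularity Sing r) :
  exists b : nat -> irr_classes R L -> Cplx R,
    (exists S : seq nat, forall p, prime p -> p \notin S ->
       forall (P : set L) (g : gal_of {:L}), frobenius_at p P g ->
       forall m : nat, \forall N \near \oo,
         fps_log (taylor (Q p)) m =
         - \sum_(1 <= n < N) \sum_W
             b n W * fps_log (fun k => (det_poly (irr_repr W g) n)`_k : Cplx R) m)
    /\
    (forall eps : R, 0 < eps ->
       forall (P : nat -> set L) (Fr : nat -> gal_of {:L}),
       (forall p, prime p -> frobenius_at p (P p) (Fr p)) ->
       exists (a : nat -> Cplx R) (D : Cplx R -> Cplx R),
         holomorphic_on [set s : Cplx R | eps < complex.Re s] D /\
         forall s : Cplx R, eps < complex.Re s ->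
         [/\ cvgn (series (fun m => `|a m * npow m.+1 (- s)|)),
             series (fun m => a m * npow m.+1 (- s)) @ \oo --> D s &
             (fun N => \prod_(0 <= p < N | prime p)
                residual_factor Q r eps b (P p) (Fr p) p s) @ \oo --> D s]).
Proof.
have [S [c [_ cJ cQ]]] := frobQ.
have [r0 rmin] := smallest_singularityP Q0 rE.
(* the identity (i) is solved for every element of the group *)
pose v m (g : gal_of {:L}) : Cplx R := fps_log (taylor (c g)) m.
have vJ m g h : g \in galQ L -> h \in galQ L -> v m (g ^ h)%g = v m g.
  by move=> Gg Gh; rewrite /v cJ.
have [b bE] := exponents_exist (irr_classes R L) vJ.
exists b; split.
  exists S => p pp pS P g gP [|m].
    exists 0%N => // N _; rewrite fps_log0; apply/esym/eqP; rewrite oppr_eq0; apply/eqP.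
    by apply: big1 => n _; apply: big1 => W _; rewrite fps_log0 mulr0.
  have [_ Gg _] := gP; exists m.+2 => // N /= mN.
  rewrite (cQ p pp pS P g gP); apply: etrans (bE m g Gg) _; apply: (congr1 -%R).
  rewrite [RHS](big_cat_nat (n := m.+2))//= [X in _ = _ + X]big_nat_cond.
  rewrite [X in _ = _ + X]big1 ?addr0// => n /andP[/andP[mn _] _].
  apply: big1 => W _; apply: etrans (mulr0 (b n W)); apply: (congr1 (fun z => b n W * z)).
  exact: (fps_log_det_repr_big (irr_repr W) Gg).
move=> eps e0 P Fr FrP; set N := Num.truncn eps^-1.
have [B1 B1P] := inertia_trivial L.
(* beyond [B]: outside [S], with trivial inertia, and with the factor [Q p] *)
pose B := maxn (\max_(p <- S) p) (maxn B1 (Num.truncn (r `^ (- eps^-1)))).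
have Qe p : prime p -> expands (Q p) (taylor (Q p)) (Num.min r 1).
  move=> pp; apply: holomorphic_expands; apply: cut_disk_cdiff (holQ p pp) _.
  by move=> w; exact: rmin.
have taylor0 p : prime p -> taylor (Q p) 0 = 1.
  by move=> pp; rewrite /taylor derive1n0 (Q0 p pp).2 fact0 divr1.
pose f p := factor_coef (residual_head Q r eps p) N b (artin_coef (P p) (Fr p)).
pose Fg g := factor_coef (taylor (c g)) N b (@det_coef R L g).
have good p : prime p -> (B < p)%N -> [/\ p \notin S, Defs.inertia (P p) = 1%g &
    ~~ (p%:R <= r `^ (- eps^-1))].
  move=> pp; rewrite !gtn_max => /and3P[Sp B1p rp]; split.
  - apply/negP => pS; move: Sp; rewrite ltnNge => /negP; apply.
    exact: (@leq_bigmax_seq _ S xpredT id p pS isT).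
  - by apply: (B1P _ _ pp B1p); case: (FrP p pp).
  - by rewrite -ltNge (lt_le_trans (truncnS_gt _))// ler_nat.
have f0 p : prime p -> f p 0%N = 1.
  move=> pp; apply: factor_coef0; rewrite /residual_head; case: ifP => // _.
  exact: taylor0.
have fFg p : prime p -> (B < p)%N -> [/\ f p = Fg (Fr p), Fg (Fr p) 0%N = 1 &
    forall m, (m < N)%N -> Fg (Fr p) m.+1 = 0].
  move=> pp Bp; have [pS I1 pr] := good p pp Bp; have [_ Gg _] := FrP p pp.
  have Qc : Q p = c (Fr p) by exact: (cQ p pp pS _ _ (FrP p pp)).
  have c1 : taylor (c (Fr p)) 0%N = 1 by rewrite -Qc taylor0.
  split; [exact: (residual_coef_good N b pp (FrP p pp) I1 pr Qc)|exact: factor_coef0|].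
  apply: factor_coef_vanish => //; first by move=> W; exact: (det_poly_coef0 (irr_repr W (Fr p))).
  move=> m; apply: etrans (bE m _ Gg) _; apply: (congr1 -%R).
  apply: eq_big_nat => n /andP[n0 _]; apply: eq_bigr => W _.
  by apply: (congr1 (fun z => b n W * z)); exact: (fps_log_det_inflate (Fr p) W).
have eval p s : prime p -> eps < complex.Re s ->
    abs_summable (fun m => f p m * npow p (- s) ^+ m) /\
    sums_to (fun m => f p m * npow p (- s) ^+ m) (residual_factor Q r eps b (P p) (Fr p) p s).
  move=> pp es; exact: (residual_factor_eval b pp (FrP p pp) r0 e0 es (Qe p pp)).
have euler s : eps < complex.Re s -> exists D, let a m := euler_coef f m.+2 m in
    [/\ abs_summable (fun m => a m * npow m.+1 (- s)),
        sums_to (fun m => a m * npow m.+1 (- s)) D &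
        tends (fun K => \prod_(0 <= p < K | prime p)
          residual_factor Q r eps b (P p) (Fr p) p s) D].
  move=> es; have s0 : 0 < complex.Re s := lt_trans e0 es.
  have Ns : 1 < N.+1%:R * complex.Re s.
    rewrite -ltr_pdivrMr// mul1r; apply: lt_trans (truncnS_gt eps^-1).
    by rewrite ltf_pV2 ?posrE.
  have [t [T [ft tT]]] := local_bounds s0 Ns fFg (fun p pp => (eval p s pp es).1).
  have := @euler_product R f (- s)
    (fun p => residual_factor Q r eps b (P p) (Fr p) p s) t T f0
    (fun p pp => (eval p s pp es).2) ft tT.
  exact.
(* primes above [m + 1] do not contribute to the coefficient of [(m + 1) ^ - s] *)
pose a m := euler_coef f m.+2 m.
have /boolp.choice[D DP] : forall s : Cplx R, exists D : Cplx R, eps < complex.Re s ->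
    [/\ abs_summable (fun m => a m * npow m.+1 (- s)),
        sums_to (fun m => a m * npow m.+1 (- s)) D &
        tends (fun K => \prod_(0 <= p < K | prime p)
          residual_factor Q r eps b (P p) (Fr p) p s) D].
  move=> s; have [es|_] := boolP (eps < complex.Re s); last by exists 0.
  by have [D hD] := euler s es; exists D.
exists a, D; split.
  by apply: (@dirichlet_holomorphic R a D eps) => s /DP[h1 h2 _].
move=> s /DP[h1 h2 h3]; split.
- exact: abs_summable_cvg h1.
- exact: sums_to_cvg h2.
- exact: tends_cvg h3.
Qed.
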